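(* Let $f$ be a complex polynomial of degree $d\geq 2$ not conformally conjugate to $z^d$, and let $S_{f^n}dz^2$ be the meromorphic quadratic differential on $\mathbb{P}^1$ determined by the Schwarzian derivative of $f^n$. Then $$\lim_{n\to\infty}\frac{S_{f^n}(z)}{d^{2n}}dz^2=-2\left(\frac{\partial G_f(z)}{\partial z}\right)^2dz^2$$ on the Fatou set of $f$ (including $\infty$), the convergence being in the sense of $L^{1/2}_{loc}$.
   Context: $f^n$ is the $n$-th iterate; $S_h=\frac{h'''}{h'}-\frac32\left(\frac{h''}{h'}\right)^2$. $G_f(z)=\lim_{n\to\infty}d^{-n}\log^+|f^n(z)|$. A meromorphic quadratic differential on a Riemann surface $S$ is given locally by $h(z)dz^2$ with $h$ meromorphic, transforming by $h_2(w(z))w'(z)^2=h_1(z)$. It is $L^{1/2}_{loc}$ integrable if every point of $S$ has a local coordinate $z=x+iy$ in which, writing it as $h(z)dz^2$, $\iint\sqrt{|h|}\,dx\,dy<\infty$ over some neighborhood of the point. A sequence $\alpha_n$ of meromorphic quadratic differentials $L^{1/2}_{loc}$-converges to $\alpha$ if all $\alpha_n$ and $\alpha$ are $L^{1/2}_{loc}$ integrable and every point of $S$ has a local coordinate in which, writing $\alpha_n=h_n dz^2$, $\alpha=h\,dz^2$, one has $\iint\sqrt{|h_n-h|}\,dx\,dy\to0$ over some neighborhood of the point. Here $S$ is the Fatou set of $f$ in $\mathbb{P}^1$. *)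

(* Defs.v *)
From HB Require Import structures.
From mathcomp Require Import all_boot all_order all_algebra complex.
From mathcomp Require Import all_classical all_reals all_analysis.

Set Implicit Arguments.
Unset Strict Implicit.
Unset Printing Implicit Defensive.

Import Order.TTheory GRing.Theory Num.Theory.
Import numFieldNormedType.Exports.

Local Open Scope classical_set_scope.
Local Open Scope ring_scope.
Local Open Scope complex_scope.

Section Defs.
Variable R : realType.

(* [R[i]^o] is [R[i]] seen as a normed module over itself: [derivable] and
   [derive1] on it are complex differentiability and the complex derivative. *)
Local Notation C := (R[i]^o).

Definition cabs (z : C) : R := complex.Re `|z|.

(* [None] is the point at infinity. *)
Local Notation sphere := (one_point_compactification C).

Definition affine_coord (p : sphere) : C := odflt 0 p.

Definition sphere_inv (p : sphere) : sphere :=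
  if p is Some z then (if z == 0 then None else Some z^-1) else Some 0.

Definition chordal (p q : sphere) : R :=
  match p, q with
  | Some z, Some w => 2 * cabs (z - w) /
      (Num.sqrt (1 + cabs z ^+ 2) * Num.sqrt (1 + cabs w ^+ 2))
  | Some z, None | None, Some z => 2 / Num.sqrt (1 + cabs z ^+ 2)
  | None, None => 0
  end.

(* To be used at all the points of an open set. Continuity keeps [psi] away
   from the point where the chosen chart of the sphere is not defined. *)
Definition holomorphic_at (psi : C -> sphere) (t : C) : Prop :=
  {for t, continuous psi} /\
  if psi t is Some _ then derivable (affine_coord \o psi : C -> C) t 1
  else derivable (affine_coord \o sphere_inv \o psi : C -> C) t 1.

Definition conformal_automorphism (M : sphere -> sphere) : Prop :=
  [/\ bijective M,
      forall z : C, holomorphic_at (M \o Some) z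
    & holomorphic_at (M \o sphere_inv \o Some) 0].

Definition conformally_conjugate (F G : sphere -> sphere) : Prop :=
  exists M, conformal_automorphism M /\ forall p, M (F p) = G (M p).

(* Infinity is fixed, so [f] is meant to be nonconstant. *)
Definition poly_sphere (f : {poly R[i]}) (p : sphere) : sphere :=
  if p is Some z then Some f.[z] else None.

Definition cvg_locally_uniformly (U : set sphere)
    (F : nat -> sphere -> sphere) (G : sphere -> sphere) : Prop :=
  forall p, U p -> exists W, nbhs p W /\
    forall e : R, 0 < e -> exists N : nat, forall n : nat, (N <= n)%N ->
      forall q, W q -> chordal (F n q) (G q) < e.

Definition normal_family (U : set sphere) (F : nat -> sphere -> sphere) : Prop :=
  forall s : nat -> nat, exists k : nat -> nat,
    {homo k : i j / (i < j)%N} /\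
    exists G, cvg_locally_uniformly U (fun j => F (s (k j))) G.

Definition fatou_set (f : {poly R[i]}) : set sphere :=
  [set p | exists U, [/\ open U, U p &
     normal_family U (fun n => iter n (poly_sphere f))]].

Definition schwarzian (h : C -> C) (z : C) : C :=
  h^`(3)%classic z / h^`()%classic z
    - 3 / 2 * (h^`(2)%classic z / h^`()%classic z) ^+ 2.

(* [ln 0 = 0] in the library, as needed here. *)
Definition log_plus (x : R) : R := Num.max 0 (ln x).

Definition green (f : {poly R[i]}) (z : C) : R :=
  let d := (size f).-1 in
  lim ((fun n : nat =>
    d%:R ^- n * log_plus (cabs (iter n (horner f) z))) @ \oo).

(* The Wirtinger derivative of [G] with respect to [z = x + iy]. *)
Definition d_dz (G : C -> R) (z : C) : C :=
  let Gx := (fun x : R => G (x +i* complex.Im z))^`()%classic (complex.Re z) in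
  let Gy := (fun y : R => G (complex.Re z +i* y))^`()%classic (complex.Im z) in
  2^-1 * (Gx -i* Gy).

(** Quadratic differentials on an open subset [S] of the sphere.

   A local coordinate [w] is given by its inverse [psi], defined on the open
   set [V] of values of [w]. A differential is represented by its coefficient
   [h] in the affine coordinate [z]; the transformation law then determines its
   coefficient [qd_coef h psi] in every other coordinate. The values of [h] at
   the poles, and of [qd_coef h psi] where [psi] is infinite, are irrelevant. *)

Definition local_coordinate (S : set sphere) (V : set C) (psi : C -> sphere)
  : Prop :=
  [/\ open V, set_inj V psi, psi @` V `<=` S
    & forall t, V t -> holomorphic_at psi t].

Definition qd_coef (h : C -> C) (psi : C -> sphere) (t : C) : C :=
  h (affine_coord (psi t)) * ((affine_coord \o psi : C -> C)^`()%classic t) ^+ 2.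

Definition meromorphic_at (h : C -> C) (t0 : C) : Prop :=
  exists (m : nat) (g : C -> C),
    (\forall t \near t0, derivable g t 1) /\
    (\forall t \near t0^', (t - t0) ^+ m * h t = g t).

Definition meromorphic_qd (S : set sphere) (h : C -> C) : Prop :=
  forall V psi, local_coordinate S V psi ->
    forall t, V t -> meromorphic_at (qd_coef h psi) t.

Definition int_sqrt (N : set C) (k : C -> C) : \bar R :=
  (\int[(@lebesgue_measure R) \x (@lebesgue_measure R)]_(p in
       [set p : R * R | N (p.1 +i* p.2)])
     (Num.sqrt (cabs (k (p.1 +i* p.2))))%:E)%E.

Definition L12_loc_integrable (S : set sphere) (h : C -> C) : Prop :=
  forall p, S p -> exists V psi t N,
    [/\ local_coordinate S V psi, V t /\ psi t = p,
        [/\ open N, N t & N `<=` V]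
      & (int_sqrt N (qd_coef h psi) < +oo)%E].

Definition L12_loc_cvg (S : set sphere) (a : nat -> C -> C) (b : C -> C)
  : Prop :=
  [/\ forall n, meromorphic_qd S (a n) /\ L12_loc_integrable S (a n),
      meromorphic_qd S b /\ L12_loc_integrable S b
    & forall p, S p -> exists V psi t N,
        [/\ local_coordinate S V psi, V t /\ psi t = p,
            [/\ open N, N t & N `<=` V]
          & (fun n => int_sqrt N
               (fun t => qd_coef (a n) psi t - qd_coef b psi t)) @ \oo
            --> 0%E]].

End Defs.

(* Main.v *)
Require Import Defs.
From HB Require Import structures.
From mathcomp Require Import all_boot all_order all_algebra complex.
From mathcomp Require Import all_classical all_reals all_analysis.
From mathcomp Require Import measurable_realfun.
From mathcomp Require Import ring lra.

Set Implicit Arguments.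
Unset Strict Implicit.
Unset Printing Implicit Defensive.

Import Order.TTheory GRing.Theory Num.Theory.
Import numFieldNormedType.Exports.

Local Open Scope classical_set_scope.
Local Open Scope ring_scope.

(** Write $L = 2 \partial G$. Near infinity $(f^n)'/(d^n f^n)$ converges to $L$ at the rate
   $2^{-n}$, and the chain rule $S_{f \circ g} = (S_f \circ g) g'^2 + S_g$ turns this into
   $d^{-2n} S_{f^n} = -L^2/2 + O(2^{-n} |z|^{-2})$. Pulling back by a fixed iterate $f^m$ gives
   the convergence on the basin of infinity, with finitely many double poles, whose square
   roots have small integrals.

   Around any other Fatou point the orbits stay bounded, $G = 0$, and one has to show that
   $d^{-2n} S_{f^n}$ tends to $0$. By the chain rule
   $\sqrt{|S_{f^n}|} \le 2 \sum_{k<n} \sum_{f'(c)=0} |(f^k)'| / |f^k - c|$. A polynomial $g$ with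
   $|g| \le M$ on a disc and $|g| \ge \eta$ at some point near the centre satisfies
   $|g'/g| \le \sum_{j} 1/|z - z_j| + C \log(M/\eta)$ on a smaller disc, the $z_j$ being
   $O(\log(M/\eta))$ zeros of $g$ (Jensen and Borel-Caratheodory). For $g = f^k - c$ one may
   take $\log(1/\eta) = o(d^k)$: since $f$ is not conjugate to a power, no fibre of
   $h = f \circ f$ is a single point, so $h$ shrinks small distances at worst like
   $r \mapsto c r^{d^2 - 1}$, and iterating costs an exponent of order $(d^2-1)^{k/2}$. *)

(** * Complex differentiability *)

(** The square root makes the sums tractable: it is subadditive, it turns the squared factor of the
    chain rule into [|(f^k)'|], and it turns double poles into [1 / |z - c|], whose integral over a
    box is bounded independently of [c]. At finite points every estimate has the form
    [a + b \sum_(c in S) 1 / |z - c|], and convergence amounts to [a + b |S| -> 0].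

    The obstacle lies around bounded orbits. With multiplicity [f^n] has [d^n - 1] critical points,
    each carrying a pole of weight of order [1], and division by [d^n] merely balances their number:
    what is needed is that a small disc sees only [o(d^n)] of them. For [z^d] they all sit at [0],
    and the conclusion fails: [S_{f^n} = (1 - d^{2n}) / (2 z^2)] while [G = 0] on the unit disc. A
    point where [f] alone is totally ramified is harmless if its image is not, as [0] for [z^2 + 1];
    hence the passage to the second iterate. *)

Section Modulus.
Variable R : realType.
Local Notation C := R[i].
Implicit Types (z w : C) (f g : C -> C).

(* The algebra is done in [R[i]], where the canonical structures are better
   behaved than in [R[i]^o]; [cmod] and [cnbhs] restate the norm and the
   topology of the latter. *)
Definition cmod z : R := complex.Re `|z|.

Lemma normcE z : `|z| = (cmod z)%:C%C.
Proof. by case: z => a b; rewrite /cmod /=. Qed.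

Lemma cmod_ge0 z : 0 <= cmod z.
Proof. by rewrite -lecR -normcE normr_ge0. Qed.

Lemma cmodM z w : cmod (z * w) = cmod z * cmod w.
Proof. by apply: (@complexI R); rewrite rmorphM /= -!normcE normrM. Qed.

Lemma cmod0 : cmod (0 : C) = 0.
Proof. by apply: (@complexI R); rewrite -normcE normr0. Qed.

Lemma cmod1 : cmod (1 : C) = 1.
Proof. by apply: (@complexI R); rewrite -normcE normr1. Qed.

Lemma cmodN z : cmod (- z) = cmod z.
Proof. by apply: (@complexI R); rewrite -!normcE normrN. Qed.

Lemma cmodC z w : cmod (z - w) = cmod (w - z).
Proof. by rewrite -cmodN opprB. Qed.

Lemma cmodV z : cmod (z^-1) = (cmod z)^-1.
Proof. by apply: (@complexI R); rewrite fmorphV /= -!normcE normfV. Qed.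

Lemma cmodX z n : cmod (z ^+ n) = cmod z ^+ n.
Proof. by apply: (@complexI R); rewrite rmorphXn /= -!normcE normrX. Qed.

Lemma cmod_eq0 z : (cmod z == 0) = (z == 0).
Proof. by rewrite -[z == 0]normr_eq0 normcE -(inj_eq (@complexI R)). Qed.

Lemma cmod_gt0 z : (0 < cmod z) = (z != 0).
Proof. by rewrite lt_def cmod_ge0 andbT cmod_eq0. Qed.

Lemma cmodD z w : cmod (z + w) <= cmod z + cmod w.
Proof. by rewrite -lecR rmorphD /= -!normcE ler_normD. Qed.

Lemma cmod_real (x : R) : cmod (x%:C%C : C) = `|x|.
Proof. by rewrite /cmod /= expr0n addr0 sqrtr_sqr. Qed.

Lemma cmod_nat n : cmod (n%:R : C) = n%:R.
Proof. by rewrite -(rmorph_nat (real_complex R)) /= cmod_real ger0_norm. Qed.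

Lemma cmod_sum (I : Type) (r : seq I) (P : pred I) (F : I -> C) :
  cmod (\sum_(i <- r | P i) F i) <= \sum_(i <- r | P i) cmod (F i).
Proof.
elim/big_ind2 : _ => [|x1 x2 y1 y2 h1 h2|//]; first by rewrite cmod0.
by apply: le_trans (cmodD _ _) _; apply: lerD.
Qed.

Lemma cmod_prod (I : Type) (r : seq I) (P : pred I) (F : I -> C) :
  cmod (\prod_(i <- r | P i) F i) = \prod_(i <- r | P i) cmod (F i).
Proof. exact: (big_morph _ cmodM cmod1). Qed.

Lemma Re_le_cmod z : `|complex.Re z| <= cmod z.
Proof.
case: z => a b; rewrite /cmod /= -(sqrtr_sqr a) ler_wsqrtr// lerDl; exact: sqr_ge0.
Qed.

Lemma Im_le_cmod z : `|complex.Im z| <= cmod z.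
Proof.
case: z => a b; rewrite /cmod /= -(sqrtr_sqr b) ler_wsqrtr// lerDr; exact: sqr_ge0.
Qed.

Lemma cmod_le_ReIm z : cmod z <= `|complex.Re z| + `|complex.Im z|.
Proof.
rewrite [z in cmod z]complexE; apply: le_trans (cmodD _ _) _.
rewrite cmodM !cmod_real.
suff -> : cmod ('i%C : C) = 1 by rewrite mul1r.
by rewrite /cmod /= expr0n add0r expr1n sqrtr1.
Qed.

Lemma cmod_sqr z : cmod z ^+ 2 = complex.Re z ^+ 2 + complex.Im z ^+ 2.
Proof. by case: z => a b; rewrite /cmod /= sqr_sqrtr // addr_ge0 ?sqr_ge0. Qed.

Lemma cmodB_le z w : cmod z - cmod w <= cmod (z - w).
Proof. by rewrite lerBlDr; apply: le_trans (cmodD _ _); rewrite subrK. Qed.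

Lemma cabsE (z : R[i]^o) : cabs z = cmod z.
Proof. by []. Qed.

Definition cnbhs z : set_system C :=
  fun P => exists2 r : R, 0 < r & forall w, cmod (w - z) < r -> P w.

Global Instance cnbhs_filter z : ProperFilter (cnbhs z).
Proof.
apply: Build_ProperFilter_ex.
  by move=> P [r r0 H]; exists z; apply: H; rewrite subrr cmod0.
split=> [|P Q [r r0 Hr] [s s0 Hs]|P Q PQ [r r0 Hr]].
- by exists 1.
- exists (Num.min r s); first by rewrite lt_min r0.
  by move=> w; rewrite lt_min => /andP[/Hr ? /Hs ?].
- by exists r => // w /Hr /PQ.
Qed.

Lemma cnbhs_singleton z (P : set C) : cnbhs z P -> P z.
Proof. by move=> [r r0]; apply; rewrite subrr cmod0. Qed.

Lemma cnbhs_disc z (r : R) : 0 < r -> \forall w \near cnbhs z, cmod (w - z) < r.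
Proof. by exists r. Qed.

Lemma cnbhs_disc_in z0 (r : R) z : cmod (z - z0) < r ->
  \forall w \near cnbhs z, cmod (w - z0) < r.
Proof.
move=> zr; exists (r - cmod (z - z0)); first by rewrite subr_gt0.
move=> v Hv; rewrite -(subrK z v) -addrA; apply: le_lt_trans (cmodD _ _) _.
by rewrite -ltrBrDr.
Qed.

Lemma cnbhs_near z (P : set C) :
  cnbhs z P -> \forall w \near cnbhs z, cnbhs w P.
Proof.
move=> [r r0 Hr]; exists r => // w wr.
have [s s0 Hs] := cnbhs_disc_in wr; exists s => // v /Hs; exact: Hr.
Qed.

Definition cts f z := forall e : R, 0 < e ->
  \forall w \near cnbhs z, cmod (f w - f z) < e.

Lemma cts_cst k z : cts (fun=> k) z.
Proof. by move=> e e0; exists 1 => // w _; rewrite subrr cmod0. Qed.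

Lemma cts_id z : cts id z.
Proof. by move=> e e0; exists e. Qed.

Lemma ctsD f g z : cts f z -> cts g z -> cts (fun w => f w + g w) z.
Proof.
move=> cf cg e e0; have e2 : 0 < e / 2 by rewrite divr_gt0.
apply: filterS2 (cf _ e2) (cg _ e2) => w fe ge.
rewrite opprD addrACA; apply: le_lt_trans (cmodD _ _) _; lra.
Qed.

Lemma cts_bounded f z : cts f z ->
  exists2 M : R, 0 < M & \forall w \near cnbhs z, cmod (f w) < M.
Proof.
move=> cf; exists (cmod (f z) + 1); first by have := cmod_ge0 (f z); lra.
apply: filterS (cf 1 ltr01) => w H.
have := cmodB_le (f w) (f z); lra.
Qed.

Lemma ctsM f g z : cts f z -> cts g z -> cts (fun w => f w * g w) z.
Proof.
move=> cf cg e e0.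
have [M M0 HM] := cts_bounded cf.
pose N := cmod (g z) + 1.
have N0 : 0 < N by rewrite /N; have := cmod_ge0 (g z); lra.
have e1 : 0 < e / 2 / M by rewrite !divr_gt0.
have e2 : 0 < e / 2 / N by rewrite !divr_gt0.
apply: filterS3 HM (cf _ e2) (cg _ e1) => w fM fe ge.
have -> : f w * g w - f z * g z = f w * (g w - g z) + (f w - f z) * g z by ring.
apply: le_lt_trans (cmodD _ _) _; rewrite !cmodM.
have H1 : cmod (f w) * cmod (g w - g z) <= e / 2.
  apply: (@le_trans _ _ (M * (e / 2 / M))).
    by apply: ler_pM; rewrite ?cmod_ge0 ?ltW.
  by rewrite mulrCA mulfV ?mulr1 ?gt_eqF.
have H2 : cmod (f w - f z) * cmod (g z) < e / 2.
  apply: (@le_lt_trans _ _ (e / 2 / N * cmod (g z))).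
    by rewrite ler_wpM2r ?cmod_ge0 ?ltW.
  rewrite -[ltRHS](divfK (lt0r_neq0 N0)) ltr_pM2l //.
  by rewrite /N ltrDl.
lra.
Qed.

Lemma ctsN f z : cts f z -> cts (fun w => - f w) z.
Proof.
by move=> cf e e0; apply: filterS (cf e e0) => w; rewrite -opprD cmodN.
Qed.

Lemma ctsB f g z : cts f z -> cts g z -> cts (fun w => f w - g w) z.
Proof. by move=> cf cg; exact: ctsD cf (ctsN cg). Qed.

Lemma cts_neq0 f z : cts f z -> f z != 0 ->
  \forall w \near cnbhs z, cmod (f z) / 2 < cmod (f w).
Proof.
move=> cf fz; have fz0 : 0 < cmod (f z) by rewrite cmod_gt0.
have e1 : 0 < cmod (f z) / 2 by rewrite divr_gt0.
apply: filterS (cf _ e1) => w; rewrite cmodC.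
have := cmodB_le (f z) (f w); lra.
Qed.

Lemma near_neq0 f z : cts f z -> f z != 0 -> \forall w \near cnbhs z, f w != 0.
Proof.
move=> cf fz; apply: filterS (cts_neq0 cf fz) => w H.
by rewrite -cmod_gt0 (le_lt_trans _ H) // divr_ge0 ?cmod_ge0.
Qed.

Lemma ctsV f z : f z != 0 -> cts f z -> cts (fun w => (f w)^-1) z.
Proof.
move=> fz cf e e0; pose m := cmod (f z).
have m0 : 0 < m by rewrite /m cmod_gt0.
have e1 : 0 < e * (m * (m / 2)) by rewrite !mulr_gt0 ?invr_gt0.
apply: filterS3 (near_neq0 cf fz) (cts_neq0 cf fz) (cf _ e1) => w fw fm fe.
have -> : (f w)^-1 - (f z)^-1 = (f z - f w) / (f z * f w).
  by field; rewrite fz fw.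
rewrite cmodM cmodV cmodM cmodC ltr_pdivrMr ?mulr_gt0 ?cmod_gt0 //.
apply: lt_trans fe _; rewrite ltr_pM2l // ltr_pM2l ?cmod_gt0 //.
Qed.

Lemma cts_comp f g z : cts f z -> cts g (f z) -> cts (fun w => g (f w)) z.
Proof.
move=> cf cg e e0; have [r r0 Hr] := cg e e0.
by apply: filterS (cf r r0) => w /Hr.
Qed.

Lemma cts_near f g z : (\forall w \near cnbhs z, f w = g w) -> cts f z -> cts g z.
Proof.
move=> fg cf e e0; have fgz := cnbhs_singleton fg.
by apply: filterS2 fg (cf e e0) => w <-; rewrite fgz.
Qed.

Lemma nbhs_cnbhs z (P : set C) : @nbhs _ R[i]^o z P <-> cnbhs z P.
Proof.
split.
  move=> /nbhs_ballP[e /= e0 He].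
  (* Radii in [R[i]^o] are complex numbers; positivity forces their imaginary part to vanish. *)
  have eE : e = (complex.Re e)%:C%C.
    by move: e0; rewrite ltcE /= => /andP[/eqP]; case: (e) => a b /= ->.
  exists (complex.Re e); first by move: e0; rewrite {1}eE ltcR.
  move=> w Hw; apply: He; rewrite -ball_normE /=.
  suff : (cmod (z - w))%:C%C < (complex.Re e)%:C%C by rewrite -normcE -eE.
  by rewrite ltcR cmodC.
move=> [r r0 Hr]; apply/nbhs_ballP; exists (r%:C%C); first by rewrite /= ltcR.
move=> w; rewrite -ball_normE /= => H; apply: Hr; rewrite cmodC -ltcR.
by rewrite -normcE.
Qed.

End Modulus.

(** * Complex derivatives *)

Section ComplexDerivative.
Variable R : realType.
Local Notation C := R[i].
Local Notation Co := (R[i]^o).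
Implicit Types (f g : C -> C) (z w l : C).

(* Caratheodory's form of complex differentiability: the difference quotient
   extends continuously; sums, products and composites are then immediate. *)
Definition cder f z l : Prop := exists phi : C -> C,
  [/\ cts phi z, phi z = l &
      \forall w \near cnbhs z, f w - f z = phi w * (w - z)].

Definition cderivable f z := exists l, cder f z l.

Lemma cder_quotient f z l : cts (fun w => if w == z then l else (f w - f z) / (w - z)) z
  -> cder f z l.
Proof.
move=> H; exists (fun w => if w == z then l else (f w - f z) / (w - z)); split => //.
  by rewrite eqxx.
exists 1 => // w _; have [->|wz] := eqVneq w z; first by rewrite !subrr mulr0.
by rewrite divfK // subr_eq0.
Qed.

Lemma cder_cts f z l : cder f z l -> cts f z.
Proof.
move=> [phi [cphi _ Hphi]].
apply: (@cts_near _ (fun w => f z + phi w * (w - z))).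
  by apply: filterS Hphi => w <-; rewrite addrC subrK.
apply: ctsD; first exact: cts_cst.
by apply: ctsM => //; apply: ctsB; [exact: cts_id|exact: cts_cst].
Qed.

Lemma cder_epsP f z l : cder f z l <-> forall e : R, 0 < e ->
  \forall w \near cnbhs z, cmod (f w - f z - l * (w - z)) <= e * cmod (w - z).
Proof.
split=> [[phi [cphi phiz Hphi]] e e0|H].
  apply: filterS2 Hphi (cphi e e0) => w -> H.
  by rewrite -mulrBl cmodM ler_wpM2r ?cmod_ge0 // -phiz ltW.
apply: cder_quotient => e e0; rewrite eqxx.
have e20 : 0 < e / 2 by rewrite divr_gt0.
apply: filterS (H _ e20) => w Hw.
have [_|wz] := eqVneq w z; first by rewrite subrr cmod0.
have wz0 : w - z != 0 by rewrite subr_eq0.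
have -> : (f w - f z) / (w - z) - l = (f w - f z - l * (w - z)) / (w - z).
  by rewrite [RHS]mulrBl mulfK.
rewrite cmodM cmodV ltr_pdivrMr ?cmod_gt0 //.
apply: le_lt_trans Hw _.
rewrite ltr_pM2r ?cmod_gt0 //; lra.
Qed.

Lemma cder_unique f z l k : cder f z l -> cder f z k -> l = k.
Proof.
move=> /cder_epsP Hl /cder_epsP Hk; apply/eqP; rewrite -subr_eq0 -cmod_eq0.
rewrite eq_le cmod_ge0 andbT; apply/ler_addgt0Pr => e e0; rewrite add0r.
have e2 : 0 < e / 2 by rewrite divr_gt0.
have [r r0 H] : \forall w \near cnbhs z,
    cmod (f w - f z - l * (w - z)) <= e / 2 * cmod (w - z) /\
    cmod (f w - f z - k * (w - z)) <= e / 2 * cmod (w - z).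
  by apply: filterS2 (Hl _ e2) (Hk _ e2).
pose h : C := (r / 2)%:C%C.
have ch : cmod h = r / 2 by rewrite /h cmod_real ger0_norm // ltW ?divr_gt0.
have [H1 H2] : cmod (f (h + z) - f z - l * h) <= e / 2 * cmod h /\
    cmod (f (h + z) - f z - k * h) <= e / 2 * cmod h.
  by have := H (h + z); rewrite addrK; apply; rewrite ch; lra.
have h0 : 0 < cmod h by rewrite ch divr_gt0.
rewrite -(ler_pM2r h0) -cmodM.
have -> : (l - k) * h = (f (h + z) - f z - k * h) - (f (h + z) - f z - l * h) by ring.
apply: le_trans (cmodD _ _) _; rewrite cmodN; lra.
Qed.

(** The bridge to the derivative used in the statement, which is a limit of difference quotients
    along the punctured neighbourhoods of [0] in [R[i]^o]. *)
Lemma cderP f z l : cder f z l <-> is_derive (z : Co) (1 : Co) (f : Co -> Co) l.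
Proof.
have sup (g : Co -> Co) k : g @ (0:Co)^' --> k <->
    forall e : R, 0 < e -> \forall w \near cnbhs (0 : C), w != 0 -> cmod (g w - k) < e.
  split=> [H e e0|H P /nbhs_cnbhs [e e0 He]].
    have /H : nbhs k [set w : Co | cmod (w - k) < e] by apply/nbhs_cnbhs; exists e.
    rewrite /nbhs/= /dnbhs /within /=; rewrite near_simpl => /nbhs_cnbhs.
    exact.
  rewrite /nbhs/= /dnbhs /within /=; rewrite near_simpl; apply/nbhs_cnbhs.
  apply: filterS (H e e0) => w Hw w0; apply: He; exact: Hw.
have main : cder f z l <->
  (fun h : Co => h^-1 *: (((f : Co -> Co) \o shift z) (h *: (1:Co)) - f z)) @ (0:Co)^' --> (l : Co).
  have E (h : C) : h^-1 *: (((f : Co -> Co) \o shift (z : Co)) ((h : Co) *: (1:Co)) - (f z : Co))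
      = h^-1 * (f (h + z) - f z).
    by rewrite /GRing.scale /= mulr1.
  have E2 (h a : C) : h != 0 -> h^-1 * a - l = h^-1 * (a - l * h).
    by move=> h0; rewrite [RHS]mulrBr [h^-1 * (l * h)]mulrCA mulVf ?mulr1.
  split=> [/cder_epsP H|/sup H].
    apply/sup => e e0; have e2 : 0 < e / 2 by rewrite divr_gt0.
    have [r r0 Hr] := H _ e2; exists r => // h; rewrite subr0 => hr h0.
    rewrite E.
    have := Hr (h + z); rewrite addrK => /(_ hr) Hh.
    have -> := E2 h (f (h + z) - f z) h0.
    rewrite cmodM cmodV mulrC ltr_pdivrMr ?cmod_gt0 //.
    apply: le_lt_trans Hh _; rewrite ltr_pM2r ?cmod_gt0 //; lra.
  apply: cder_quotient => e e0; rewrite eqxx.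
  have [r r0 Hr] := H _ e0; exists r => // w wr.
  have [_|wz] := eqVneq w z; first by rewrite subrr cmod0.
  have := Hr (w - z); rewrite subr0 subr_eq0 E subrK mulrC => /(_ wr wz); exact.
split=> [/main H|[H1 H2]].
  split; first by apply/cvg_ex; exists l.
  by apply: cvg_lim.
by apply/main; rewrite -H2; exact: H1.
Qed.

Lemma cderE f z l : cder f z l -> derive1 (f : Co -> Co) z = l.
Proof. by move=> /cderP H; rewrite derive1E derive_val. Qed.

Lemma cderivableP f z : derivable (f : Co -> Co) z 1 <-> cderivable f z.
Proof.
split=> [H|[l /cderP [] H _]]; last exact: H.
exists (derive1 (f : Co -> Co) z); apply/cderP.
split; first exact: H.
by rewrite derive1E.
Qed.

Lemma cder_derive1 f z : cderivable f z -> cder f z (derive1 (f : Co -> Co) z).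
Proof. by move=> [l fl]; rewrite (cderE fl). Qed.

Lemma cder_cst k z : cder (fun=> k) z 0.
Proof.
exists (fun=> 0); split => //; first exact: cts_cst.
by exists 1 => // w _; rewrite subrr mul0r.
Qed.

Lemma cder_id z : cder id z 1.
Proof.
exists (fun=> 1); split => //; first exact: cts_cst.
by exists 1 => // w _; rewrite mul1r.
Qed.

Lemma cderD f g z l k : cder f z l -> cder g z k ->
  cder (fun w => f w + g w) z (l + k).
Proof.
move=> [p [cp pz Hp]] [q [cq qz Hq]]; exists (fun w => p w + q w).
split; [exact: ctsD|by rewrite pz qz|].
by apply: filterS2 Hp Hq => w Ep Eq; rewrite opprD addrACA mulrDl Ep Eq.
Qed.

Lemma cderM f g z l k : cder f z l -> cder g z k ->
  cder (fun w => f w * g w) z (l * g z + f z * k).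
Proof.
move=> df dg; have cg := cder_cts dg.
move: df dg => [p [cp pz Hp]] [q [cq qz Hq]].
exists (fun w => p w * g w + f z * q w); split.
- exact: ctsD (ctsM cp cg) (ctsM (cts_cst (f z) z) cq).
- by rewrite pz qz.
apply: filterS2 Hp Hq => w Ep Eq.
transitivity ((f w - f z) * g w + f z * (g w - g z)); first by ring.
by rewrite Ep Eq; ring.
Qed.

Lemma cderZ k f z l : cder f z l -> cder (fun w => k * f w) z (k * l).
Proof.
by move=> df; have := cderM (cder_cst k z) df; rewrite mul0r add0r.
Qed.

Lemma cder_near f g z l : (\forall w \near cnbhs z, f w = g w) ->
  cder f z l -> cder g z l.
Proof.
move=> fg [p [cp pz Hp]]; exists p; split => //.
have fgz := cnbhs_singleton fg.
by apply: filterS2 fg Hp => w <-; rewrite -fgz.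
Qed.

Lemma cder_ext f g z l : f =1 g -> cder f z l -> cder g z l.
Proof. by move=> /funext ->. Qed.

Lemma cderN f z l : cder f z l -> cder (fun w => - f w) z (- l).
Proof.
move=> /(cderZ (-1)); rewrite mulN1r; apply: cder_ext => w.
by rewrite mulN1r.
Qed.

Lemma cderB f g z l k : cder f z l -> cder g z k ->
  cder (fun w => f w - g w) z (l - k).
Proof. by move=> df /cderN; exact: cderD. Qed.

Lemma cderX f z l n : cder f z l ->
  cder (fun w => f w ^+ n) z (n%:R * f z ^+ n.-1 * l).
Proof.
move=> df; elim: n => [|n IH]; first by rewrite !mul0r; exact: cder_cst.
have := cderM df IH => /=.
rewrite (_ : l * _ + _ = n.+1%:R * f z ^+ n * l).
  by apply: cder_ext => w; rewrite exprS.
case: n {IH} => [|n]; first by rewrite expr0; ring.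
by rewrite /= exprS -!natr1; ring.
Qed.

Lemma cderV f z l : f z != 0 -> cder f z l ->
  cder (fun w => (f w)^-1) z (- l / f z ^+ 2).
Proof.
move=> fz df; have cf := cder_cts df; have nf := near_neq0 cf fz.
move: df => [p [cp pz Hp]].
exists (fun w => - p w / (f w * f z)); split.
- apply: (ctsM (ctsN cp)); apply: ctsV; first exact: mulf_neq0.
  exact: ctsM cf (cts_cst (f z) z).
- by rewrite pz expr2.
apply: filterS2 nf Hp => w fw E1.
transitivity (- (f w - f z) / (f w * f z)); last by rewrite E1; ring.
by field; rewrite fz fw.
Qed.

Lemma cder_comp f g z l k : cder f z l -> cder g (f z) k ->
  cder (fun w => g (f w)) z (k * l).
Proof.
move=> df dg; have cf := cder_cts df.
move: df dg => [p [cp pz Hp]] [q [cq qz [r r0 Hq]]].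
exists (fun w => q (f w) * p w); split.
- exact: ctsM (cts_comp cf cq) cp.
- by rewrite pz qz.
by apply: filterS2 Hp (cf r r0) => w E1 /Hq ->; rewrite E1 mulrA.
Qed.

Lemma cder_horner (p : {poly R[i]}) z : cder (horner p) z p^`().[z].
Proof.
elim/poly_ind : p => [|p c IH].
  rewrite deriv0 horner0; apply: cder_ext (cder_cst 0 z) => w.
  by rewrite horner0.
rewrite derivD derivM derivX derivC addr0 mulr1 hornerD hornerM hornerX.
have := cderD (cderM IH (cder_id z)) (cder_cst c z).
rewrite addr0 mulr1; apply: cder_ext => w.
by rewrite hornerD hornerM hornerX hornerC.
Qed.

Lemma cts_horner (p : {poly R[i]}) z : cts (horner p) z.
Proof. exact: cder_cts (cder_horner p z). Qed.

Lemma derive1_hornerC (p : {poly R[i]}) :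
  derive1 (horner p : Co -> Co) = horner p^`().
Proof. by apply/funext => z; exact: cderE (cder_horner p z). Qed.

End ComplexDerivative.

(** * Limits of complex sequences *)

Section ComplexLimits.
Variable R : realType.
Local Notation C := R[i].
Implicit Types (u v : nat -> C) (l k : C).

Definition clim u l := forall e : R, 0 < e ->
  exists N, forall n, (N <= n)%N -> cmod (u n - l) <= e.

Lemma clim_unique u l k : clim u l -> clim u k -> l = k.
Proof.
move=> ul uk; apply/eqP; rewrite -subr_eq0 -cmod_eq0.
rewrite eq_le cmod_ge0 andbT; apply/ler_addgt0Pr => e e0; rewrite add0r.
have e2 : 0 < e / 2 by rewrite divr_gt0.
have [N HN] := ul _ e2; have [M HM] := uk _ e2.
have := HN (maxn N M) (leq_maxl _ _); have := HM (maxn N M) (leq_maxr _ _).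
set w := u _ => H1 H2.
have -> : l - k = (w - k) - (w - l) by ring.
apply: le_trans (cmodD _ _) _; rewrite cmodN; lra.
Qed.

Lemma clim_cst l : clim (fun=> l) l.
Proof. by move=> e e0; exists 0%N => n _; rewrite subrr cmod0 ltW. Qed.

Lemma climD u v l k : clim u l -> clim v k -> clim (fun n => u n + v n) (l + k).
Proof.
move=> ul vk e e0; have e2 : 0 < e / 2 by rewrite divr_gt0.
have [N HN] := ul _ e2; have [M HM] := vk _ e2.
exists (maxn N M) => n; rewrite geq_max => /andP[/HN H1 /HM H2].
rewrite opprD addrACA; apply: le_trans (cmodD _ _) _; lra.
Qed.

Lemma climZ c u l : clim u l -> clim (fun n => c * u n) (c * l).
Proof.
move=> ul e e0; have c0 : 0 < cmod c + 1 by have := cmod_ge0 c; lra.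
have e2 : 0 < e / (cmod c + 1) by rewrite divr_gt0.
have [N HN] := ul _ e2; exists N => n /HN H.
rewrite -mulrBr cmodM; apply: (@le_trans _ _ ((cmod c + 1) * cmod (u n - l))).
  by rewrite ler_wpM2r ?cmod_ge0 // lerDl.
by rewrite mulrC -ler_pdivlMr.
Qed.

Lemma climN u l : clim u l -> clim (fun n => - u n) (- l).
Proof.
move=> ul e /ul[N HN]; exists N => n /HN.
by rewrite -opprD cmodN.
Qed.

Lemma clim_shift u l : clim u l -> clim (fun n => u n.+1) l.
Proof. by move=> ul e /ul[N HN]; exists N => n Nn; apply: HN; apply: leqW. Qed.

Lemma clim_le u l k (e : R) : clim u l -> (exists N, forall n, (N <= n)%N -> cmod (u n - k) <= e) ->
  cmod (l - k) <= e.
Proof.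
move=> ul [N HN]; apply/ler_addgt0Pr => d d0; have [M HM] := ul d d0.
have H1 := HN _ (leq_maxl N M); have H2 := HM _ (leq_maxr N M).
rewrite -(subrK (u (maxn N M)) l) -addrA; apply: le_trans (cmodD _ _) _.
by rewrite [cmod (l - _)]cmodC; lra.
Qed.

(** Completeness comes from [R], through the real and imaginary parts, both 1-Lipschitz for
    [cmod]. *)
Lemma clim_cauchy u : (forall e : R, 0 < e -> exists N, forall n (k : nat),
   (N <= n)%N -> cmod (u (n + k)%N - u n) <= e) -> exists l, clim u l.
Proof.
move=> H.
have aux (p : C -> R) : (forall z w, `|p z - p w| <= cmod (z - w)) ->
    exists l : R, forall e, 0 < e -> exists N, forall n, (N <= n)%N -> `|p (u n) - l| <= e.
  move=> Hp; have : cvg (p (u n) @[n --> \oo]).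
    apply/cauchy_cvgP/cauchy_exP => e e0.
    have e2 : 0 < e / 2 by rewrite divr_gt0.
    have [N HN] := H _ e2; exists (p (u N)); exists N => // n /= Nn.
    rewrite /ball /= (le_lt_trans (Hp _ _)) // cmodC -(subnKC Nn).
    by apply: le_lt_trans (HN _ _ (leqnn N)) _; lra.
  move=> /cvg_ex[l /cvgrPdist_le Hl]; exists l => e /Hl[N _ HN]; exists N => n Nn.
  by rewrite distrC; exact: HN.
have [z w|x Hx] := aux (@complex.Re R).
  have := Re_le_cmod (z - w); rewrite (_ : complex.Re (z - w) = complex.Re z - complex.Re w) //.
  by case: (z) (w) => ? ? [].
have [z w|y Hy] := aux (@complex.Im R).
  have := Im_le_cmod (z - w); rewrite (_ : complex.Im (z - w) = complex.Im z - complex.Im w) //.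
  by case: (z) (w) => ? ? [].
exists (x +i* y)%C => e e0; have e2 : 0 < e / 2 by rewrite divr_gt0.
have [N HN] := Hx _ e2; have [M HM] := Hy _ e2.
exists (maxn N M) => n; rewrite geq_max => /andP[/HN H1 /HM H2].
apply: le_trans (cmod_le_ReIm _) _.
move: H1 H2; case: (u n) => a b /=; lra.
Qed.

End ComplexLimits.

(** * Cauchy theory *)

Section SegmentIntegral.
Variable R : realType.
Local Notation C := R[i].
Implicit Types (f g : C -> C) (a b c z w : C).

Definition segment a b : set C :=
  [set z | exists2 t : R, 0 <= t <= 1 & z = a + t%:C%C * (b - a)].

Definition mid a b : C := (a + b) / 2.

(** The midpoint rule on the [2^n] dyadic pieces. Recursion on the two halves makes additivity at
    the midpoint exact at every level. *)
Fixpoint midsum f n a b : C :=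
  if n is n'.+1 then midsum f n' a (mid a b) + midsum f n' (mid a b) b
  else (b - a) * f (mid a b).

Definition cts_on (A : set C) f := forall z, A z -> cts f z.

Definition pint f a b : C := xget 0 [set l | clim (fun n => midsum f n a b) l].

Lemma midBl a b : mid a b - a = (b - a) / 2.
Proof. by rewrite /mid; field. Qed.

Lemma midBr a b : b - mid a b = (b - a) / 2.
Proof. by rewrite /mid; field. Qed.

Lemma midC a b : mid a b = mid b a.
Proof. by rewrite /mid addrC. Qed.

Lemma half_real : (2^-1 : R)%:C%C = 2^-1 :> C.
Proof. by rewrite fmorphV /= rmorph_nat. Qed.

Lemma segment_l a b : segment a b a.
Proof. by exists 0; rewrite ?lexx ?ler01 // rmorph0 mul0r addr0. Qed.

Lemma segment_r a b : segment a b b.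
Proof. by exists 1; rewrite ?lexx ?ler01 // rmorph1 mul1r addrC subrK. Qed.

Lemma segmentC a b : segment a b `<=` segment b a.
Proof.
move=> z [t /andP[t0 t1] ->]; exists (1 - t); first by apply/andP; split; lra.
by rewrite rmorphB rmorph1 /=; ring.
Qed.

Lemma mid_segment a b : segment a b (mid a b).
Proof.
exists 2^-1; first by apply/andP; split; lra.
by rewrite half_real /mid; field.
Qed.

Lemma segment_sub a b z w : segment a b z -> segment a b w ->
  segment z w `<=` segment a b.
Proof.
move=> [s /andP[s0 s1] ->] [t /andP[t0 t1] ->] _ [r /andP[r0 r1] ->].
exists (s + r * (t - s)).
  have -> : s + r * (t - s) = s * (1 - r) + t * r by ring.
  have H1 : 0 <= (1 - s) * (1 - r) by apply: mulr_ge0; lra.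
  have H2 : 0 <= (1 - t) * r by apply: mulr_ge0; lra.
  apply/andP; split; first by apply: addr_ge0; apply: mulr_ge0; lra.
  lra.
by rewrite rmorphD rmorphM rmorphB /=; ring.
Qed.

Lemma segment_dist a b z w : segment a b z -> segment a b w ->
  cmod (z - w) <= cmod (b - a).
Proof.
move=> [s /andP[s0 s1] ->] [t /andP[t0 t1] ->].
have -> : a + s%:C%C * (b - a) - (a + t%:C%C * (b - a)) = (s - t)%:C%C * (b - a).
  by rewrite rmorphB /=; ring.
rewrite cmodM cmod_real -[leRHS]mul1r ler_wpM2r ?cmod_ge0 //.
by rewrite ler_norml; apply/andP; split; lra.
Qed.

(** The compact set is one of real parameters, an interval or a square, mapped to the plane by [y];
    the near-covering form of compactness yields a common radius. The point [w] may leave the image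
    of [y], which later moves rely on. *)
Lemma compact_unif (T : topologicalType) (K : set T) (y : T -> C) f (e : R) :
  compact K -> (forall t, K t -> forall d : R, 0 < d -> \forall s \near t, cmod (y s - y t) < d) ->
  (forall t, K t -> cts f (y t)) -> 0 < e ->
  exists2 d : R, 0 < d & forall t w, K t -> cmod (w - y t) < d -> cmod (f w - f (y t)) < e.
Proof.
move=> cK cy cf e0; have e2 : 0 < e / 2 by rewrite divr_gt0.
move: cK; rewrite compact_near_coveringP.
move=> /(_ R (0 : R)^'+ (fun d t => forall w, cmod (w - y t) < d -> cmod (f w - f (y t)) < e)).
case => [t Kt|].
  have [r r0 Hr] := cf t Kt _ e2.
  have r2 : 0 < r / 2 by rewrite divr_gt0.
  near=> s d => w /= wd.
  have st : cmod (y s - y t) < r / 2 by near: s; exact: cy.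
  have dr : d < r / 2 by near: d; exact: nbhs_right_lt.
  have sr : cmod (y s - y t) < r by lra.
  have H1 := Hr _ sr.
  have H2 : cmod (f w - f (y t)) < e / 2.
    apply: Hr; rewrite -(subrK (y s) w) -addrA.
    by apply: le_lt_trans (cmodD _ _) _; lra.
  rewrite -(subrK (f (y t)) (f w)) -addrA; apply: le_lt_trans (cmodD _ _) _.
  rewrite [cmod (f (y t) - _)]cmodC; lra.
move=> d0 [/= d0pos Hd].
have dd : 0 < d0 / 2 by rewrite divr_gt0.
exists (d0 / 2) => // t w Kt; apply: (Hd (d0 / 2)) => //=.
by rewrite sub0r normrN gtr0_norm //; lra.
Unshelve. all: by end_near. Qed.

Lemma compact_bounded_image (T : topologicalType) (K : set T) (y : T -> C) f :
  compact K -> (forall t, K t -> forall d : R, 0 < d -> \forall s \near t, cmod (y s - y t) < d) ->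
  (forall t, K t -> cts f (y t)) ->
  exists2 M : R, 0 < M & forall t, K t -> cmod (f (y t)) <= M.
Proof.
move=> cK cy cf; move: cK; rewrite compact_near_coveringP.
move=> /(_ R +oo%R (fun M t => cmod (f (y t)) <= M)).
case => [t Kt|].
  have [r r0 Hr] := cf t Kt _ ltr01.
  near=> s M => /=.
  have H1 : cmod (f (y s) - f (y t)) < 1 by apply: Hr; near: s; exact: cy.
  have H2 : cmod (f (y t)) + 1 <= M by near: M; by apply: nbhs_pinfty_ge; exact: num_real.
  have := cmodB_le (f (y s)) (f (y t)); lra.
move=> M0 [_ HM].
exists (Num.max M0 0 + 1) => [|t Kt]; first by rewrite ltr_wpDl // le_max lexx orbT.
by apply: HM => //; rewrite (@le_lt_trans _ _ (Num.max M0 0)) ?le_max ?lexx // ltrDl.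
Unshelve. all: by end_near. Qed.

Lemma segment_path_cts a b (t d : R) : 0 < d ->
  \forall s \near t, cmod (a + s%:C%C * (b - a) - (a + t%:C%C * (b - a))) < d.
Proof.
move=> d0; pose m := cmod (b - a) + 1.
have m0 : 0 < m by rewrite /m; have := cmod_ge0 (b - a); lra.
apply/nbhs_ballP; exists (d / m); first by rewrite /= divr_gt0.
move=> s; rewrite /ball /= distrC => st.
have -> : a + s%:C%C * (b - a) - (a + t%:C%C * (b - a)) = (s - t)%:C%C * (b - a).
  by rewrite rmorphB /=; ring.
rewrite cmodM cmod_real; apply: (@le_lt_trans _ _ (`|s - t| * m)).
  by rewrite ler_wpM2l // /m lerDl.
by rewrite -ltr_pdivlMr.
Qed.

Lemma segment_unif f a b (e : R) : cts_on (segment a b) f -> 0 < e ->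
  exists2 d : R, 0 < d & forall z w, segment a b z -> cmod (w - z) < d ->
    cmod (f w - f z) < e.
Proof.
move=> cf e0.
have [||d d0 Hd] := compact_unif (y := fun t : R => a + t%:C%C * (b - a)) (f := f) (@segment_compact R 0 1) _ _ e0.
- by move=> t _ d d0; exact: segment_path_cts.
- by move=> t; rewrite /= in_itv /= => t01; apply: cf; exists t.
by exists d => // z w [t t01 ->]; apply: Hd; rewrite /= in_itv.
Qed.

Lemma segment_bounded f a b : cts_on (segment a b) f ->
  exists2 M : R, 0 < M & forall z, segment a b z -> cmod (f z) <= M.
Proof.
move=> cf.
have [||M M0 HM] := compact_bounded_image (y := fun t : R => a + t%:C%C * (b - a)) (f := f) (@segment_compact R 0 1).
- by move=> t _ d d0; exact: segment_path_cts.
- by move=> t; rewrite /= in_itv /= => t01; apply: cf; exists t.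
by exists M => // z [t t01 ->]; apply: HM; rewrite /= in_itv.
Qed.

Lemma disc_unif f z0 (r e : R) : (forall z, cmod (z - z0) <= 2 * r -> cts f z) -> 0 <= r -> 0 < e ->
  exists2 d : R, 0 < d & forall z w, cmod (z - z0) <= r -> cmod (w - z) < d ->
    cmod (f w - f z) < e.
Proof.
move=> cf r0 e0.
(* The square of half-side [r] contains the disc of radius [r] and lies in that of radius [2 * r],
   hence the hypothesis on the larger disc. *)
have cK : compact (`[- r, r]%classic `*` `[- r, r]%classic : set (R * R)).
  by apply: compact_setX; exact: segment_compact.
have [||d d0 Hd] := compact_unif (y := fun p : R * R => z0 + (p.1 +i* p.2)%C) (f := f) cK _ _ e0.
- move=> [s t] _ d d0.
  apply/nbhs_ballP; exists (d / 2); first by rewrite /= divr_gt0.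
  move=> [s' t'] [/= H1 H2]; rewrite /ball /= in H1 H2.
  rewrite opprD addrACA subrr add0r; apply: le_lt_trans (cmod_le_ReIm _) _ => /=.
  rewrite [`|s' - s|]distrC [`|t' - t|]distrC; lra.
- move=> [s t] [/=]; rewrite !in_itv /= => s1 t1; apply: cf.
  rewrite addrAC subrr add0r; apply: le_trans (cmod_le_ReIm _) _ => /=.
  rewrite -!ler_norml in s1 t1; lra.
exists d => // z w zr.
have E (x : C) : (complex.Re x +i* complex.Im x)%C = x by case: x.
have -> : z = z0 + ((complex.Re (z - z0)) +i* (complex.Im (z - z0)))%C.
  by rewrite E addrCA subrr addr0.
apply: (Hd (_, _)); split; rewrite /= in_itv /= -ler_norml; apply: le_trans zr.
  exact: Re_le_cmod.
exact: Im_le_cmod.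
Qed.

Lemma segment_halves a b :
  segment a (mid a b) `<=` segment a b /\ segment (mid a b) b `<=` segment a b.
Proof.
split; apply: segment_sub; [exact: segment_l|exact: mid_segment|
  exact: mid_segment|exact: segment_r].
Qed.

Lemma cmod_half z : cmod (z / 2) = cmod z / 2.
Proof. by rewrite cmodM cmodV cmod_nat. Qed.

Lemma midsum_bound f n a b c (e : R) :
  (forall z, segment a b z -> cmod (f z - c) <= e) ->
  cmod (midsum f n a b - (b - a) * c) <= e * cmod (b - a).
Proof.
elim: n a b => [|n IH] a b H /=.
  by rewrite -mulrBr cmodM mulrC ler_wpM2r ?cmod_ge0 // H //; exact: mid_segment.
have [s1 s2] := segment_halves a b.
have H1 := IH _ _ (fun z sz => H z (s1 z sz)).
have H2 := IH _ _ (fun z sz => H z (s2 z sz)).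
move: H1 H2; rewrite midBl midBr cmod_half => H1 H2.
set u := midsum _ _ _ _ in H1 *; set v := midsum _ _ _ _ in H2 *.
have -> : u + v - (b - a) * c = u - (b - a) / 2 * c + (v - (b - a) / 2 * c).
  by field.
apply: le_trans (cmodD _ _) _; lra.
Qed.

(** Refining by [k] levels only moves the evaluation points within each of the [2^n] pieces. *)
Lemma midsum_osc f n k a b (e : R) :
  (forall z w, segment a b z -> segment a b w ->
     cmod (w - z) <= cmod (b - a) / 2 ^+ n -> cmod (f w - f z) <= e) ->
  cmod (midsum f (n + k)%N a b - midsum f n a b) <= e * cmod (b - a).
Proof.
elim: n a b => [|n IH] a b H.
  rewrite add0n [X in _ - X]/=; apply: midsum_bound => z sz; apply: H => //.
    exact: mid_segment.
  rewrite expr0 divr1; apply: segment_dist => //; exact: mid_segment.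
have [s1 s2] := segment_halves a b.
have H1 := IH a (mid a b); have H2 := IH (mid a b) b.
move: H1 H2; rewrite midBl midBr cmod_half => H1 H2.
have E (x : R) : x / 2 / 2 ^+ n = x / 2 ^+ n.+1.
  by rewrite exprS invfM mulrA.
have {}H1 := H1 (fun z w sz sw zw => H z w (s1 z sz) (s1 w sw)
   (eq_ind _ (fun x => cmod (w - z) <= x) zw _ (E _))).
have {}H2 := H2 (fun z w sz sw zw => H z w (s2 z sz) (s2 w sw)
   (eq_ind _ (fun x => cmod (w - z) <= x) zw _ (E _))).
rewrite addSn /=.
set u := midsum _ _ _ _ in H1 *; set u' := midsum _ _ _ _ in H1 *.
set v := midsum _ _ _ _ in H2 *; set v' := midsum _ _ _ _ in H2 *.
have -> : u + v - (u' + v') = (u - u') + (v - v') by ring.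
apply: le_trans (cmodD _ _) _; lra.
Qed.

Lemma exp2_small (d x : R) : 0 < d -> 0 <= x -> exists N, forall n, (N <= n)%N -> x / 2 ^+ n < d.
Proof.
move=> d0 x0; exists (Num.bound (x / d)) => n Nn.
rewrite ltr_pdivrMr ?exprn_gt0 // -ltr_pdivrMl // mulrC.
have xd : 0 <= x / d by rewrite divr_ge0 // ltW.
apply: lt_le_trans (archi_boundP xd) _.
by rewrite -natrX ler_nat (leq_trans Nn) // ltnW // ltn_expl.
Qed.

Lemma pint_cvg f a b : cts_on (segment a b) f ->
  clim (fun n => midsum f n a b) (pint f a b).
Proof.
move=> cf; apply: (@xgetPex _ 0 [set l | clim (fun n => midsum f n a b) l]).
apply: clim_cauchy => e e0.
pose m := cmod (b - a) + 1.
have m0 : 0 < m by rewrite /m; have := cmod_ge0 (b - a); lra.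
have em : 0 < e / m by rewrite divr_gt0.
have [d d0 Hd] := segment_unif cf em.
have [N HN] := exp2_small d0 (cmod_ge0 (b - a)).
exists N => n k Nn; apply: (@le_trans _ _ (e / m * cmod (b - a))).
  apply: midsum_osc => z w sz sw zw; apply: ltW; apply: Hd => //.
  exact: le_lt_trans zw (HN n Nn).
by rewrite mulrAC ler_pdivrMr // ler_wpM2l ?ltW // /m ltrDl.
Qed.

Lemma pint_unique f a b l : cts_on (segment a b) f ->
  clim (fun n => midsum f n a b) l -> pint f a b = l.
Proof. by move=> cf; apply: clim_unique; exact: pint_cvg. Qed.

Lemma pint_bound f a b c (e : R) : cts_on (segment a b) f ->
  (forall z, segment a b z -> cmod (f z - c) <= e) ->
  cmod (pint f a b - (b - a) * c) <= e * cmod (b - a).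
Proof.
move=> cf H; apply: clim_le (pint_cvg cf) _.
by exists 0%N => n _; exact: midsum_bound.
Qed.

Lemma pint_le f a b (M : R) : cts_on (segment a b) f ->
  (forall z, segment a b z -> cmod (f z) <= M) ->
  cmod (pint f a b) <= M * cmod (b - a).
Proof.
move=> cf H; have := @pint_bound f a b 0 M cf.
by rewrite mulr0 subr0; apply=> z /H; rewrite subr0.
Qed.

Lemma pint_mid f a b : cts_on (segment a b) f ->
  pint f a b = pint f a (mid a b) + pint f (mid a b) b.
Proof.
move=> cf; have [s1 s2] := segment_halves a b.
apply: clim_unique (clim_shift (pint_cvg cf)) _; apply: climD; apply: pint_cvg => z.
  by move/s1; exact: cf.
by move/s2; exact: cf.
Qed.

Lemma midsumC f n a b : midsum f n b a = - midsum f n a b.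
Proof.
elim: n a b => [|n IH] a b /=; first by rewrite midC; ring.
by rewrite midC IH [midsum f n (mid a b) a]IH opprD addrC.
Qed.

Lemma pintC f a b : cts_on (segment a b) f -> pint f b a = - pint f a b.
Proof.
move=> cf; apply: pint_unique => [z /segmentC|]; first exact: cf.
by under eq_fun do rewrite midsumC; exact: climN (pint_cvg cf).
Qed.

Lemma midsumD f g n a b : midsum (fun z => f z + g z) n a b = midsum f n a b + midsum g n a b.
Proof.
elim: n a b => [|n IH] a b /=; first by rewrite mulrDr.
by rewrite !IH addrACA.
Qed.

Lemma midsumZ c f n a b : midsum (fun z => c * f z) n a b = c * midsum f n a b.
Proof.
elim: n a b => [|n IH] a b /=; first by rewrite mulrCA.
by rewrite !IH mulrDr.
Qed.

Lemma midsum_ext f g n a b : (forall z, segment a b z -> f z = g z) ->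
  midsum f n a b = midsum g n a b.
Proof.
elim: n a b => [|n IH] a b H /=; first by rewrite H //; exact: mid_segment.
have [s1 s2] := segment_halves a b.
by congr (_ + _); apply: IH => z sz; apply: H; [exact: s1|exact: s2].
Qed.

Lemma pint_ext f g a b : (forall z, segment a b z -> f z = g z) ->
  pint f a b = pint g a b.
Proof.
move=> H; rewrite /pint; congr (xget 0 _); apply/funext => l.
by congr (clim _ l); apply/funext => n; exact: midsum_ext.
Qed.

Lemma pintD f g a b : cts_on (segment a b) f -> cts_on (segment a b) g ->
  pint (fun z => f z + g z) a b = pint f a b + pint g a b.
Proof.
move=> cf cg; apply: pint_unique => [z sz|]; first by apply: ctsD; [exact: cf|exact: cg].
by under eq_fun do rewrite midsumD; apply: climD; exact: pint_cvg.
Qed.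

Lemma pintZ k f a b : cts_on (segment a b) f ->
  pint (fun z => k * f z) a b = k * pint f a b.
Proof.
move=> cf; apply: pint_unique => [z sz|].
  by apply: ctsM; [exact: cts_cst|exact: cf].
by under eq_fun do rewrite midsumZ; apply: climZ; exact: pint_cvg.
Qed.

Lemma pintB f g a b : cts_on (segment a b) f -> cts_on (segment a b) g ->
  pint (fun z => f z - g z) a b = pint f a b - pint g a b.
Proof.
move=> cf cg; have -> : (fun z => f z - g z) = (fun z => f z + (-1) * g z).
  by apply/funext => z; rewrite mulN1r.
rewrite pintD // ?pintZ ?mulN1r // => z sz.
by apply: ctsM; [exact: cts_cst|exact: cg].
Qed.

(** The midpoint rule is exact on affine functions; Goursat's argument compares [f] with its affine
    approximation through this. *)
Lemma midsum_linear p q n a b : midsum (fun z => p * z + q) n a b =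
  p * (b ^+ 2 - a ^+ 2) / 2 + q * (b - a).
Proof. by elim: n a b => [|n IH] a b /=; rewrite ?IH /mid; field. Qed.

Lemma cts_linear p q z : cts (fun w : C => p * w + q) z.
Proof.
by apply: ctsD; [apply: ctsM; [exact: cts_cst|exact: cts_id]|exact: cts_cst].
Qed.

Lemma pint_linear p q a b : pint (fun z => p * z + q) a b =
  p * (b ^+ 2 - a ^+ 2) / 2 + q * (b - a).
Proof.
apply: pint_unique => [z _|]; first exact: cts_linear.
by under eq_fun do rewrite midsum_linear; exact: clim_cst.
Qed.

End SegmentIntegral.

(** * Goursat's theorem and primitives on a disc *)

Section Goursat.
Variable R : realType.
Local Notation C := R[i].
Implicit Types (f g F : C -> C) (a b c z w : C).

Definition disc z (r : R) w : Prop := cmod (w - z) < r.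

Definition holo_on (A : set C) f := forall z, A z -> cderivable f z.

Lemma cderivable_cts f z : cderivable f z -> cts f z.
Proof. by move=> [l /cder_cts]. Qed.

Lemma holo_cts (A : set C) f : holo_on A f -> cts_on A f.
Proof. by move=> hf z /hf; exact: cderivable_cts. Qed.

Lemma cts_onS (A B : set C) f : A `<=` B -> cts_on B f -> cts_on A f.
Proof. by move=> AB cf z /AB; exact: cf. Qed.

Lemma disc_center z (r : R) : 0 < r -> disc z r z.
Proof. by rewrite /disc /= subrr cmod0. Qed.

Lemma disc_near z (r : R) w : disc z r w -> \forall v \near cnbhs w, disc z r v.
Proof. exact: cnbhs_disc_in. Qed.

Lemma segment_cdisc a b z z0 (r : R) : segment a b z ->
  cmod (a - z0) <= r -> cmod (b - z0) <= r -> cmod (z - z0) <= r.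
Proof.
move=> [t /andP[t0 t1] ->] ar br.
have -> : a + t%:C%C * (b - a) - z0 = (1 - t)%:C%C * (a - z0) + t%:C%C * (b - z0).
  by rewrite rmorphB rmorph1 /=; ring.
apply: le_trans (cmodD _ _) _; rewrite !cmodM !cmod_real !ger0_norm //; last lra.
have -> : r = (1 - t) * r + t * r by ring.
by apply: lerD; apply: ler_wpM2l => //; lra.
Qed.

Lemma segment_disc a b z0 (r : R) : disc z0 r a -> disc z0 r b ->
  segment a b `<=` disc z0 r.
Proof.
move=> ar br z sz; rewrite /disc /=.
apply: (@le_lt_trans _ _ (Num.max (cmod (a - z0)) (cmod (b - z0)))).
  by apply: segment_cdisc sz _ _; rewrite le_max lexx ?orbT.
by rewrite gt_max ar.
Qed.

Lemma mid_cdisc a b z0 (r : R) :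
  cmod (a - z0) <= r -> cmod (b - z0) <= r -> cmod (mid a b - z0) <= r.
Proof. by apply: segment_cdisc; exact: mid_segment. Qed.

Definition tri f a b c := pint f a b + pint f b c + pint f c a.

Lemma tri_split f z0 (r : R) a b c : cts_on (disc z0 r) f ->
  disc z0 r a -> disc z0 r b -> disc z0 r c ->
  tri f a b c = tri f a (mid a b) (mid c a) + tri f (mid a b) b (mid b c)
    + tri f (mid c a) (mid b c) c + tri f (mid b c) (mid c a) (mid a b).
Proof.
move=> cf Da Db Dc.
have seg u v : disc z0 r u -> disc z0 r v -> cts_on (segment u v) f.
  by move=> Du Dv; apply: cts_onS cf; exact: segment_disc.
have Dm u v : disc z0 r u -> disc z0 r v -> disc z0 r (mid u v).
  by move=> Du Dv; apply: segment_disc Du Dv _ (mid_segment _ _).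
have Dab := Dm _ _ Da Db; have Dbc := Dm _ _ Db Dc; have Dca := Dm _ _ Dc Da.
rewrite /tri (pint_mid (seg _ _ Da Db)) (pint_mid (seg _ _ Db Dc)).
rewrite (pint_mid (seg _ _ Dc Da)).
rewrite (pintC (seg _ _ Dab Dca)) (pintC (seg _ _ Dbc Dab)) (pintC (seg _ _ Dca Dbc)).
ring.
Qed.

Lemma pint_near_linear f p q a b (e : R) : cts_on (segment a b) f ->
  (forall z, segment a b z -> cmod (f z - (p * z + q)) <= e) ->
  cmod (pint f a b - pint (fun z => p * z + q) a b) <= e * cmod (b - a).
Proof.
move=> cf H; rewrite -pintB //; last by move=> z _; exact: cts_linear.
apply: pint_le => // z sz; apply: ctsB; [exact: cf|exact: cts_linear].
Qed.

Lemma tri_linear p q a b c : tri (fun z => p * z + q) a b c = 0.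
Proof. by rewrite /tri !pint_linear; field. Qed.

Definition perim a b c := cmod (b - a) + cmod (c - b) + cmod (a - c).

Lemma tri_near_linear f p q a b c z0 (r e : R) : cts_on (disc z0 r) f ->
  disc z0 r a -> disc z0 r b -> disc z0 r c ->
  (forall z, cmod (z - a) <= perim a b c -> disc z0 r z -> cmod (f z - (p * z + q)) <= e) ->
  cmod (tri f a b c) <= e * perim a b c.
Proof.
move=> cf Da Db Dc H.
have seg u v : disc z0 r u -> disc z0 r v -> cts_on (segment u v) f.
  by move=> Du Dv; apply: cts_onS cf; exact: segment_disc.
have g1 := cmod_ge0 (b - a); have g2 := cmod_ge0 (c - b); have g3 := cmod_ge0 (a - c).
have aa : cmod (a - a) <= perim a b c by rewrite subrr cmod0 /perim; lra.
have ba : cmod (b - a) <= perim a b c by rewrite /perim; lra.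
have ca : cmod (c - a) <= perim a b c by rewrite cmodC /perim; lra.
have key u v : disc z0 r u -> disc z0 r v -> cmod (u - a) <= perim a b c ->
    cmod (v - a) <= perim a b c ->
    cmod (pint f u v - pint (fun z => p * z + q) u v) <= e * cmod (v - u).
  move=> Du Dv ua va; apply: pint_near_linear (seg _ _ Du Dv) _ => z sz.
  by apply: H; [exact: segment_cdisc sz ua va|exact: segment_disc Du Dv _ sz].
have K1 := key _ _ Da Db aa ba; have K2 := key _ _ Db Dc ba ca.
have K3 := key _ _ Dc Da ca aa.
rewrite -[tri f a b c]subr0 -(tri_linear p q a b c) /tri.
set x := pint f a b in K1 *; set y := pint f b c in K2 *; set t := pint f c a in K3 *.
set x' := pint _ a b in K1 *; set y' := pint _ b c in K2 *; set t' := pint _ c a in K3 *.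
have -> : x + y + t - (x' + y' + t') = (x - x') + (y - y') + (t - t') by ring.
apply: le_trans (cmodD _ _) _; apply: le_trans (lerD (cmodD _ _) (lexx _)) _.
rewrite /perim; lra.
Qed.

Definition in_cdisc z0 (rho : R) (T : C * C * C) :=
  [/\ cmod (T.1.1 - z0) <= rho, cmod (T.1.2 - z0) <= rho & cmod (T.2 - z0) <= rho].

(** One of the four triangles cut out by the midpoints carries at least a quarter of the integral.
    The last conjunct controls the first vertex, so that iterating the step produces a Cauchy
    sequence. *)
Lemma tri_step f z0 (r rho : R) (T : C * C * C) : rho < r -> cts_on (disc z0 r) f ->
  in_cdisc z0 rho T -> exists T', [/\ in_cdisc z0 rho T',
    cmod (tri f T.1.1 T.1.2 T.2) <= 4 * cmod (tri f T'.1.1 T'.1.2 T'.2),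
    perim T'.1.1 T'.1.2 T'.2 = perim T.1.1 T.1.2 T.2 / 2
    & cmod (T'.1.1 - T.1.1) <= perim T.1.1 T.1.2 T.2].
Proof.
case: T => [[a b] c] /= rr cf [/= Da Db Dc].
have Dab := mid_cdisc Da Db; have Dbc := mid_cdisc Db Dc; have Dca := mid_cdisc Dc Da.
have E := tri_split cf (le_lt_trans Da rr) (le_lt_trans Db rr) (le_lt_trans Dc rr).
have g1 := cmod_ge0 (b - a); have g2 := cmod_ge0 (c - b); have g3 := cmod_ge0 (a - c).
have mm u v w : mid u v - mid w u = (v - w) / 2 by rewrite /mid; field.
have mm' u v w : mid u v - mid v w = (u - w) / 2 by rewrite /mid; field.
pose M := cmod (tri f a b c) / 4.
have [H|H1] := leP M (cmod (tri f a (mid a b) (mid c a))).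
  exists (a, mid a b, mid c a); split=> //=.
  - by move: H; rewrite /M; lra.
  - by rewrite /perim midBl [cmod (mid c a - mid a b)]cmodC mm midBr !cmod_half
      [cmod (b - c)]cmodC; lra.
  - by rewrite subrr cmod0 /perim; lra.
have [H|H2] := leP M (cmod (tri f (mid a b) b (mid b c))).
  exists (mid a b, b, mid b c); split=> //=.
  - by move: H; rewrite /M; lra.
  - by rewrite /perim midBr midBl mm' !cmod_half; lra.
  - by rewrite midBl cmod_half /perim; lra.
have [H|H3] := leP M (cmod (tri f (mid c a) (mid b c) c)).
  exists (mid c a, mid b c, c); split=> //=.
  - by move: H; rewrite /M; lra.
  - by rewrite /perim midBr mm' (midBl c a) !cmod_half; lra.
  - by rewrite cmodC midBr cmod_half /perim; lra.
have [H|H4] := leP M (cmod (tri f (mid b c) (mid c a) (mid a b))).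
  exists (mid b c, mid c a, mid a b); split=> //=.
  - by move: H; rewrite /M; lra.
  - rewrite /perim [cmod (mid c a - _)]cmodC mm' [cmod (mid a b - mid c a)]cmodC mm'.
    by rewrite [cmod (mid b c - mid a b)]cmodC mm' !cmod_half; lra.
  - rewrite -(subrK b (mid b c)) -addrA; apply: le_trans (cmodD _ _) _.
    by rewrite midBl cmod_half /perim; lra.
exfalso; move: E => /(congr1 (@cmod R)) E.
have : cmod (tri f a b c) < M + M + M + M.
  rewrite E; apply: le_lt_trans (cmodD _ _) _; apply: ltrD => //.
  apply: le_lt_trans (cmodD _ _) _; apply: ltrD => //.
  by apply: le_lt_trans (cmodD _ _) _; apply: ltrD.
rewrite /M; lra.
Qed.

Lemma goursat f z0 (r : R) a b c : holo_on (disc z0 r) f ->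
  disc z0 r a -> disc z0 r b -> disc z0 r c -> tri f a b c = 0.
Proof.
move=> hf Da Db Dc; have cf := holo_cts hf.
(* All triangles stay in the closed disc of radius [rho < r], hence so does the limit of their first
   vertices. *)
pose rho := Num.max (cmod (a - z0)) (Num.max (cmod (b - z0)) (cmod (c - z0))).
have rr : rho < r by rewrite !gt_max; apply/and3P.
have [T|step Hstep] := @choice _ _ (fun T T' => in_cdisc z0 rho T ->
    [/\ in_cdisc z0 rho T',
    cmod (tri f T.1.1 T.1.2 T.2) <= 4 * cmod (tri f T'.1.1 T'.1.2 T'.2),
    perim T'.1.1 T'.1.2 T'.2 = perim T.1.1 T.1.2 T.2 / 2
    & cmod (T'.1.1 - T.1.1) <= perim T.1.1 T.1.2 T.2]).
  have [DT|nDT] := pselect (in_cdisc z0 rho T); last by exists T => /nDT.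
  by have [T' HT'] := tri_step rr cf DT; exists T'.
pose T n := iter n step (a, b, c).
pose p := perim a b c.
have g1 := cmod_ge0 (b - a); have g2 := cmod_ge0 (c - b); have g3 := cmod_ge0 (a - c).
have p0 : 0 <= p by rewrite /p /perim; lra.
pose K := cmod (tri f a b c).
have HT n : [/\ in_cdisc z0 rho (T n),
    K <= 4 ^+ n * cmod (tri f (T n).1.1 (T n).1.2 (T n).2),
    perim (T n).1.1 (T n).1.2 (T n).2 = p / 2 ^+ n
    & cmod ((T n.+1).1.1 - (T n).1.1) <= p / 2 ^+ n].
  have aux : [/\ in_cdisc z0 rho (T n),
    K <= 4 ^+ n * cmod (tri f (T n).1.1 (T n).1.2 (T n).2) &
    perim (T n).1.1 (T n).1.2 (T n).2 = p / 2 ^+ n].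
    elim: n => [|n [IH1 IH2 IH3]].
      split; last by rewrite expr0 divr1.
        by split; rewrite /= /rho !le_max lexx ?orbT.
      by rewrite expr0 mul1r.
    have [S1 S2 S3 _] := Hstep _ IH1; split => //.
      apply: le_trans IH2 _; rewrite exprSr -mulrA ler_wpM2l // exprn_ge0 //.
    by rewrite [T n.+1]/= S3 IH3 exprS invfM; ring.
  have [A1 A2 A3] := aux; split => //; rewrite -A3.
  by have [] := Hstep _ A1.
have cauchy n k : cmod ((T (n + k)%N).1.1 - (T n).1.1) <= 2 * p / 2 ^+ n - 2 * p / 2 ^+ (n + k).
  elim: k => [|k IH]; first by rewrite addn0 !subrr cmod0.
  rewrite -(subrK (T (n + k)%N).1.1 (T (n + k.+1)%N).1.1) -addrA.
  apply: le_trans (cmodD _ _) _; have [_ _ _ H] := HT (n + k)%N.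
  rewrite addnS; have -> : 2 * p / 2 ^+ (n + k).+1 = p / 2 ^+ (n + k).
    by rewrite exprS invfM; field; rewrite expf_neq0 ?pnatr_eq0.
  have E : 2 * p / 2 ^+ (n + k) = 2 * (p / 2 ^+ (n + k)) by rewrite mulrA.
  move: IH; rewrite E; lra.
have pos2 n : 0 < 2 ^+ n :> R by rewrite exprn_gt0.
have cauchy' n k : cmod ((T (n + k)%N).1.1 - (T n).1.1) <= 2 * p / 2 ^+ n.
  apply: le_trans (cauchy n k) _; rewrite lerBlDr lerDl.
  by rewrite divr_ge0 ?mulr_ge0 // ltW.
have [l Hl] : exists l, clim (fun n => (T n).1.1) l.
  apply: clim_cauchy => e e0.
  have [N HN] := exp2_small e0 (mulr_ge0 (ler0n R 2) p0).
  by exists N => n k /HN H; apply: le_trans (cauchy' n k) _; exact: ltW.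
have la n : cmod (l - (T n).1.1) <= 2 * p / 2 ^+ n.
  apply: clim_le Hl _; exists n => m nm; rewrite -(subnKC nm); exact: cauchy'.
have Dl : disc z0 r l.
  apply: le_lt_trans rr; apply: clim_le Hl _; exists 0%N => n _.
  by have [[]] := HT n.
have [L /cder_epsP HL] := hf _ Dl.
(* The [N]-th triangle lies within [3 p / 2^N] of [l] and has perimeter [p / 2^N], so its integral
   is at most [e * 3 p^2 / 4^N]; the factor [4^N] lost in the subdivision is recovered exactly. *)
have main (e : R) : 0 < e -> K <= e * (3 * p ^+ 2).
  move=> e0; have [d d0 Hd] := HL e e0.
  have [N HN] := exp2_small d0 (mulr_ge0 (ler0n R 3) p0).
  have [[D1 D2 D3] H2 H3 _] := HT N.
  have lt_r z : cmod (z - z0) <= rho -> disc z0 r z by move=> H; exact: le_lt_trans rr.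
  have := @tri_near_linear f L (f l - L * l) _ _ _ z0 r (e * (3 * p / 2 ^+ N)) cf
    (lt_r _ D1) (lt_r _ D2) (lt_r _ D3).
  rewrite H3 => Htri.
  have {}Htri : cmod (tri f (T N).1.1 (T N).1.2 (T N).2) <= e * (3 * p / 2 ^+ N) * (p / 2 ^+ N).
    apply: Htri => z zT _.
    have zl : cmod (z - l) <= 3 * p / 2 ^+ N.
      rewrite -(subrK (T N).1.1 z) -addrA; apply: le_trans (cmodD _ _) _.
      have := la N; rewrite [cmod (l - _)]cmodC -!mulrA; lra.
    have -> : f z - (L * z + (f l - L * l)) = f z - f l - L * (z - l) by ring.
    apply: le_trans (Hd z _) _; first exact: le_lt_trans zl (HN N (leqnn N)).
    by rewrite ler_wpM2l // ltW.
  apply: le_trans H2 _.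
  apply: le_trans (ler_wpM2l (exprn_ge0 N (ler0n R 4)) Htri) _.
  have -> : (4 : R) ^+ N = 2 ^+ N * 2 ^+ N.
    by rewrite -exprMn -natrM.
  rewrite le_eqVlt; apply/orP; left; apply/eqP; field.
  exact: lt0r_neq0.
apply/eqP; rewrite -cmod_eq0 eq_le cmod_ge0 andbT.
apply/ler_addgt0Pr => e e0; rewrite add0r.
have q0 : 0 < 3 * p ^+ 2 + 1 by have := sqr_ge0 p; lra.
apply: le_trans (main (e / (3 * p ^+ 2 + 1)) _) _; first by rewrite divr_gt0.
by rewrite mulrAC ler_pdivrMr // ler_pM2l // lerDl.
Qed.

Lemma pint_triangle f z0 (r : R) a b c : holo_on (disc z0 r) f ->
  disc z0 r a -> disc z0 r b -> disc z0 r c -> pint f a c - pint f a b = pint f b c.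
Proof.
move=> hf Da Db Dc; have := goursat hf Da Db Dc; rewrite /tri.
have cs : cts_on (segment a c) f by apply: cts_onS (holo_cts hf); exact: segment_disc.
rewrite (pintC cs) => /eqP; rewrite subr_eq0 => /eqP <-; ring.
Qed.

Lemma primitive f z0 (r : R) : holo_on (disc z0 r) f ->
  forall z, disc z0 r z -> cder (pint f z0) z (f z).
Proof.
move=> hf z Dz; have cf := holo_cts hf.
apply/cder_epsP => e e0.
have r0 : 0 < r by apply: le_lt_trans Dz; exact: cmod_ge0.
have [s s0 Hs] : \forall w \near cnbhs z, disc z0 r w /\ cmod (f w - f z) < e.
  by apply: filterS2 (disc_near Dz) (cf z Dz e e0).
exists s => // w ws.
have [Dw _] := Hs w ws.
have D0 : disc z0 r z0 by exact: disc_center.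
rewrite (pint_triangle hf D0 Dz Dw) [f z * _]mulrC.
apply: pint_bound => [v /(segment_disc Dz Dw)|v sv]; first exact: cf.
apply/ltW/(Hs _ _).2; apply: segment_disc ws _ sv.
by rewrite /disc /= subrr cmod0.
Qed.

End Goursat.

(** * Real differentials and mean value estimates *)

Section RealDifferential.
Variable R : realType.
Local Notation C := R[i].
Implicit Types (f g h : C -> C) (u v : C -> R) (a b c z w k l : C).

(* [u] is differentiable at [z] in the real sense, with differential
   [t |-> Re (k t)]. *)
Definition rdiff u z k := forall e : R, 0 < e -> \forall w \near cnbhs z,
  `|u w - u z - complex.Re (k * (w - z))| <= e * cmod (w - z).

Lemma ReD z w : complex.Re (z + w) = complex.Re z + complex.Re w.
Proof. by case: z w => ? ? []. Qed.

Lemma ReN z : complex.Re (- z) = - complex.Re z.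
Proof. by case: z. Qed.

Lemma ReB z w : complex.Re (z - w) = complex.Re z - complex.Re w.
Proof. by rewrite ReD ReN. Qed.

Lemma Re_realM (x : R) z : complex.Re (x%:C%C * z) = x * complex.Re z.
Proof. by case: z => ? ? /=; rewrite mul0r subr0. Qed.

Lemma is_derive_eps (g : R -> R) (t l : R) :
  (forall e, 0 < e -> \forall s \near t, `|g s - g t - l * (s - t)| <= e * `|s - t|) ->
  is_derive t 1 g l.
Proof.
move=> H.
have cv : (fun x => x^-1 *: ((g \o shift t) (x *: 1) - g t)) @ 0^' --> l.
  apply/cvgrPdist_le => e e0; have /nbhs_ballP[r /= r0 Hr] := H e e0.
  rewrite near_withinE; apply/nbhs_ballP; exists r => // x xr x0 /=.
  have {}xr : `|x| < r by move: xr; rewrite /ball /= sub0r normrN.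
  have := Hr (x + t); rewrite /ball /= addrK.
  rewrite (_ : t - (x + t) = - x); last by ring.
  rewrite normrN => /(_ xr) Hh.
  rewrite /GRing.scale /= mulr1.
  have -> : l - x^-1 * (g (x + t) - g t) = - (x^-1 * (g (x + t) - g t - l * x)).
    by field.
  by rewrite normrN normrM normfV mulrC ler_pdivrMr ?normr_gt0.
split; first by apply/cvg_ex; exists l.
exact: cvg_lim.
Qed.

Lemma rdiff_path u (p q : C) (t : R) k :
  rdiff u (p + t%:C%C * q) k ->
  is_derive t 1 (fun s : R => u (p + s%:C%C * q)) (complex.Re (k * q)).
Proof.
move=> H; apply: is_derive_eps => e e0.
pose m := cmod q + 1; have m0 : 0 < m by rewrite /m; have := cmod_ge0 q; lra.
have em : 0 < e / m by rewrite divr_gt0.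
have [r r0 Hr] := H _ em.
apply/nbhs_ballP; exists (r / m); first by rewrite /= divr_gt0.
move=> s; rewrite /ball /= distrC => st.
have E : p + s%:C%C * q - (p + t%:C%C * q) = (s - t)%:C%C * q.
  by rewrite rmorphB /=; ring.
have qm : cmod q <= m by rewrite /m lerDl.
have := Hr (p + s%:C%C * q); rewrite E cmodM cmod_real => Hs.
have {}Hs := Hs (le_lt_trans (ler_wpM2l (normr_ge0 _) qm) _).
rewrite ltr_pdivlMr // in st; move: (Hs st).
rewrite mulrCA Re_realM [(s - t) * _]mulrC => {}Hs.
apply: le_trans Hs _.
have -> : e / m * (`|s - t| * cmod q) = e * `|s - t| * (cmod q / m) by ring.
rewrite -[leRHS]mulr1; apply: ler_wpM2l; first by rewrite mulr_ge0 // ltW.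
by rewrite ler_pdivrMr // mul1r.
Qed.

Lemma rdiff_mvt u a b (k : C -> C) : (forall z, segment a b z -> rdiff u z (k z)) ->
  exists2 z, segment a b z & u b - u a = complex.Re (k z * (b - a)).
Proof.
move=> H; pose y (s : R) := a + s%:C%C * (b - a).
have D (t : R) : 0 <= t <= 1 -> is_derive t 1 (fun s : R => u (y s)) (complex.Re (k (y t) * (b - a))).
  by move=> t01; apply: rdiff_path; apply: H; exists t.
have [t||c cI E] := @MVT R (fun s => u (y s)) (fun t => complex.Re (k (y t) * (b - a))) 0 1 ltr01.
- by rewrite in_itv /= => /andP[t0 t1]; apply: D; rewrite !ltW.
- apply: continuous_in_subspaceT => t; rewrite inE /= in_itv /= => t01.
  have [dt _] := D t t01.
  by apply/differentiable_continuous; apply/derivable1_diffP.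
exists (y c); first by exists c => //; move: cI; rewrite in_itv /= => /andP[c0 c1]; rewrite !ltW.
move: E; rewrite subr0 mulr1 /y rmorph0 mul0r addr0 rmorph1 mul1r => <-.
by rewrite addrCA subrr addr0.
Qed.

Lemma rdiff_Re f z l : cder f z l -> rdiff (fun w => complex.Re (f w)) z l.
Proof.
move=> /cder_epsP H e e0; apply: filterS (H e e0) => w; apply: le_trans.
rewrite -!ReB; exact: Re_le_cmod.
Qed.

Lemma rdiffB u v z k l : rdiff u z k -> rdiff v z l ->
  rdiff (fun w => u w - v w) z (k - l).
Proof.
move=> Hu Hv e e0; have e2 : 0 < e / 2 by rewrite divr_gt0.
apply: filterS2 (Hu _ e2) (Hv _ e2) => w.
rewrite mulrBl ReB.
set x := complex.Re _; set y := complex.Re _ => H1 H2.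
have -> : u w - v w - (u z - v z) - (x - y) = (u w - u z - x) - (v w - v z - y) by ring.
apply: le_trans (ler_normB _ _) _.
have -> : e * cmod (w - z) = e / 2 * cmod (w - z) + e / 2 * cmod (w - z) by field.
exact: lerD.
Qed.

Lemma rdiffZ (x : R) u z k : rdiff u z k -> rdiff (fun w => x * u w) z (x%:C%C * k).
Proof.
move=> Hu e e0; pose m := `|x| + 1.
have m0 : 0 < m by rewrite /m; have := normr_ge0 x; lra.
have em : 0 < e / m by rewrite divr_gt0.
apply: filterS (Hu _ em) => w H.
rewrite -mulrA Re_realM -!mulrBr normrM.
apply: (@le_trans _ _ (m * (e / m * cmod (w - z)))).
  by apply: ler_pM => //; rewrite /m lerDl.
by rewrite mulrA [m * _]mulrC divfK ?gt_eqF.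
Qed.

Lemma rdiff_cst (x : R) z : rdiff (fun=> x) z 0.
Proof.
move=> e e0; exists 1 => // w _.
by rewrite mul0r subrr subr0 normr0 mulr_ge0 ?cmod_ge0 // ltW.
Qed.

Lemma rdiff_near u v z k : (\forall w \near cnbhs z, u w = v w) -> rdiff u z k -> rdiff v z k.
Proof.
move=> uv Hu e e0; have E := cnbhs_singleton uv.
by apply: filterS2 uv (Hu e e0) => w <-; rewrite -E.
Qed.

(** The real mean value theorem applied to [Re (q f)], where [q] is the conjugate of the increment
    of [f]: the increment of this function is [|f b - f a|^2]. *)
Lemma cder_mvt f a b (d : C -> C) (M : R) :
  (forall z, segment a b z -> cder f z (d z)) ->
  (forall z, segment a b z -> cmod (d z) <= M) ->
  cmod (f b - f a) <= M * cmod (b - a).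
Proof.
move=> H HM; set D := f b - f a.
have [->|D0] := eqVneq D 0.
  rewrite cmod0 mulr_ge0 ?cmod_ge0 //.
  by apply: le_trans (HM a (segment_l a b)); exact: cmod_ge0.
pose q := conjc D.
have qD : complex.Re (q * D) = cmod D ^+ 2.
  by rewrite cmod_sqr /q; case: (D) => x y /=; ring.
have qm : cmod q = cmod D.
  by rewrite /q /cmod; case: (D) => x y /=; rewrite sqrrN.
have [z sz E] := @rdiff_mvt (fun w => complex.Re (q * f w)) a b (fun z => q * d z)
  (fun z sz => rdiff_Re (cderZ q (H z sz))).
have {}E : cmod D ^+ 2 = complex.Re (q * d z * (b - a)).
  by rewrite -E -ReB -mulrBr -qD.
have D0' : 0 < cmod D by rewrite cmod_gt0.
rewrite -(ler_pM2l D0') -expr2 E; apply: le_trans (ler_norm _) _.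
apply: le_trans (Re_le_cmod _) _; rewrite !cmodM qm mulrA.
by rewrite ler_wpM2r ?cmod_ge0 // ler_wpM2l ?cmod_ge0 // HM.
Qed.

(** The lower bound is the inequality [ln (1 + y) <= y] taken at [y = - x / (1 + x)], for which
    [1 + y = (1 + x)^-1]. *)
Lemma ln1D_approx (x : R) : - 2^-1 <= x -> `|ln (1 + x) - x| <= 2 * x ^+ 2.
Proof.
move=> x2; have x1 : -1 < x by lra.
have up := le_ln1Dx x1.
have x10 : 0 < 1 + x by lra.
have y1 : -1 < - x / (1 + x) by rewrite ltr_pdivlMr //; lra.
have := le_ln1Dx y1.
have -> : 1 + - x / (1 + x) = (1 + x)^-1 by field; rewrite gt_eqF.
rewrite lnV ?posrE // => low.
have x20 := sqr_ge0 x.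
have E : - x / (1 + x) + x = x ^+ 2 / (1 + x) by field; rewrite gt_eqF.
have H : x ^+ 2 / (1 + x) <= 2 * x ^+ 2 by rewrite ler_pdivrMr //; nra.
by rewrite ler_norml; apply/andP; split; lra.
Qed.

(** [|1 + q|^2 = 1 + (2 Re q + |q|^2)], and half the logarithm of the square is expanded to first
    order. *)
Lemma ln_cmod1D_approx (q : C) : cmod q <= 8^-1 ->
  `|ln (cmod (1 + q)) - complex.Re q| <= 6 * cmod q ^+ 2.
Proof.
move=> q8; have q0 := cmod_ge0 q.
have q2 := cmod_sqr q.
have r1 := Re_le_cmod q.
set x := complex.Re q in r1 q2 *.
have E : cmod (1 + q) ^+ 2 = 1 + (2 * x + cmod q ^+ 2).
  by rewrite cmod_sqr q2 /x; case: (q) => a b /=; ring.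
have n0 : 0 < cmod (1 + q).
  have := cmodB_le (1 : C) (- q); rewrite opprK cmodN cmod1; lra.
have E2 : ln (cmod (1 + q)) = 2^-1 * ln (1 + (2 * x + cmod q ^+ 2)).
  by rewrite -E lnXn // mulr2n; field.
have := r1; rewrite ler_norml => /andP[r2 r3].
have qq : 0 <= cmod q ^+ 2 by exact: sqr_ge0.
have qq8 : cmod q ^+ 2 <= 8^-1 * cmod q by rewrite expr2 ler_wpM2r.
have := @ln1D_approx (2 * x + cmod q ^+ 2) ltac:(lra).
rewrite E2 !ler_norml => /andP[H1 H2].
have Y : (2 * x + cmod q ^+ 2) ^+ 2 <= 5 * cmod q ^+ 2.
  have -> : 5 * cmod q ^+ 2 = 4 * (cmod q * cmod q) + cmod q ^+ 2 by ring.
  have xx : x * x <= cmod q * cmod q by nra.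
  have -> : (2 * x + cmod q ^+ 2) ^+ 2 = 4 * (x * x) + (4 * x * cmod q ^+ 2 + cmod q ^+ 2 * cmod q ^+ 2) by ring.
  have : 4 * x * cmod q ^+ 2 + cmod q ^+ 2 * cmod q ^+ 2 <= cmod q ^+ 2.
    rewrite -mulrDl -[leRHS]mul1r; apply: ler_wpM2r => //; lra.
  lra.
by apply/andP; split; lra.
Qed.

(** Writing [h w = h z * (1 + q w)] reduces to the expansion of [ln |1 + q|] for small [q]; a branch
    of [log h] never enters. *)
Lemma rdiff_ln_cmod h z l : h z != 0 -> cder h z l ->
  rdiff (fun w => ln (cmod (h w))) z (l / h z).
Proof.
move=> hz Hh e e0.
have hz0 : 0 < cmod (h z) by rewrite cmod_gt0.
pose q w := (h w - h z) / h z.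
have dq : cder q z (l / h z).
  have := cderM (cderB Hh (cder_cst (h z) z)) (cder_cst (h z)^-1 z).
  by rewrite subr0 mulr0 addr0.
have qz : q z = 0 by rewrite /q subrr mul0r.
have [phi [cphi phiz Hphi]] := dq.
have [M M0 HM] := cts_bounded cphi.
have e8 : 0 < 8^-1 :> R by lra.
pose d := e / 2 / (6 * M ^+ 2).
have d0 : 0 < d by rewrite /d !divr_gt0 ?mulr_gt0 ?exprn_gt0.
have e2 : 0 < e / 2 by rewrite divr_gt0.
have /cder_epsP/(_ _ e2) Hq := dq.
have Hd := cnbhs_disc z d0.
apply: filterS3 (filterI (cder_cts dq e8) HM) Hphi (filterI Hq Hd) => w [q8 pM] Ep [Hw wd].
rewrite qz subr0 in q8 Ep Hw.
have E : h w = h z * (1 + q w) by rewrite /q mulrDr mulr1 mulrCA mulfV // mulr1 addrC subrK.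
have q1 : 0 < cmod (1 + q w).
  have := cmodB_le (1 : C) (- q w); rewrite opprK cmodN cmod1; lra.
rewrite E cmodM lnM ?posrE // [ln (cmod (h z)) + _]addrC addrK.
have A := ln_cmod1D_approx (ltW q8).
have B : `|complex.Re (q w) - complex.Re (l / h z * (w - z))| <= e / 2 * cmod (w - z).
  by rewrite -ReB; apply: le_trans (Re_le_cmod _) _.
have D : 6 * cmod (q w) ^+ 2 <= e / 2 * cmod (w - z).
  rewrite Ep cmodM exprMn.
  have c0 := cmod_ge0 (w - z).
  have M2 : cmod (phi w) ^+ 2 <= M ^+ 2 by rewrite lerXn2r ?nnegrE ?cmod_ge0 // ltW.
  apply: (@le_trans _ _ (6 * (M ^+ 2 * cmod (w - z) ^+ 2))).
    by rewrite ler_wpM2l // ler_wpM2r // sqr_ge0.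
  rewrite expr2 !mulrA; apply: ler_wpM2r => //.
  have : cmod (w - z) <= d by exact: ltW.
  rewrite /d ler_pdivlMr ?mulr_gt0 ?exprn_gt0 //; lra.
have -> : ln (cmod (1 + q w)) - complex.Re (l / h z * (w - z)) =
  (ln (cmod (1 + q w)) - complex.Re (q w)) +
  (complex.Re (q w) - complex.Re (l / h z * (w - z))) by ring.
apply: le_trans (ler_normD _ _) _; lra.
Qed.

End RealDifferential.

(** * Integrals along the boundary of a square *)

Section SquareLoop.
Variable R : realType.
Local Notation C := R[i].
Implicit Types (f g F : C -> C) (a b c z w : C).

(** The vertices lie on the circle of radius [rho], and multiplication by [i] permutes the sides, so
    that one computation serves all four. *)
Definition vtx z0 (rho : R) k : C := z0 + rho%:C%C * 'i%C ^+ k.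

Definition square z0 rho : set C :=
  [set z | exists k, segment (vtx z0 rho k) (vtx z0 rho k.+1) z].

Definition loop z0 rho f : C :=
  \sum_(k < 4) pint f (vtx z0 rho k) (vtx z0 rho k.+1).

Lemma cmod_i : cmod ('i%C : C) = 1.
Proof. by rewrite /cmod /= expr0n add0r expr1n sqrtr1. Qed.

(** On a side [|z - z0|^2 = rho^2 ((1 - t)^2 + t^2)], which lies between [rho^2 / 2] and [rho^2];
    the lower bound is rounded to avoid a square root. *)
Lemma squareP z0 rho z : 0 < rho -> square z0 rho z ->
  rho / 2 <= cmod (z - z0) <= rho.
Proof.
move=> rho0 [k [t /andP[t0 t1] ->]].
have -> : vtx z0 rho k + t%:C%C * (vtx z0 rho k.+1 - vtx z0 rho k) - z0 =
    rho%:C%C * ('i%C ^+ k * ((1 - t) +i* t)%C).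
  have -> : ((1 - t) +i* t)%C = (1 - t)%:C%C + 'i%C * t%:C%C :> C by rewrite [LHS]complexE.
  by rewrite /vtx exprS rmorphB rmorph1 /=; ring.
rewrite !cmodM cmodX cmod_i expr1n mul1r cmod_real gtr0_norm //.
have E := cmod_sqr ((1 - t) +i* t)%C; rewrite /= in E.
have m0 := cmod_ge0 ((1 - t) +i* t)%C.
move: E m0; set m := cmod _ => E m0.
have m1 : m <= 1 by rewrite -(@expr_le1 _ 2) // E; nra.
have m2 : 2^-1 <= m.
  rewrite -(@ler_pXn2r _ 2) ?nnegrE // E; nra.
apply/andP; split; nra.
Qed.

Lemma vtx_side z0 rho k : 0 < rho ->
  cmod (vtx z0 rho k.+1 - vtx z0 rho k) <= 2 * rho.
Proof.
move=> rho0; rewrite /vtx exprS.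
have -> : z0 + rho%:C%C * ('i%C * 'i%C ^+ k) - (z0 + rho%:C%C * 'i%C ^+ k) =
  rho%:C%C * 'i%C ^+ k * ('i%C - 1) :> C by ring.
rewrite !cmodM cmodX cmod_i expr1n mulr1 cmod_real gtr0_norm // mulrC.
apply: ler_wpM2r; first exact: ltW.
apply: le_trans (cmodD _ _) _.
by rewrite cmodN cmod1 cmod_i -[1 + 1]/2%:R.
Qed.

Lemma square_side z0 rho f k : cts_on (square z0 rho) f ->
  cts_on (segment (vtx z0 rho k) (vtx z0 rho k.+1)) f.
Proof. by move=> cf z sz; apply: cf; exists k. Qed.

Lemma loopD z0 rho f g : cts_on (square z0 rho) f -> cts_on (square z0 rho) g ->
  loop z0 rho (fun z => f z + g z) = loop z0 rho f + loop z0 rho g.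
Proof.
move=> cf cg; rewrite /loop -big_split /=; apply: eq_bigr => k _.
by apply: pintD; exact: square_side.
Qed.

Lemma loopZ z0 rho c f : cts_on (square z0 rho) f ->
  loop z0 rho (fun z => c * f z) = c * loop z0 rho f.
Proof.
move=> cf; rewrite /loop mulr_sumr; apply: eq_bigr => j _.
by apply: pintZ; exact: square_side.
Qed.

Lemma loopB z0 rho f g : cts_on (square z0 rho) f -> cts_on (square z0 rho) g ->
  loop z0 rho (fun z => f z - g z) = loop z0 rho f - loop z0 rho g.
Proof.
move=> cf cg; rewrite /loop -sumrB; apply: eq_bigr => k _.
by apply: pintB; exact: square_side.
Qed.

Lemma loop_ext z0 rho f g : (forall z, square z0 rho z -> f z = g z) ->
  loop z0 rho f = loop z0 rho g.
Proof.
by move=> H; apply: eq_bigr => k _; apply: pint_ext => z sz; apply: H; exists k.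
Qed.

Lemma loop_le z0 rho f (M : R) : 0 < rho -> 0 <= M -> cts_on (square z0 rho) f ->
  (forall z, square z0 rho z -> cmod (f z) <= M) ->
  cmod (loop z0 rho f) <= 8 * rho * M.
Proof.
move=> rho0 M0 cf HM; apply: le_trans (cmod_sum _ _ _) _.
apply: (@le_trans _ _ (\sum_(k < 4) M * (2 * rho))).
  apply: ler_sum => k _.
  apply: (@le_trans _ _ (M * cmod (vtx z0 rho k.+1 - vtx z0 rho k))).
    apply: pint_le; first exact: square_side.
    by move=> z sz; apply: HM; exists k.
  by rewrite ler_wpM2l // vtx_side.
rewrite sumr_const card_ord -mulr_natl; lra.
Qed.

Lemma square_bounded z0 rho f : cts_on (square z0 rho) f ->
  exists2 M : R, 0 < M & forall z, square z0 rho z -> cmod (f z) <= M.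
Proof.
move=> cf.
(* The index in [square] runs over all naturals; [i^4 = 1] brings it back to four sides. *)
have vtx4 k : vtx z0 rho (k %% 4) = vtx z0 rho k.
  rewrite {2}(divn_eq k 4) /vtx exprD mulnC exprM.
  have -> : 'i%C ^+ 4 = 1 :> C by rewrite (exprM _ 2 2) sqr_i sqrrN expr1n.
  by rewrite expr1n mul1r.
have H k := segment_bounded (@square_side z0 rho f k cf).
have [M0 M00 H0] := H 0%N; have [M1 M10 H1] := H 1%N.
have [M2 M20 H2] := H 2%N; have [M3 M30 H3] := H 3%N.
exists (M0 + M1 + M2 + M3) => [|z [k]]; first lra.
have -> : vtx z0 rho k.+1 = vtx z0 rho (k %% 4).+1.
  by rewrite -vtx4 -addn1 -modnDml addn1 vtx4.
rewrite -vtx4; have := ltn_pmod k (isT : 0 < 4)%N.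
case: (k %% 4)%N => [_ /H0|[_ /H1|[_ /H2|[_ /H3|//]]]]; lra.
Qed.

Lemma loop_holo z0 (rho r : R) f : 0 < rho -> rho < r -> holo_on (disc z0 r) f ->
  loop z0 rho f = 0.
Proof.
move=> rho0 rr hf.
have Dv k : disc z0 r (vtx z0 rho k).
  rewrite /disc /= /vtx addrC addrA addNr add0r cmodM cmodX cmod_i expr1n mulr1.
  by rewrite cmod_real gtr0_norm.
(* A diagonal cuts the square into two triangles. *)
have := goursat hf (Dv 0%N) (Dv 1%N) (Dv 2%N).
have := goursat hf (Dv 0%N) (Dv 2%N) (Dv 3%N).
rewrite /tri /loop !big_ord_recl big_ord0 /=.
have c02 : cts_on (segment (vtx z0 rho 0) (vtx z0 rho 2)) f.
  by apply: cts_onS (holo_cts hf); exact: segment_disc.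
rewrite (pintC c02).
have -> : vtx z0 rho 4 = vtx z0 rho 0.
  by rewrite /vtx (exprM _ 2 2) sqr_i sqrrN expr1n expr0.
rewrite /bump /= => H1 H2; have := congr2 +%R H1 H2; rewrite [0 + 0]addr0 => E.
by apply: (etrans _ E); ring.
Qed.

(** On each side [dz / (z - z0) = (i - 1) dt / ((1 - t) + i t)], whose imaginary part
    [dt / ((1 - t)^2 + t^2)] is at least [dt]. The induction follows the dyadic pieces through their
    parameters. *)
Lemma Im_side n (t1 t2 : R) (k : nat) z0 rho (y : R -> C) :
  y = (fun t => vtx z0 rho k + t%:C%C * (vtx z0 rho k.+1 - vtx z0 rho k)) ->
  0 < rho -> 0 <= t1 -> t1 <= t2 -> t2 <= 1 ->
  t2 - t1 <= complex.Im (midsum (fun z => (z - z0)^-1) n (y t1) (y t2)).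
Proof.
move=> yE rho0.
have ym s t : mid (y s) (y t) = y ((s + t) / 2).
  by rewrite yE /mid fmorph_div /= rmorphD rmorph_nat; field.
elim: n t1 t2 => [|n IH] t1 t2 t10 t12 t21 /=.
  rewrite ym; set t := (t1 + t2) / 2.
  have i0 : ('i%C : C) ^+ k != 0 by rewrite expf_neq0 // -cmod_gt0 cmod_i.
  have r0 : (rho%:C%C : C) != 0 by rewrite -cmod_gt0 cmod_real gtr0_norm.
  have E1 : y t - z0 = rho%:C%C * 'i%C ^+ k * ((1 - t) +i* t)%C.
    have -> : ((1 - t) +i* t)%C = (1 - t)%:C%C + 'i%C * t%:C%C :> C by rewrite [LHS]complexE.
    by rewrite yE /vtx exprS rmorphB rmorph1 /=; ring.
  have E2 : y t2 - y t1 = (t2 - t1)%:C%C * (rho%:C%C * 'i%C ^+ k) * ('i%C - 1).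
    by rewrite yE /vtx exprS rmorphB /=; ring.
  have p0 : 0 < (1 - t) ^+ 2 + t ^+ 2 by nra.
  have q0 : ((1 - t) +i* t)%C != 0 :> C.
    rewrite eq_complex /= -[_ && _]/(_ && _); apply/negP => /andP[/eqP u /eqP v].
    by move: p0; rewrite u v !expr0n /= addr0 ltxx.
  rewrite E1 E2.
  have -> : (t2 - t1)%:C%C * (rho%:C%C * 'i%C ^+ k) * ('i%C - 1) /
     (rho%:C%C * 'i%C ^+ k * ((1 - t) +i* t)%C) =
     (t2 - t1)%:C%C * (('i%C - 1) / ((1 - t) +i* t)%C) :> C.
    by field; rewrite q0 i0 r0.
  have -> : complex.Im ((t2 - t1)%:C%C * (('i%C - 1) / ((1 - t) +i* t)%C)) =
     (t2 - t1) / ((1 - t) ^+ 2 + t ^+ 2).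
    by rewrite /= ; field; rewrite gt_eqF.
  rewrite ler_pdivlMr // -[leRHS]mulr1; apply: ler_wpM2l; first lra.
  have : 0 <= t <= 1 by rewrite /t; apply/andP; split; lra.
  by move=> /andP[u v]; nra.
rewrite ym.
have H1 := IH t1 ((t1 + t2) / 2) t10 ltac:(lra) ltac:(lra).
have H2 := IH ((t1 + t2) / 2) t2 ltac:(lra) ltac:(lra) t21.
have -> u v : complex.Im (u + v) = complex.Im u + complex.Im v :> R by case: u v => ? ? [].
lra.
Qed.

(** Each side contributes at least [1] to the imaginary part. This lower bound stands in for the
    exact value [2 pi i] in all estimates. *)
Lemma loop_inv_ge z0 rho : 0 < rho ->
  4 <= cmod (loop z0 rho (fun z => (z - z0)^-1)).
Proof.
move=> rho0; apply: le_trans (Im_le_cmod _); apply: le_trans (ler_norm _).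
have ImD u v : complex.Im (u + v) = complex.Im u + complex.Im v :> R by case: u v => ? ? [].
have side k : 1 <= complex.Im (pint (fun z => (z - z0)^-1) (vtx z0 rho k) (vtx z0 rho k.+1)).
  have cs : cts_on (segment (vtx z0 rho k) (vtx z0 rho k.+1)) (fun z => (z - z0)^-1).
    move=> z sz; apply: ctsV; last by apply: ctsB; [exact: cts_id|exact: cts_cst].
    have /squareP : square z0 rho z by exists k.
    by move=> /(_ rho0) /andP[H _]; rewrite -cmod_gt0; lra.
  apply/ler_addgt0Pr => e /(pint_cvg cs)[N HN].
  have := HN N (leqnn N); set x := midsum _ _ _ _; set y := pint _ _ _ => H.
  have /= := @Im_side N 0 1 k z0 rho _ erefl rho0 (lexx 0) ler01 (lexx 1).
  rewrite rmorph0 rmorph1 mul0r mul1r addr0 subr0 addrCA subrr addr0 -/x => Hx.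
  have := Im_le_cmod (x - y); rewrite ImD ler_norml => /andP[_].
  have -> : complex.Im (- y) = - complex.Im y :> R by case: (y).
  lra.
rewrite /loop !big_ord_recl big_ord0 /= !ImD /bump /=.
have := side 0%N; have := side 1%N; have := side 2%N; have := side 3%N.
rewrite /=; lra.
Qed.

End SquareLoop.

(** * Cauchy's formula and its consequences *)

Section Cauchy.
Variable R : realType.
Local Notation C := R[i].
Implicit Types (f g F : C -> C) (a b c z w : C).

(** Left unnormalised: Cauchy's formula reads [cauchy_int f 1 w = f w * cauchy_int 1 1 w], the
    integral of the constant [1] playing the part of [2 pi i]. *)
Definition cauchy_int z0 (rho : R) f k w : C :=
  loop z0 rho (fun x => f x * (x - w)^-1 ^+ k).

Lemma lip_const (g : R -> C) :
  (forall e : R, 0 < e -> exists2 d : R, 0 < d & forall s t : R, 0 <= s <= 1 -> 0 <= t <= 1 ->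
    `|t - s| < d -> cmod (g t - g s) <= e * `|t - s|) -> g 1 = g 0.
Proof.
move=> H; apply/eqP; rewrite -subr_eq0 -cmod_eq0 eq_le cmod_ge0 andbT.
apply/ler_addgt0Pr => e e0; rewrite add0r; have [d d0 Hd] := H e e0.
pose N := (Num.bound d^-1).+1.
have N0 : 0 < N%:R :> R by rewrite ltr0n.
have Nd : N%:R^-1 < d.
  rewrite invf_plt ?posrE //; apply: lt_trans (archi_boundP _) _; first by rewrite invr_ge0 ltW.
  by rewrite ltr_nat.
have key k : (k <= N)%N -> cmod (g (k%:R / N%:R) - g 0) <= e * (k%:R / N%:R).
  elim: k => [|k IH] kN; first by rewrite mul0r subrr cmod0 mulr0.
  have kN' : (k <= N)%N by exact: ltnW.
  have i01 j : (j <= N)%N -> 0 <= (j%:R / N%:R : R) <= 1.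
    move=> jN; apply/andP; split; first by rewrite divr_ge0 ?ler0n.
    by rewrite ler_pdivrMr // mul1r ler_nat.
  have E : k.+1%:R / N%:R - k%:R / N%:R = N%:R^-1 :> R.
    by rewrite -natr1; field; rewrite gt_eqF.
  have := Hd _ _ (i01 _ kN') (i01 _ kN).
  rewrite E ger0_norm ?invr_ge0 ?ler0n // => /(_ Nd) H1.
  rewrite -(subrK (g (k%:R / N%:R)) (g (k.+1%:R / N%:R))) -addrA.
  apply: le_trans (cmodD _ _) _.
  have -> : e * (k.+1%:R / N%:R) = e * N%:R^-1 + e * (k%:R / N%:R).
    by rewrite -natr1; field; rewrite gt_eqF.
  by apply: lerD => //; exact: IH.
have := key N (leqnn N); rewrite divff ?gt_eqF // mulr1; exact.
Qed.

Section Formula.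
Variables (z0 : C) (rho : R).
Hypothesis rho0 : 0 < rho.

Lemma square_far w x : disc z0 (rho / 2) w -> square z0 rho x -> x - w != 0.
Proof.
rewrite /disc /= => wr /(squareP rho0) /andP[H _].
apply: contraTneq wr => /eqP; rewrite subr_eq0 => /eqP <-.
by rewrite -leNgt.
Qed.

Lemma cts_kernel f k w : cts_on (square z0 rho) f -> disc z0 (rho / 2) w ->
  cts_on (square z0 rho) (fun x => f x * (x - w)^-1 ^+ k).
Proof.
move=> cf Dw x sx; apply: ctsM; first exact: cf.
have cV : cts (fun x => (x - w)^-1) x.
  apply: ctsV; first exact: square_far Dw sx.
  by apply: ctsB; [exact: cts_id|exact: cts_cst].
elim: k => [|k IH]; first exact: cts_cst.
under eq_fun do rewrite exprS.
exact: ctsM cV IH.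
Qed.

Lemma kernel_le w (d : R) x : 0 < d -> cmod (w - z0) <= rho / 2 - d -> square z0 rho x ->
  cmod (x - w)^-1 <= d^-1.
Proof.
move=> d0 wd /(squareP rho0) /andP[H _].
have H2 : d <= cmod (x - w).
  have := cmodB_le (x - z0) (w - z0).
  rewrite (_ : x - z0 - (w - z0) = x - w); [lra|ring].
by rewrite cmodV lef_pV2 // posrE // (lt_le_trans d0).
Qed.

(** Meant for [x = (s - w)^-1], [y = (s - v)^-1] and [t = v - w], which satisfy [y - x = t x y]. The
    conclusion is then the differentiability of [w |-> (s - w)^-k], uniformly in the point [s] of
    the square. *)
Lemma pow_taylor k (B : R) : 0 <= B -> exists2 K : R, 0 <= K & forall x y t : C, y - x = t * x * y ->
  cmod x <= B -> cmod y <= B ->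
  cmod (y ^+ k - x ^+ k - k%:R * t * x ^+ k.+1) <= K * cmod t ^+ 2.
Proof.
move=> B0; elim: k => [|k [K K0 IH]].
  by exists 0 => // x y t _ _ _; rewrite !expr0 subrr !mul0r subrr cmod0.
exists (B * K + k.+1%:R * B ^+ k.+3).
  by rewrite addr_ge0 // mulr_ge0 ?ler0n ?exprn_ge0.
move=> x y t E xB yB.
have -> : y ^+ k.+1 - x ^+ k.+1 - k.+1%:R * t * x ^+ k.+2 =
   y * (y ^+ k - x ^+ k - k%:R * t * x ^+ k.+1) + k.+1%:R * t ^+ 2 * (x ^+ k.+2 * y).
  have E' : y = x + t * x * y by rewrite -E addrCA subrr addr0.
  have -> : k.+1%:R * t ^+ 2 * (x ^+ k.+2 * y) = k.+1%:R * t * x ^+ k.+1 * (y - x).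
    by rewrite E; rewrite !exprS; ring.
  rewrite -natr1 !exprS.
  have -> : k%:R * t * (x * x ^+ k) = k%:R * t * x * x ^+ k by ring.
  set X := x ^+ k; set Y := y ^+ k; set n := k%:R.
  have E2 : t * x * y = y - x by rewrite E.
  have -> : y * (Y - X - n * t * x * X) = y * (Y - X) - n * (t * x * y) * X by ring.
  rewrite E2.
  have -> : (n + 1) * t * (x * X) * (y - x) = (n + 1) * X * (t * x * y - t * x * x) by ring.
  rewrite E2; ring.
apply: le_trans (cmodD _ _) _; rewrite mulrDl; apply: lerD.
  rewrite cmodM -[B * K * _]mulrA; apply: ler_pM; rewrite ?cmod_ge0 //; exact: IH E xB yB.
have -> : cmod (k.+1%:R * t ^+ 2 * (x ^+ k.+2 * y)) =
    k.+1%:R * (cmod x ^+ k.+2 * cmod y) * cmod t ^+ 2.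
  by rewrite -!cmodX -[k.+1%:R in RHS]cmod_nat -!cmodM; congr cmod; ring.
apply: ler_wpM2r; first exact: sqr_ge0.
apply: ler_wpM2l; first exact: ler0n.
rewrite [B ^+ _]exprSr; apply: ler_pM => //; rewrite ?cmod_ge0 ?exprn_ge0 ?cmod_ge0 //.
by rewrite lerXn2r ?nnegrE ?cmod_ge0.
Qed.

Lemma cder_cauchy_int f k w : cts_on (square z0 rho) f -> disc z0 (rho / 2) w ->
  cder (cauchy_int z0 rho f k) w (k%:R * cauchy_int z0 rho f k.+1 w).
Proof.
move=> cf Dw; have [M M0 HM] := square_bounded cf.
pose d := (rho / 2 - cmod (w - z0)) / 2.
have d0 : 0 < d by rewrite /d divr_gt0 // subr_gt0.
have wd : cmod (w - z0) <= rho / 2 - d by move: Dw; rewrite /disc /= /d; lra.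
have dV : 0 <= d^-1 by rewrite invr_ge0 ltW.
have [K K0 HK] := pow_taylor k dV.
apply/cder_epsP => e e0.
pose A := 8 * rho * (M * K) + 1.
have A0 : 0 < A by rewrite /A ltr_wpDl // !mulr_ge0 // ltW.
have eA : 0 < e / A by rewrite divr_gt0.
have md : 0 < Num.min d (e / A) by rewrite lt_min d0.
exists (Num.min d (e / A)) => // v; rewrite lt_min => /andP[vd ve].
have vd' : cmod (v - z0) <= rho / 2 - d.
  rewrite -(subrK w v) -addrA; apply: le_trans (cmodD _ _) _.
  move: vd; rewrite /d; lra.
have Dv : disc z0 (rho / 2) v by rewrite /disc /=; lra.
rewrite /cauchy_int -loopB; [|exact: cts_kernel..].
have -> : k%:R * loop z0 rho (fun x => f x * (x - w)^-1 ^+ k.+1) * (v - w) =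
   loop z0 rho (fun x => (k%:R * (v - w)) * (f x * (x - w)^-1 ^+ k.+1)).
  by rewrite loopZ; [ring|exact: cts_kernel].
have c1 : cts_on (square z0 rho) (fun x => k%:R * (v - w) * (f x * (x - w)^-1 ^+ k.+1)).
  by move=> x sx; apply: ctsM; [exact: cts_cst|exact: cts_kernel].
have c2 : cts_on (square z0 rho) (fun x => f x * (x - v)^-1 ^+ k - f x * (x - w)^-1 ^+ k).
  by move=> x sx; apply: ctsB; exact: cts_kernel.
rewrite -loopB //.
have c0 := cmod_ge0 (v - w).
apply: (@le_trans _ _ (8 * rho * (M * (K * cmod (v - w) ^+ 2)))).
  apply: loop_le => //.
  - by rewrite !mulr_ge0 ?sqr_ge0 // ltW.
  - by move=> x sx; apply: ctsB; [exact: c2|exact: c1].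
  move=> x sx.
  have -> : f x * (x - v)^-1 ^+ k - f x * (x - w)^-1 ^+ k -
      k%:R * (v - w) * (f x * (x - w)^-1 ^+ k.+1) =
    f x * ((x - v)^-1 ^+ k - (x - w)^-1 ^+ k - k%:R * (v - w) * (x - w)^-1 ^+ k.+1) by ring.
  rewrite cmodM; apply: ler_pM; rewrite ?cmod_ge0 //; first exact: HM.
  apply: HK; [|exact: kernel_le sx..].
  have xv := square_far Dv sx; have xw := square_far Dw sx.
  by field; rewrite xv xw.
have -> : 8 * rho * (M * (K * cmod (v - w) ^+ 2)) = (8 * rho * (M * K) * cmod (v - w)) * cmod (v - w) by ring.
apply: ler_wpM2r => //.
apply: (@le_trans _ _ (A * cmod (v - w))); first by rewrite ler_wpM2r // /A lerDl.
by rewrite -ler_pdivlMl // mulrC ltW.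
Qed.

(** The homotopy [y s x = w + s (x - w)] shrinks the square to [w]. The derivative in [s] of the
    integral of [F (y s x) / (x - w)] is the integral of [f (y s x)], which vanishes by Goursat, so
    its values at [s = 1] and [s = 0] agree. [F] is taken with a holomorphic derivative [f] because
    that derivatives are holomorphic is only deduced afterwards, in [holo_c1der]. *)
Lemma cauchy_formula0 (r : R) f F w : 2 * rho < r -> holo_on (disc z0 r) f ->
  (forall z, disc z0 r z -> cder F z (f z)) -> disc z0 (rho / 2) w ->
  cauchy_int z0 rho F 1 w = F w * cauchy_int z0 rho (fun=> 1) 1 w.
Proof.
move=> rr hf dF Dw; have rho0' := rho0.
have Dw' : disc z0 rho w by move: rho0 Dw; rewrite /disc /=; lra.
pose y (s : R) x := w + s%:C%C * (x - w).
have yin s x : 0 <= s <= 1 -> cmod (x - z0) <= rho -> cmod (y s x - z0) <= rho.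
  move=> s01 xr; apply: (@segment_cdisc _ w x (y s x)) => //; first by exists s.
  exact: ltW.
have yD s x : 0 <= s <= 1 -> cmod (x - z0) <= rho -> disc z0 r (y s x).
  by move=> s01 xr; rewrite /disc /=; apply: le_lt_trans (yin _ _ s01 xr) _; lra.
have cy s x : cts (y s) x.
  apply: ctsD; first exact: cts_cst.
  by apply: ctsM; [exact: cts_cst|apply: ctsB; [exact: cts_id|exact: cts_cst]].
have sq x : square z0 rho x -> cmod (x - z0) <= rho by move=> /(squareP rho0) /andP[].
pose g (s : R) := loop z0 rho (fun x => F (y s x) * (x - w)^-1 ^+ 1).
have cF s : 0 <= s <= 1 -> cts_on (square z0 rho) (fun x => F (y s x) * (x - w)^-1 ^+ 1).
  move=> s01; apply: cts_kernel => // x sx; apply: cts_comp; first exact: cy.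
  by apply: cder_cts (dF _ _); apply: yD => //; exact: sq.
have hfs s : 0 <= s <= 1 -> loop z0 rho (fun x => f (y s x)) = 0.
  move=> s01; apply: (@loop_holo _ z0 rho r) => //; first lra.
  move=> x Dx; have [l Hl] : cderivable f (y s x).
    apply: hf; apply: (@segment_disc _ w x) => //; last by exists s.
    by move: Dw'; rewrite /disc /=; lra.
  exists (l * (s%:C%C * 1)); apply: cder_comp => //.
  have := cderD (cder_cst w x) (cderZ s%:C%C (cderB (cder_id x) (cder_cst w x))).
  by rewrite add0r subr0.
suff E : g 1 = g 0.
  have -> : cauchy_int z0 rho F 1 w = g 1.
    by apply: loop_ext => x _; rewrite /y rmorph1 mul1r addrCA subrr addr0.
  rewrite E /g /cauchy_int -loopZ; last first.
    by apply: cts_kernel => // x _; exact: cts_cst.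
  by apply: loop_ext => x _; rewrite /y rmorph0 mul0r addr0 mul1r.
apply: lip_const => e e0.
pose e' := e / (8 * rho).
have e'0 : 0 < e' by rewrite /e' divr_gt0 // mulr_gt0.
have [d d0 Hd] : exists2 d : R, 0 < d & forall z v, cmod (z - z0) <= rho ->
    cmod (v - z) < d -> cmod (f v - f z) < e'.
  apply: disc_unif => // [z zr|]; last exact: ltW.
  by apply: (holo_cts hf); rewrite /disc /=; lra.
exists (d / (2 * rho)) => [|s t s01 t01 st]; first by rewrite divr_gt0 // mulr_gt0.
rewrite /g -loopB; [|exact: cF..].
have cfs : cts_on (square z0 rho) (fun x => f (y s x)).
  move=> x sx; apply: cts_comp; first exact: cy.
  by apply: (holo_cts hf); apply: yD => //; exact: sq.
have cfs' : cts_on (square z0 rho) (fun x => (t - s)%:C%C * f (y s x)).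
  by move=> x sx; apply: ctsM; [exact: cts_cst|exact: cfs].
have cd : cts_on (square z0 rho) (fun x => F (y t x) * (x - w)^-1 ^+ 1 - F (y s x) * (x - w)^-1 ^+ 1).
  by move=> x sx; apply: ctsB; exact: cF.
rewrite -[loop _ _ _]subr0 -(mulr0 (t - s)%:C%C) -(hfs s s01) -loopZ // -loopB //.
have -> : e * `|t - s| = 8 * rho * (e' * `|t - s|).
  by rewrite /e'; field; rewrite gt_eqF.
apply: loop_le => //.
- by rewrite mulr_ge0 // ltW.
- by move=> x sx; apply: ctsB; [exact: cd|exact: cfs'].
move=> x sx; have xw := square_far Dw sx.
have E : y t x - y s x = (t - s)%:C%C * (x - w).
  by rewrite /y rmorphB /=; ring.
have -> : F (y t x) * (x - w)^-1 ^+ 1 - F (y s x) * (x - w)^-1 ^+ 1 - (t - s)%:C%C * f (y s x)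
   = (F (y t x) - F (y s x) - f (y s x) * (y t x - y s x)) / (x - w).
  by rewrite E; field.
rewrite cmodM cmodV ler_pdivrMr ?cmod_gt0 //.
have -> : e' * `|t - s| * cmod (x - w) = e' * cmod (y t x - y s x).
  by rewrite E cmodM cmod_real mulrA.
have sg z : segment (y s x) (y t x) z -> disc z0 r z.
  by apply: segment_disc; apply: yD => //; exact: sq.
have -> : F (y t x) - F (y s x) - f (y s x) * (y t x - y s x) =
   (F (y t x) - f (y s x) * y t x) - (F (y s x) - f (y s x) * y s x) by ring.
apply: (@cder_mvt _ (fun z => F z - f (y s x) * z) _ _ (fun z => f z - f (y s x) * 1)).
  by move=> z sz; apply: cderB; [apply: dF; exact: sg|apply: cderZ; exact: cder_id].
move=> z sz; rewrite mulr1; apply: ltW; apply: Hd; first by apply: yin => //; exact: sq.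
apply: le_lt_trans (segment_dist sz (segment_l _ _)) _.
rewrite E cmodM cmod_real.
apply: (@le_lt_trans _ _ (`|t - s| * (2 * rho))).
  apply: ler_wpM2l => //.
  have -> : x - w = (x - z0) - (w - z0) by ring.
  by apply: le_trans (cmodD _ _) _; rewrite cmodN; have := sq x sx; move: Dw'; rewrite /disc /=; lra.
by rewrite -ltr_pdivlMr // mulr_gt0.
Qed.

Lemma cauchy_int1_center : cauchy_int z0 rho (fun=> 1) 1 z0 != 0.
Proof.
rewrite -cmod_gt0; apply: lt_le_trans (_ : 4 <= _); first by [].
have -> : cauchy_int z0 rho (fun=> 1) 1 z0 = loop z0 rho (fun z => (z - z0)^-1).
  by apply: loop_ext => x _; rewrite mul1r expr1.
exact: loop_inv_ge.
Qed.

End Formula.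

Definition c1der f : C -> C := derive1 (f : R[i]^o -> R[i]^o).

Lemma cderivableM f g z : cderivable f z -> cderivable g z -> cderivable (fun w => f w * g w) z.
Proof. by move=> [l Hl] [k Hk]; exists (l * g z + f z * k); exact: cderM. Qed.

Lemma cderivableD f g z : cderivable f z -> cderivable g z -> cderivable (fun w => f w + g w) z.
Proof. by move=> [l Hl] [k Hk]; exists (l + k); exact: cderD. Qed.

Lemma cderivableN f z : cderivable f z -> cderivable (fun w => - f w) z.
Proof. by move=> [l Hl]; exists (- l); exact: cderN. Qed.

(* [n.+1] times differentiable at [z] *)
Fixpoint cdern n f z := if n is n'.+1 then exists2 f' : C -> C,
    (\forall w \near cnbhs z, cder f w (f' w)) & cdern n' f' z
  else cderivable f z.

Lemma cdernW n f z : cdern n.+1 f z -> cdern n f z.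
Proof.
elim: n f => [|n IH] f [f' Hf H].
  by exists (f' z); exact: cnbhs_singleton Hf.
by exists f' => //; exact: IH.
Qed.

Lemma cdern0 n f z : cdern n f z -> cderivable f z.
Proof. by elim: n => // n IH /cdernW/IH. Qed.

Lemma cdernD n f g z : cdern n f z -> cdern n g z -> cdern n (fun w => f w + g w) z.
Proof.
elim: n f g => [|n IH] f g; first exact: cderivableD.
move=> [f' Hf H] [g' Hg K]; exists (fun w => f' w + g' w); last exact: IH.
by apply: filterS2 Hf Hg => w; exact: cderD.
Qed.

Lemma cdernN n f z : cdern n f z -> cdern n (fun w => - f w) z.
Proof.
elim: n f => [|n IH] f; first exact: cderivableN.
move=> [f' Hf H]; exists (fun w => - f' w); last exact: IH.
by apply: filterS Hf => w; exact: cderN.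
Qed.

Lemma cdernM n f g z : cdern n f z -> cdern n g z -> cdern n (fun w => f w * g w) z.
Proof.
elim: n f g => [|n IH] f g; first exact: cderivableM.
move=> Hf' Hg'; have Wf := cdernW Hf'; have Wg := cdernW Hg'.
move: Hf' Hg' => [f' Hf H] [g' Hg K].
exists (fun w => f' w * g w + f w * g' w).
  by apply: filterS2 Hf Hg => w; exact: cderM.
by apply: cdernD; exact: IH.
Qed.

Lemma cdernV n f z : f z != 0 -> cdern n f z -> cdern n (fun w => (f w)^-1) z.
Proof.
move=> fz; elim: n => [|n IH].
  by move=> [l Hl]; exists (- l / f z ^+ 2); exact: cderV.
move=> Hf'; have dV := IH (cdernW Hf'); have cf := cderivable_cts (cdern0 Hf').
move: Hf' => [f' Hf H].
exists (fun w => f' w * (- ((f w)^-1 * (f w)^-1))).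
  apply: filterS2 Hf (near_neq0 cf fz) => w dw fw.
  have := cderV fw dw; rewrite (_ : - f' w / f w ^+ 2 = f' w * (- ((f w)^-1 * (f w)^-1))) //.
  by field.
by apply: cdernM => //; apply: cdernN; exact: cdernM.
Qed.

Lemma cdernZ n k f z : cdern n f z -> cdern n (fun w => k * f w) z.
Proof.
elim: n f => [|n IH] f; first by move=> [l Hl]; exists (k * l); exact: cderZ.
move=> [f' Hf H]; exists (fun w => k * f' w); last exact: IH.
by apply: filterS Hf => w; exact: cderZ.
Qed.

Lemma cdern_cauchy_int n z0 (rho : R) f k : 0 < rho -> cts_on (square z0 rho) f ->
  cdern n (cauchy_int z0 rho f k) z0.
Proof.
move=> rho0 cf; have rho2 : 0 < rho / 2 by rewrite divr_gt0.
elim: n k => [|n IH] k.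
  exists (k%:R * cauchy_int z0 rho f k.+1 z0).
  by apply: cder_cauchy_int => //; exact: disc_center.
exists (fun w => k%:R * cauchy_int z0 rho f k.+1 w); last exact: cdernZ.
by apply: filterS (cnbhs_disc z0 rho2) => w; exact: cder_cauchy_int.
Qed.

Lemma cauchy_quotient z0 (rho : R) f : 0 < rho ->
  (forall w, disc z0 (rho / 2) w ->
    cauchy_int z0 rho f 1 w = f w * cauchy_int z0 rho (fun=> 1) 1 w) ->
  \forall w \near cnbhs z0,
    cauchy_int z0 rho f 1 w * (cauchy_int z0 rho (fun=> 1) 1 w)^-1 = f w.
Proof.
move=> rho0 H; have rho2 : 0 < rho / 2 by rewrite divr_gt0.
have D0 : disc z0 (rho / 2) z0 by exact: disc_center.
have c1 : cts_on (square z0 rho) (fun=> 1) by move=> x _; exact: cts_cst.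
have cc := cder_cts (cder_cauchy_int rho0 1 c1 D0).
apply: filterS2 (near_neq0 cc (cauchy_int1_center z0 rho0)) (cnbhs_disc z0 rho2) => w w0 Dw.
by rewrite H // mulfK.
Qed.

(** By the formula [f] coincides near [z0] with a quotient of two Cauchy integrals, which have
    derivatives of all orders there. *)
Lemma cdern_formula n z0 (rho : R) f : 0 < rho -> cts_on (square z0 rho) f ->
  (forall w, disc z0 (rho / 2) w ->
    cauchy_int z0 rho f 1 w = f w * cauchy_int z0 rho (fun=> 1) 1 w) ->
  exists2 g, cdern n g z0 & \forall w \near cnbhs z0, g w = f w.
Proof.
move=> rho0 cf H.
exists (fun w => cauchy_int z0 rho f 1 w * (cauchy_int z0 rho (fun=> 1) 1 w)^-1).
  apply: cdernM; first exact: cdern_cauchy_int.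
  apply: cdernV; first exact: cauchy_int1_center.
  by apply: cdern_cauchy_int => // x _; exact: cts_cst.
exact: cauchy_quotient.
Qed.

Lemma square_disc z0 (rho r : R) : 0 < rho -> rho < r -> square z0 rho `<=` disc z0 r.
Proof. by move=> rho0 rr x /(squareP rho0) /andP[_]; rewrite /disc /=; lra. Qed.

(** A primitive of [f] satisfies Cauchy's formula, hence is three times differentiable, and
    [c1der f] is its second derivative. *)
Lemma holo_c1der z0 (r : R) f : holo_on (disc z0 r) f -> holo_on (disc z0 r) (c1der f).
Proof.
move=> hf z Dz.
have [s s0 Hs] := disc_near Dz.
have hs : holo_on (disc z s) f by move=> w /Hs; exact: hf.
pose rho := s / 3; have rho0 : 0 < rho by rewrite divr_gt0.
have rr : 2 * rho < s by rewrite /rho; lra.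
pose F := pint f z.
have dF w : disc z s w -> cder F w (f w) by exact: primitive.
have rs : rho < s by rewrite /rho; lra.
have cF : cts_on (square z rho) F.
  by move=> x /(square_disc rho0 rs) /dF /cder_cts.
have [g [g1 Hg [g2 Hg1 [l Hl]]] gF] := cdern_formula 2 rho0 cF
  (fun w Dw => cauchy_formula0 rho0 rr hs dF Dw).
have Ef : \forall w \near cnbhs z, g1 w = f w.
  apply: filterS3 Hg (cnbhs_near gF) (cnbhs_disc z s0) => w dg gw Dw.
  exact: cder_unique (cder_near gw dg) (dF w Dw).
exists l; apply: cder_near Hl.
apply: filterS2 Hg1 (cnbhs_near Ef) => w dg1 Efw.
by rewrite /c1der (cderE (cder_near Efw dg1)).
Qed.

Lemma holo_cder (A : set C) f z : holo_on A f -> A z -> cder f z (c1der f z).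
Proof. by move=> hf /hf /cder_derive1. Qed.

Lemma cauchy_formula z0 (rho r : R) f w : 0 < rho -> 2 * rho < r ->
  holo_on (disc z0 r) f -> disc z0 (rho / 2) w ->
  cauchy_int z0 rho f 1 w = f w * cauchy_int z0 rho (fun=> 1) 1 w.
Proof.
move=> rho0 rr hf; apply: (cauchy_formula0 rho0 rr (holo_c1der hf)) => z.
exact: holo_cder.
Qed.

Lemma cauchy_int_le z0 (rho : R) f k (M : R) : 0 < rho -> 0 <= M ->
  cts_on (square z0 rho) f -> (forall x, square z0 rho x -> cmod (f x) <= M) ->
  cmod (cauchy_int z0 rho f k z0) <= 8 * rho * (M * (2 / rho) ^+ k).
Proof.
move=> rho0 M0 cf HM; have D0 : disc z0 (rho / 2) z0 by apply: disc_center; rewrite divr_gt0.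
have r20 : 0 <= 2 / rho by rewrite divr_ge0 // ltW.
apply: loop_le => //; first by rewrite mulr_ge0 ?exprn_ge0.
  exact: cts_kernel.
move=> x sx; rewrite cmodM cmodX; apply: ler_pM; rewrite ?exprn_ge0 ?cmod_ge0 //.
  exact: HM.
rewrite lerXn2r ?nnegrE ?cmod_ge0 // -[2 / rho]invf_div.
by apply: (@kernel_le z0 rho rho0) sx; rewrite ?divr_gt0 // subrr cmod0 subrr.
Qed.

(** Differentiating [cauchy_int f 1 = f * cauchy_int 1 1] at the centre leaves a term with the
    derivative of [cauchy_int 1 1], whose constancy is not established; bounding it like the main
    term doubles the constant, and [rho = r / 3] gives [48]. *)
Lemma cauchy_estimate z0 (r : R) f (M : R) : 0 < r -> holo_on (disc z0 r) f ->
  (forall z, disc z0 r z -> cmod (f z) <= M) -> cmod (c1der f z0) <= 48 * M / r.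
Proof.
move=> r0 hf HM; have D0r : disc z0 r z0 by exact: disc_center.
have M0 : 0 <= M by apply: le_trans (HM _ D0r); exact: cmod_ge0.
have df := holo_cder hf D0r.
apply/ler_addgt0Pr => e e0.
(* any [rho < r / 2] will do *)
pose rho := r / 3; have rho0 : 0 < rho by rewrite divr_gt0.
have rr : 2 * rho < r by rewrite /rho; lra.
have rr' : rho < r by rewrite /rho; lra.
have rho2 : 0 < rho / 2 by rewrite divr_gt0.
have D0 : disc z0 (rho / 2) z0 by exact: disc_center.
have cf : cts_on (square z0 rho) f := cts_onS (square_disc rho0 rr') (holo_cts hf).
have c1 : cts_on (square z0 rho) (fun=> 1) by move=> x _; exact: cts_cst.
have H1 := cder_cauchy_int rho0 1 cf D0; have H2 := cder_cauchy_int rho0 1 c1 D0.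
rewrite !mul1r in H1 H2.
have E : cauchy_int z0 rho f 2 z0 = c1der f z0 * cauchy_int z0 rho (fun=> 1) 1 z0
    + f z0 * cauchy_int z0 rho (fun=> 1) 2 z0.
  apply: cder_unique H1 _; apply: cder_near (cderM df H2).
  by apply: filterS (cnbhs_disc z0 rho2) => w Dw; rewrite (cauchy_formula rho0 rr hf).
have B1 : cmod (cauchy_int z0 rho f 2 z0) <= 8 * rho * (M * (2 / rho) ^+ 2).
  by apply: cauchy_int_le => // x /(square_disc rho0 rr'); exact: HM.
have B2 : cmod (cauchy_int z0 rho (fun=> 1) 2 z0) <= 8 * rho * (1 * (2 / rho) ^+ 2).
  by apply: cauchy_int_le => // x _; rewrite cmod1.
have B3 : 4 <= cmod (cauchy_int z0 rho (fun=> 1) 1 z0).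
  rewrite (_ : cauchy_int _ _ _ _ _ = loop z0 rho (fun z => (z - z0)^-1)).
    exact: loop_inv_ge.
  by apply: loop_ext => x _; rewrite mul1r expr1.
have B4 : cmod (c1der f z0) * 4 <= 16 * rho * (M * (2 / rho) ^+ 2).
  apply: (@le_trans _ _ (cmod (c1der f z0) * cmod (cauchy_int z0 rho (fun=> 1) 1 z0))).
    by rewrite ler_wpM2l ?cmod_ge0.
  rewrite -cmodM.
  have -> : c1der f z0 * cauchy_int z0 rho (fun=> 1) 1 z0 = cauchy_int z0 rho f 2 z0
      - f z0 * cauchy_int z0 rho (fun=> 1) 2 z0 by rewrite E addrK.
  apply: le_trans (cmodD _ _) _; rewrite cmodN cmodM.
  have B5 : cmod (f z0) * cmod (cauchy_int z0 rho (fun=> 1) 2 z0) <= M * (8 * rho * (1 * (2 / rho) ^+ 2)).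
    by apply: ler_pM; rewrite ?cmod_ge0 //; exact: HM.
  lra.
have Er : 16 * rho * (M * (2 / rho) ^+ 2) = 4 * (48 * M / r).
  by rewrite /rho; field; rewrite gt_eqF.
lra.
Qed.

(** Weierstrass' theorem: Cauchy's formula passes to the uniform limit, and the formula implies
    differentiability. *)
Lemma holo_ulim z0 (r : R) (fn : nat -> C -> C) f :
  (forall n, holo_on (disc z0 r) (fn n)) ->
  (forall e : R, 0 < e -> exists N, forall n, (N <= n)%N -> forall z, disc z0 r z ->
    cmod (fn n z - f z) <= e) -> holo_on (disc z0 r) f.
Proof.
move=> hfn Hu z Dz.
have [s s0 Hs] := disc_near Dz.
have cf : cts_on (disc z s) f.
  move=> w Dw e e0; have e4 : 0 < e / 4 by rewrite divr_gt0.
  have [N HN] := Hu _ e4; have {}HN := HN N (leqnn N).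
  have [l /cder_cts/(_ _ e4) Hw] := hfn N w (Hs w Dw).
  apply: filterS2 Hw (disc_near Dw) => v H1 Dv.
  have := HN v (Hs v Dv); have := HN w (Hs w Dw).
  rewrite cmodC; move: H1.
  set a := fn N v; set b := fn N w => H1 H2; rewrite cmodC => H3.
  have -> : f v - f w = (f v - a) + (a - b) - (f w - b) by ring.
  apply: le_lt_trans (cmodD _ _) _; rewrite cmodN.
  have := cmodD (f v - a) (a - b); lra.
pose rho := s / 3; have rho0 : 0 < rho by rewrite divr_gt0.
have rr : 2 * rho < s by rewrite /rho; lra.
have rs : rho < s by rewrite /rho; lra.
have csq : cts_on (square z rho) f := cts_onS (square_disc rho0 rs) cf.
have hn n : holo_on (disc z s) (fn n) by move=> w /Hs; exact: hfn.
have csn n : cts_on (square z rho) (fn n) := cts_onS (square_disc rho0 rs) (holo_cts (hn n)).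
apply: (@cdern0 0).
suff F w : disc z (rho / 2) w ->
    cauchy_int z rho f 1 w = f w * cauchy_int z rho (fun=> 1) 1 w.
  have [g [l Hl] gf] := cdern_formula 0 rho0 csq F.
  by exists l; exact: cder_near gf Hl.
move=> Dw; pose d := rho / 2 - cmod (w - z).
have d0 : 0 < d by rewrite /d subr_gt0.
have cc := cmod_ge0 (cauchy_int z rho (fun=> 1) 1 w).
have Dsw : disc z r w -> disc z s w by move=> _; move: Dw; rewrite /disc /=; lra.
have Dsw' : disc z s w by move: Dw; rewrite /disc /=; lra.
pose A := 8 * rho * d^-1 + cmod (cauchy_int z rho (fun=> 1) 1 w) + 1.
have A0 : 0 < A.
  have : 0 <= 8 * rho * d^-1 by rewrite !mulr_ge0 ?invr_ge0 // ltW.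
  by rewrite /A; lra.
apply/eqP; rewrite -subr_eq0 -cmod_eq0 eq_le cmod_ge0 andbT.
apply/ler_addgt0Pr => e e0; rewrite add0r.
have eA : 0 < e / A by rewrite divr_gt0.
have [N HN] := Hu _ eA; have {}HN := HN N (leqnn N).
have ck g : cts_on (square z rho) g -> cts_on (square z rho) (fun x => g x * (x - w)^-1 ^+ 1).
  by move=> cg; exact: cts_kernel.
have -> : cauchy_int z rho f 1 w - f w * cauchy_int z rho (fun=> 1) 1 w =
   (fn N w - f w) * cauchy_int z rho (fun=> 1) 1 w -
   (cauchy_int z rho (fn N) 1 w - cauchy_int z rho f 1 w).
  by rewrite (cauchy_formula rho0 rr (hn N) Dw); ring.
apply: le_trans (cmodD _ _) _; rewrite cmodN cmodM.
have B1 : cmod (fn N w - f w) * cmod (cauchy_int z rho (fun=> 1) 1 w) <=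
    e / A * cmod (cauchy_int z rho (fun=> 1) 1 w).
  by rewrite ler_wpM2r // HN //; exact: Hs.
have B2 : cmod (cauchy_int z rho (fn N) 1 w - cauchy_int z rho f 1 w) <= 8 * rho * (e / A * d^-1).
  rewrite /cauchy_int -loopB; [|exact: ck..].
  apply: loop_le => //.
  - by rewrite mulr_ge0 ?invr_ge0 // ltW.
  - by move=> x sx; apply: ctsB; apply: ck.
  move=> x sx; rewrite -mulrBl cmodM; apply: ler_pM; rewrite ?cmod_ge0 //.
    by apply: HN; apply: Hs; exact: (square_disc rho0 rs).
  by rewrite expr1; apply: (@kernel_le z rho rho0) sx => //; rewrite /d; lra.
have -> : e = e / A * A by rewrite divfK ?gt_eqF.
have -> : e / A * A = e / A * cmod (cauchy_int z rho (fun=> 1) 1 w) +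
   8 * rho * (e / A * d^-1) + e / A by rewrite /A; ring.
lra.
Qed.

(** The finite geometric series of [(x - w)^-1] in powers of [(w - z0) / (x - z0)], with its exact
    remainder. Up to the factor [cauchy_int 1 1] this is a Taylor expansion. *)
Lemma cauchy_int_expand z0 (rho : R) f w n : 0 < rho -> cts_on (square z0 rho) f ->
  disc z0 (rho / 2) w ->
  cauchy_int z0 rho f 1 w =
  \sum_(k < n) (w - z0) ^+ k * cauchy_int z0 rho f k.+1 z0 +
  (w - z0) ^+ n * loop z0 rho (fun x => f x * (x - z0)^-1 ^+ n * (x - w)^-1 ^+ 1).
Proof.
move=> rho0 cf Dw.
have D0 : disc z0 (rho / 2) z0 by apply: disc_center; rewrite divr_gt0.
have ck k : cts_on (square z0 rho) (fun x => f x * (x - z0)^-1 ^+ k * (x - w)^-1 ^+ 1).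
  by apply: cts_kernel => //; exact: cts_kernel.
elim: n => [|n ->].
  rewrite big_ord0 add0r expr0 mul1r; apply: loop_ext => x _.
  by rewrite expr0 mulr1.
rewrite big_ord_recr /= -addrA; congr (_ + _).
rewrite exprSr -mulrA -mulrDr; congr (_ * _).
rewrite -loopZ; last exact: ck.
rewrite /cauchy_int -loopD; [|exact: cts_kernel|]; last first.
  by move=> x sx; apply: ctsM; [exact: cts_cst|exact: ck].
apply: loop_ext => x sx.
have x0 := square_far rho0 D0 sx; have xw := square_far rho0 Dw sx.
by rewrite !exprS !expr0; field; rewrite x0 xw.
Qed.

(** [j] is the index of the first nonzero coefficient of the expansion; the remainder beyond it is
    absorbed in a smaller disc. *)
Lemma holo_lower_bound z0 (r : R) f : 0 < r -> holo_on (disc z0 r) f -> f z0 = 0 ->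
  (forall s : R, 0 < s -> exists2 z, disc z0 s z & f z != 0) ->
  exists j, exists2 c : R, 0 < c &
    \forall w \near cnbhs z0, c * cmod (w - z0) ^+ j <= cmod (f w).
Proof.
move=> r0 hf fz0 nz.
pose rho := r / 3; have rho0 : 0 < rho by rewrite divr_gt0.
have rr : 2 * rho < r by rewrite /rho; lra.
have rr' : rho < r by rewrite /rho; lra.
have rho2 : 0 < rho / 2 by rewrite divr_gt0.
have D0 : disc z0 (rho / 2) z0 by exact: disc_center.
have cf : cts_on (square z0 rho) f := cts_onS (square_disc rho0 rr') (holo_cts hf).
have c1 : cts_on (square z0 rho) (fun=> 1) by move=> x _; exact: cts_cst.
have [M M0 HM] := square_bounded cf.
have rem n w : disc z0 (rho / 4) w -> cmod (loop z0 rho (fun x => f x * (x - z0)^-1 ^+ n * (x - w)^-1 ^+ 1))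
    <= 8 * rho * (M * (2 / rho) ^+ n * (4 / rho)).
  move=> Dw; have Dw' : disc z0 (rho / 2) w by move: Dw; rewrite /disc /=; lra.
  have r20 : 0 <= 2 / rho by rewrite divr_ge0 // ltW.
  apply: loop_le => //.
  - by rewrite !mulr_ge0 ?invr_ge0 ?exprn_ge0 // ltW.
  - by apply: cts_kernel => //; exact: cts_kernel.
  move=> x sx; rewrite !cmodM expr1; apply: ler_pM; rewrite ?mulr_ge0 ?cmod_ge0 //.
    rewrite cmodX; apply: ler_pM; rewrite ?exprn_ge0 ?cmod_ge0 //; first exact: HM.
    rewrite lerXn2r ?nnegrE ?cmod_ge0 // -[2 / rho]invf_div.
    by apply: (@kernel_le z0 rho rho0) sx; rewrite ?divr_gt0 // subrr cmod0 subrr.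
  rewrite -[4 / rho]invf_div; apply: (@kernel_le z0 rho rho0) sx; first by rewrite divr_gt0.
  by move: Dw; rewrite /disc /=; lra.
have cc := cder_cts (cder_cauchy_int rho0 1 c1 D0).
have nc0 := near_neq0 cc (cauchy_int1_center z0 rho0).
have [B B0 HB] := cts_bounded cc.
have rho4 : 0 < rho / 4 by rewrite divr_gt0.
have [[j Hj]|Hall] := pselect (exists j, cauchy_int z0 rho f j.+1 z0 != 0); last first.
  exfalso.
  (* If all coefficients vanish only the remainder is left; on the disc of radius [rho / 4] it gains
     a factor [(rho / 4) (2 / rho) = 1 / 2] at each order, so [f] vanishes near [z0]. *)
  have [s s0 Hs] : \forall w \near cnbhs z0, f w = 0.
    apply: filterS2 nc0 (cnbhs_disc z0 rho4) => w cw Dw.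
    have Dw' : disc z0 (rho / 2) w by move: Dw; rewrite /disc /=; lra.
    apply/eqP; apply: contraT => fw.
    have := mulf_neq0 fw cw; rewrite -(cauchy_formula rho0 rr hf Dw') -cmod_gt0 => p.
    have bound n : cmod (cauchy_int z0 rho f 1 w) <= 8 * rho * (M * (4 / rho)) / 2 ^+ n.
      rewrite (cauchy_int_expand n rho0 cf Dw') big1 ?add0r => [|k _]; last first.
        apply/eqP; rewrite mulf_eq0; apply/orP; right; apply: contraT => H.
        by case: Hall; exists k.
      rewrite cmodM cmodX; apply: (@le_trans _ _ ((rho / 4) ^+ n * (8 * rho * (M * (2 / rho) ^+ n * (4 / rho))))).
        apply: ler_pM; rewrite ?exprn_ge0 ?cmod_ge0 //; last exact: rem.
        by rewrite lerXn2r ?nnegrE ?cmod_ge0 ?ltW.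
      have -> : (rho / 4) ^+ n * (8 * rho * (M * (2 / rho) ^+ n * (4 / rho))) =
        8 * rho * (M * (4 / rho)) * ((rho / 4) ^+ n * (2 / rho) ^+ n) by ring.
      rewrite -exprMn; have -> : rho / 4 * (2 / rho) = 2^-1 by field; rewrite gt_eqF.
      by rewrite exprVn.
    have q0 : 0 <= 8 * rho * (M * (4 / rho)) by rewrite !mulr_ge0 ?invr_ge0 // ltW.
    have [N HN] := exp2_small p q0.
    by have := le_lt_trans (bound N) (HN N (leqnn N)); rewrite ltxx.
  by have [z Dz] := nz s s0; rewrite (Hs z Dz) eqxx.
have [{Hj}j Hj Hmin] := ex_minnP (ex_intro (fun j => cauchy_int z0 rho f j.+1 z0 != 0) j Hj).
set a := cauchy_int z0 rho f j.+1 z0 in Hj.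
have a0 : 0 < cmod a by rewrite cmod_gt0.
pose K := 8 * rho * (M * (2 / rho) ^+ j.+1 * (4 / rho)) + 1.
have K0 : 0 < K.
  have : 0 <= 8 * rho * (M * (2 / rho) ^+ j.+1 * (4 / rho)).
    by rewrite !mulr_ge0 ?invr_ge0 ?exprn_ge0 ?mulr_ge0 ?invr_ge0 // ltW.
  by rewrite /K; lra.
have aK : 0 < cmod a / 2 / K by rewrite !divr_gt0.
exists j; exists (cmod a / 2 / B); first by rewrite !divr_gt0.
apply: filterS3 HB (cnbhs_disc z0 rho4) (cnbhs_disc z0 aK) => w cB Dw wK.
have Dw' : disc z0 (rho / 2) w by move: Dw; rewrite /disc /=; lra.
have := cauchy_int_expand j.+1 rho0 cf Dw'.
rewrite big_ord_recr /= big1 ?add0r => [|k _]; last first.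
  apply/eqP; rewrite mulf_eq0; apply/orP; right; apply: contraT => H.
  by have := Hmin k H; rewrite leqNgt ltn_ord.
rewrite exprSr -mulrA -mulrDr (cauchy_formula rho0 rr hf Dw').
set T := (w - z0) * _ => /(congr1 (@cmod R)); rewrite !cmodM cmodX -/a => E.
have TK : cmod T <= cmod a / 2.
  rewrite /T cmodM; apply: (@le_trans _ _ (cmod a / 2 / K * K)).
    apply: ler_pM; rewrite ?cmod_ge0 //; first exact: ltW.
    by apply: le_trans (rem j.+1 w Dw) _; rewrite /K lerDl.
  by rewrite divfK ?gt_eqF.
have aT : cmod a / 2 <= cmod (a + T).
  have := cmodB_le a (- T); rewrite opprK cmodN; lra.
have p0 : 0 <= cmod (w - z0) ^+ j by rewrite exprn_ge0 ?cmod_ge0.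
rewrite mulrAC ler_pdivrMr //.
apply: (@le_trans _ _ (cmod (w - z0) ^+ j * cmod (a + T))).
  by rewrite mulrC ler_wpM2l.
by rewrite -E ler_wpM2l ?cmod_ge0 // ltW.
Qed.

End Cauchy.

(** * Coordinates on the sphere *)

Section Sphere.
Variable R : realType.
Local Notation C := R[i].
Local Notation Co := (R[i]^o).
Local Notation sphere := (one_point_compactification Co).
Implicit Types (f g h : C -> C) (z w t : C) (psi : Co -> sphere).

Lemma Co_bounded (K : set Co) : compact K -> exists2 M : R, 0 < M & forall w, K w -> cmod w <= M.
Proof.
move=> cK; have [||M M0 HM] := compact_bounded_image (y := fun x : Co => x : C) (f := id) cK.
- by move=> t _ d d0; apply/nbhs_cnbhs; exists d.
- by move=> t _; exact: cts_id.
by exists M.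
Qed.

Lemma closed_cdisc (rho : R) : closed [set w : Co | cmod w <= rho].
Proof.
move=> w H; rewrite /= leNgt; apply/negP => rw.
have : nbhs (w : Co) [set v : Co | rho < cmod v].
  apply/nbhs_cnbhs; exists (cmod w - rho); first by rewrite subr_gt0.
  by move=> v; rewrite cmodC /=; have := cmodB_le w v; lra.
by move=> /H [v [/=]]; rewrite leNgt => /negP.
Qed.

Lemma compact_cdisc (rho : R) : compact [set w : Co | cmod w <= rho].
Proof.
have cK : compact (`[- rho, rho]%classic `*` `[- rho, rho]%classic : set (R * R)).
  by apply: compact_setX; exact: segment_compact.
pose y (p : R * R) : Co := (p.1 +i* p.2)%C.
have cy : continuous y.
  move=> [s t] U /nbhs_cnbhs [d d0 Hd].
  apply/nbhs_ballP; exists (d / 2); first by rewrite /= divr_gt0.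
  move=> [s' t'] [/= H1 H2]; rewrite /ball /= in H1 H2.
  apply: Hd; apply: le_lt_trans (cmod_le_ReIm _) _ => /=.
  rewrite [`|s' - s|]distrC [`|t' - t|]distrC; lra.
apply: (@subclosed_compact _ _ (y @` (`[- rho, rho]%classic `*` `[- rho, rho]%classic))).
- exact: closed_cdisc.
- by apply: continuous_compact cK; exact: continuous_subspaceT.
move=> z /= zr; exists (complex.Re z, complex.Im z); last by rewrite /y /=; case: (z).
by split; rewrite /= in_itv /= -ler_norml; apply: le_trans zr; [exact: Re_le_cmod|exact: Im_le_cmod].
Qed.

Lemma nbhs_infty (U : set sphere) : nbhs (None : sphere) U ->
  exists2 M : R, 0 < M & forall w, M < cmod w -> U (Some w).
Proof.
move=> [K [cK _] KU]; have [M M0 HM] := Co_bounded cK.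
exists M => // w Mw; apply: KU; left; exists w => // /HM.
by rewrite leNgt Mw.
Qed.

Lemma infty_nbhs (M : R) :
  nbhs (None : sphere) [set p | if p is Some w then M < cmod w else true].
Proof.
exists [set w : Co | cmod w <= M]; first by split; [exact: compact_cdisc|exact: closed_cdisc].
by move=> p [[w /= Hw <-]|->//]; rewrite ltNge; apply/negP.
Qed.

Lemma nbhs_Some z (U : set sphere) : nbhs (Some z : sphere) U <-> cnbhs z (fun w => U (Some w)).
Proof. by split=> /nbhs_cnbhs. Qed.

Lemma open_disc_in (V : set Co) t : open V -> V t -> exists2 r : R, 0 < r & disc t r `<=` V.
Proof.
move=> oV Vt; have /nbhs_cnbhs [r r0 Hr] : nbhs (t : Co) V by apply: open_nbhs_nbhs.
by exists r => // w; exact: Hr.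
Qed.

Definition acoord psi : C -> C := fun t => affine_coord (psi t).

Definition icoord psi : C -> C := fun t => affine_coord (sphere_inv (psi t)).

Section LocalCoordinate.
Variables (S : set sphere) (V : set Co) (psi : Co -> sphere) (t0 : C).
Hypotheses (Vpsi : local_coordinate S V psi) (Vt0 : V t0).

Lemma coord_near (U : set sphere) : nbhs (psi t0) U -> \forall t \near cnbhs t0, U (psi t).
Proof.
case: Vpsi => _ _ _ /(_ t0 Vt0) [cpsi _] NU.
by have /nbhs_cnbhs := cpsi _ NU.
Qed.

Lemma coord_V : \forall t \near cnbhs t0, V t.
Proof.
by case: Vpsi => oV _ _ _; have [r r0 Hr] := open_disc_in oV Vt0; exists r => // w /Hr.
Qed.

Lemma acoord_derivable : psi t0 <> None -> cderivable (acoord psi) t0.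
Proof.
case: Vpsi => _ _ _ /(_ t0 Vt0) [_]; case: (psi t0) => [w|//] H _.
exact/cderivableP.
Qed.

Lemma coord_fin_near z0 : psi t0 = Some z0 ->
  \forall t \near cnbhs t0, psi t = Some (acoord psi t).
Proof.
move=> E; have : nbhs (psi t0) [set p | p <> None].
  by rewrite E; apply/nbhs_Some; exists 1 => // w _.
by move=> /coord_near; apply: filterS => t; rewrite /acoord /=; case: (psi t).
Qed.

Lemma coord_inj : \forall t \near cnbhs t0, psi t = psi t0 -> t = t0.
Proof.
case: Vpsi => _ injV _ _; apply: filterS coord_V => t Vt E.
by apply: (injV t t0) => //; rewrite inE.
Qed.

Lemma icoord_derivable_inf : psi t0 = None -> cderivable (icoord psi) t0.
Proof.
case: Vpsi => _ _ _ /(_ t0 Vt0) [_] + E; rewrite E => H.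
exact/cderivableP.
Qed.

End LocalCoordinate.

Lemma near_neq_point (r : R) t : 0 < r -> exists2 w, disc t r w & w != t.
Proof.
move=> r0; exists (t + (r / 2)%:C%C).
  rewrite /disc addrAC subrr add0r cmod_real ger0_norm; lra.
rewrite -subr_eq0 addrAC subrr add0r -cmod_gt0 cmod_real ger0_norm; lra.
Qed.

(** Riemann's removable singularity theorem: two extra powers make [(t - t0)^(m + 2) h] vanish to
    second order at [t0], hence differentiable there, whatever the value [h t0] is. *)
Lemma meromorphic_bound h t0 m (M : R) :
  (\forall t \near cnbhs t0, t != t0 -> cderivable h t /\ cmod (h t) * cmod (t - t0) ^+ m <= M) ->
  meromorphic_at (h : Co -> Co) t0.
Proof.
move=> [r r0 H]; pose g t := (t - t0) ^+ m.+2 * h t.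
exists m.+2, g; split; last first.
  rewrite /= near_withinE; apply/nbhs_cnbhs; exists r => //.
apply/nbhs_cnbhs; exists r => // t tr; apply/cderivableP.
have [->|tt] := eqVneq t t0; last first.
  have [[l Hl] _] := H t tr tt.
  have := cderM (cderX m.+2 (cderB (cder_id t) (cder_cst t0 t))) Hl.
  by move=> K; eexists; exact: K.
exists 0; apply/cder_epsP => e e0.
pose B := `|M| + 1; have B0 : 0 < B by rewrite /B; have := normr_ge0 M; lra.
have eB : 0 < e / B by rewrite divr_gt0.
apply: filterS2 (cnbhs_disc t0 r0) (cnbhs_disc t0 eB) => w wr we.
have E : g t0 = 0 by rewrite /g subrr exprS !mul0r.
rewrite E mul0r !subr0.
have [->|wt] := eqVneq w t0; first by rewrite E subrr cmod0 mulr0.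
have [_ Hw] := H w wr wt.
rewrite /g cmodM cmodX exprSr exprSr.
set x := cmod (w - t0) in we Hw *; have x0 : 0 <= x by exact: cmod_ge0.
have -> : x ^+ m * x * x * cmod (h w) = (cmod (h w) * x ^+ m) * x * x by ring.
rewrite ler_wpM2r //.
apply: (@le_trans _ _ (B * x)).
  by rewrite ler_wpM2r // (le_trans Hw) // (le_trans (ler_norm _)) // /B lerDl.
by rewrite -ler_pdivlMl // mulrC ltW.
Qed.

Lemma qdE h psi t : qd_coef h psi t = h (acoord psi t) * c1der (acoord psi) t ^+ 2.
Proof. by []. Qed.

(** Injectivity of a coordinate serves to exclude that it is locally constant. The order [j] is left
    open, as poles of any order are allowed. *)
Lemma lower_bound_near (chi : C -> C) t0 z0 (r : R) : 0 < r -> holo_on (disc t0 r) chi ->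
  chi t0 = z0 -> (\forall t \near cnbhs t0, chi t = z0 -> t = t0) ->
  exists j, exists2 c : R, 0 < c &
    \forall w \near cnbhs t0, c * cmod (w - t0) ^+ j <= cmod (chi w - z0).
Proof.
move=> r0 hchi chi0 inj.
apply: (@holo_lower_bound _ t0 r (fun t => chi t - z0)) => //.
- by move=> t /hchi [l Hl]; exists (l - 0); apply: cderB => //; exact: cder_cst.
- by rewrite chi0 subrr.
move=> s s0; move: inj => [d d0 Hd].
have md : 0 < Num.min s d by rewrite lt_min s0.
have [w Dw wt] := near_neq_point t0 md; exists w.
  by move: Dw; rewrite /disc lt_min => /andP[].
rewrite subr_eq0; apply: contra wt => /eqP/Hd -> //.
by move: Dw; rewrite /disc lt_min => /andP[].
Qed.

Lemma holo_near_disc f t0 : (\forall t \near cnbhs t0, cderivable f t) ->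
  exists2 r : R, 0 < r & holo_on (disc t0 r) f.
Proof. by move=> [r r0 H]; exists r => // t; exact: H. Qed.

Lemma meromorphic_qd_fin S V psi t0 z0 h m (M : R) : local_coordinate S V psi -> V t0 ->
  psi t0 = Some z0 ->
  (\forall z \near cnbhs z0, z != z0 -> cderivable h z /\ cmod (h z) * cmod (z - z0) ^+ m <= M) ->
  meromorphic_at (qd_coef h psi) t0.
Proof.
move=> Vpsi Vt0 E0 Hh.
have fin := coord_fin_near Vpsi Vt0 E0.
pose chi := acoord psi.
have chi0 : chi t0 = z0 by rewrite /chi /acoord E0.
have [r r0 hchi] : exists2 r : R, 0 < r & holo_on (disc t0 r) chi.
  apply: holo_near_disc; apply: filterS2 (coord_V Vpsi Vt0) fin => t Vt Et.
  by apply: acoord_derivable Vpsi Vt _; rewrite Et.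
have hd := holo_c1der hchi.
have inj : \forall t \near cnbhs t0, chi t = z0 -> t = t0.
  apply: filterS2 fin (coord_inj Vpsi Vt0) => t Et Ht Ez; apply: Ht.
  by rewrite Et E0 -Ez.
have [j [c c0 Hc]] := lower_bound_near r0 hchi chi0 inj.
have D0 := disc_center t0 r0.
have cchi := cderivable_cts (hchi t0 D0).
have [B B0 HB] := cts_bounded (cderivable_cts (hd t0 D0)).
move: Hh => [d d0 Hh].
have M1 : 0 <= `|M| by [].
apply: (@meromorphic_bound _ _ (j * m)%N (`|M| * B ^+ 2 / c ^+ m)).
have near1 : \forall t \near cnbhs t0, cmod (chi t - z0) < d by rewrite -chi0; exact: cchi.
apply: filterS3 (filterI near1 inj) (filterI HB Hc) (cnbhs_disc t0 r0) => t [td it] [cB cl] Dt tt.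
have cz : chi t != z0 by apply: contra tt => /eqP/it ->.
have [[l Hl] Hb] := Hh (chi t) td cz.
split.
  have [k Hk] := hchi t Dt; have [k' Hk'] := hd t Dt.
  have := cderM (cder_comp Hk Hl) (cderX 2 Hk').
  by move=> K; eexists; exact: K.
rewrite qdE cmodM cmodX -/chi.
have cz0 : 0 < cmod (chi t - z0) by rewrite cmod_gt0 subr_eq0.
have t0' : 0 <= cmod (t - t0) by exact: cmod_ge0.
rewrite ler_pdivlMr ?exprn_gt0 // -[_ * _ * c ^+ m]mulrA exprM -exprMn.
have H1 : (cmod (t - t0) ^+ j * c) ^+ m <= cmod (chi t - z0) ^+ m.
  by rewrite lerXn2r ?nnegrE ?cmod_ge0 ?mulr_ge0 ?exprn_ge0 // 1?mulrC // ltW.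
have H2 : cmod (c1der chi t) ^+ 2 <= B ^+ 2.
  by rewrite lerXn2r ?nnegrE ?cmod_ge0 // ltW.
apply: (@le_trans _ _ (cmod (h (chi t)) * B ^+ 2 * cmod (chi t - z0) ^+ m)).
  apply: ler_pM => //; rewrite ?mulr_ge0 ?exprn_ge0 ?mulr_ge0 ?exprn_ge0 ?cmod_ge0 //; first exact: ltW.
  by rewrite ler_wpM2l ?cmod_ge0.
rewrite mulrAC; apply: ler_wpM2r; first exact: sqr_ge0.
exact: le_trans Hb (ler_norm _).
Qed.

Lemma icoord_near S V psi t0 : local_coordinate S V psi -> V t0 -> psi t0 = None ->
  \forall t \near cnbhs t0, cderivable (icoord psi) t /\
    (t != t0 -> [/\ psi t = Some (acoord psi t), acoord psi t != 0,
       icoord psi t = (acoord psi t)^-1 & \forall s \near cnbhs t, cderivable (acoord psi) s]).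
Proof.
move=> Vpsi Vt0 E0.
have : \forall t \near cnbhs t0, (if psi t is Some w then 1 < cmod w else true).
  have H : nbhs (psi t0) [set p : sphere | if p is Some w then 1 < cmod w else true].
    by rewrite E0; exact: infty_nbhs.
  by have K := coord_near Vpsi Vt0 H; apply: filterS K => t /=; case: (psi t).
move=> big; apply: filterS3 big (coord_inj Vpsi Vt0) (coord_V Vpsi Vt0) => t Ht inj Vt.
have [-> |tt] := eqVneq t t0; first by split => //; exact: icoord_derivable_inf Vpsi Vt0 E0.
have Et : psi t = Some (acoord psi t).
  rewrite /acoord; case E: (psi t) => [w //|].
  by move: tt; rewrite inj ?eqxx // E E0.
have wt : acoord psi t != 0.
  by rewrite -cmod_gt0; move: Ht; rewrite Et; apply: lt_trans.
have fin := coord_fin_near Vpsi Vt Et.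
have dd : \forall s \near cnbhs t, cderivable (acoord psi) s.
  apply: filterS2 (coord_V Vpsi Vt) fin => s Vs Es.
  by apply: acoord_derivable Vpsi Vs _; rewrite Es.
have [l Hl] := cnbhs_singleton dd.
have iE s : psi s = Some (acoord psi s) -> acoord psi s != 0 -> icoord psi s = (acoord psi s)^-1.
  by move=> Es ws; rewrite {1}/icoord Es /= (negbTE ws).
split; last by split => //; exact: iE.
exists (- l / acoord psi t ^+ 2); apply: cder_near (cderV wt Hl).
apply: filterS2 fin (near_neq0 (cder_cts Hl) wt) => s Es ws.
by rewrite iE.
Qed.

(** In the coordinate [t = 1 / z] the coefficient is [h (1 / t) / t^4], so [h = O(z^-2)] means at
    most a double pole at infinity. *)
Lemma meromorphic_qd_inf S V psi t0 h (rho M : R) : local_coordinate S V psi -> V t0 ->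
  psi t0 = None ->
  (forall z, rho < cmod z -> cderivable h z /\ cmod (h z) * cmod z ^+ 2 <= M) ->
  meromorphic_at (qd_coef h psi) t0.
Proof.
move=> Vpsi Vt0 E0 Hh.
have ic := icoord_near Vpsi Vt0 E0.
pose chi := icoord psi.
have chi0 : chi t0 = 0 by rewrite /chi /icoord E0.
have [r r0 hchi] : exists2 r : R, 0 < r & holo_on (disc t0 r) chi.
  by apply: holo_near_disc; apply: filterS ic => t [].
have hd := holo_c1der hchi.
have inj : \forall t \near cnbhs t0, chi t = 0 -> t = t0.
  apply: filterS ic => t [_ Ht] Ez; apply/eqP; apply: contraT => /Ht [_ H1 H2 _].
  by move: H1; rewrite -invr_eq0 -H2 -/chi Ez eqxx.
have [j [c c0 Hc]] := lower_bound_near r0 hchi chi0 inj.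
have D0 := disc_center t0 r0.
have [B B0 HB] := cts_bounded (cderivable_cts (hd t0 D0)).
have big : \forall t \near cnbhs t0, (if psi t is Some w then rho < cmod w else true).
  have H : nbhs (psi t0) [set p : sphere | if p is Some w then rho < cmod w else true].
    by rewrite E0; exact: infty_nbhs.
  by have K := coord_near Vpsi Vt0 H; apply: filterS K => t /=; case: (psi t).
apply: (@meromorphic_bound _ _ (j * 2)%N (M * B ^+ 2 / c ^+ 2)).
apply: filterS3 (filterI big ic) (filterI HB Hc)
  (filterI (coord_V Vpsi Vt0) (cnbhs_disc t0 r0)) => t [bt [_ it]] [cB cl] [Vt Dt] tt.
have [Et wt Ei dd] := it tt.
rewrite Et in bt; have [[l Hl] Hb] := Hh _ bt.
have [s s0 hs] := holo_near_disc dd.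
have hds := holo_c1der hs; have Ds := disc_center t s0.
have [k Hk] := hs t Ds; have [k' Hk'] := hds t Ds.
split.
  have := cderM (cder_comp Hk Hl) (cderX 2 Hk').
  by move=> K; eexists; exact: K.
(* [eta' = - chi' / chi ^ 2] as [eta = 1 / chi] *)
have chit : chi t = (acoord psi t)^-1 by exact: Ei.
have Ed : c1der (acoord psi) t = - c1der chi t * acoord psi t ^+ 2.
  have d1 : cder chi t (- c1der (acoord psi) t / acoord psi t ^+ 2).
    apply: cder_near (cderV wt (holo_cder hs Ds)).
    apply: filterS2 (coord_fin_near Vpsi Vt Et) (near_neq0 (cder_cts Hk) wt) => v Ev wv.
    by rewrite /chi /icoord Ev /= (negbTE wv).
  rewrite (cder_unique (holo_cder hchi Dt) d1).
  by field.
rewrite qdE Ed cmodM cmodX [cmod (- _ * _)]cmodM cmodN cmodX.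
have w0 : 0 < cmod (acoord psi t) by rewrite cmod_gt0.
have cl' : c * cmod (t - t0) ^+ j * cmod (acoord psi t) <= 1.
  move: cl; rewrite subr0 chit cmodV => cl.
  by rewrite -ler_pdivlMr // mul1r.
have H2 : cmod (c1der chi t) ^+ 2 <= B ^+ 2.
  by rewrite lerXn2r ?nnegrE ?cmod_ge0 // ltW.
rewrite ler_pdivlMr ?exprn_gt0 // exprM.
set a := cmod (h _) in Hb *; set w := cmod (acoord psi t) in Hb cl' w0 *.
set b := cmod (c1der chi t) in H2 *; set x := cmod (t - t0) ^+ j in cl' *.
have -> : a * ((b * w ^+ 2) ^+ 2) * x ^+ 2 * c ^+ 2 = (a * w ^+ 2) * b ^+ 2 * (c * x * w) ^+ 2 by ring.
have a0 : 0 <= a by exact: cmod_ge0.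
have x0 : 0 <= x by rewrite exprn_ge0 ?cmod_ge0.
rewrite -[leRHS]mulr1; apply: ler_pM.
- by apply: mulr_ge0; [apply: mulr_ge0 => //; exact: sqr_ge0|exact: sqr_ge0].
- exact: sqr_ge0.
- by apply: ler_pM => //; [apply: mulr_ge0 => //; exact: sqr_ge0|exact: sqr_ge0].
- by rewrite expr_le1 // !mulr_ge0 // ltW.
Qed.

End Sphere.

(** * Schwarzian derivatives of iterates *)

Section Schwarzian.
Variable R : realType.
Local Notation C := R[i].
Local Notation Co := (R[i]^o).
Implicit Types (p q f : {poly R[i]}) (z w c : C).

Definition pschw p z : C :=
  p^`()^`()^`().[z] / p^`().[z] - 3 / 2 * (p^`()^`().[z] / p^`().[z]) ^+ 2.

Lemma schwarzian_horner p z : schwarzian (horner p : Co -> Co) z = pschw p z.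
Proof.
by rewrite /schwarzian /derive1n /= !derive1_hornerC.
Qed.

Definition pol_iter f n : {poly R[i]} := iter n (fun q => f \Po q) 'X.

Lemma pol_iterS f n : pol_iter f n.+1 = f \Po pol_iter f n.
Proof. by []. Qed.

Lemma pol_iterE f n : (iter n (horner f) : C -> C) = horner (pol_iter f n).
Proof.
apply/funext => z; elim: n => [|n IH]; first by rewrite hornerX.
by rewrite pol_iterS horner_comp -IH.
Qed.

Lemma pol_iter_add f m n z : (pol_iter f (m + n)).[z] = (pol_iter f m).[(pol_iter f n).[z]].
Proof. by rewrite -!pol_iterE iterD. Qed.

Lemma pschw_comp f q z : (f \Po q)^`().[z] != 0 ->
  pschw (f \Po q) z = pschw f q.[z] * q^`().[z] ^+ 2 + pschw q z.
Proof.
rewrite /pschw !(deriv_comp, derivM, derivD) !(hornerD, hornerM, horner_comp).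
rewrite mulf_eq0 negb_or => /andP[f0 q0].
by field; rewrite q0 f0.
Qed.

Lemma pol_iter_deriv_neq0 f n z : (pol_iter f n.+1)^`().[z] != 0 ->
  f^`().[(pol_iter f n).[z]] != 0 /\ (pol_iter f n)^`().[z] != 0.
Proof.
rewrite pol_iterS deriv_comp hornerM horner_comp mulf_eq0 negb_or.
by move/andP.
Qed.

Lemma pschw_iter f n z : (pol_iter f n)^`().[z] != 0 ->
  pschw (pol_iter f n) z =
  \sum_(k < n) pschw f (pol_iter f k).[z] * (pol_iter f k)^`().[z] ^+ 2.
Proof.
elim: n => [|n IH] H.
  by rewrite big_ord0 /pschw /pol_iter /= derivX -polyC1 !derivC horner0 !mul0r expr0n /= mulr0 subrr.
rewrite big_ord_recr /= -IH; first by rewrite addrC; exact: pschw_comp.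
by have [] := pol_iter_deriv_neq0 H.
Qed.

(** By the convention [0^-1 = 0]; this default value at the poles lets [pschw_le] hold
    everywhere. *)
Lemma pschw_crit p z : p^`().[z] = 0 -> pschw p z = 0.
Proof. by rewrite /pschw => ->; rewrite invr0 !mulr0 expr0n /= mulr0 subrr. Qed.

Definition lin_prod (s : seq C) : {poly R[i]} := \prod_(c <- s) ('X - c%:P).

Lemma poly_factor p : {s : seq C | p = lead_coef p *: lin_prod s}.
Proof. exact: closed_field_poly_normal. Qed.

Lemma size_factor p s : p != 0 -> p = lead_coef p *: lin_prod s -> size s = (size p).-1.
Proof.
move=> p0 E; rewrite E size_scale ?lead_coef_eq0 // /lin_prod size_prod_XsubC //.
Qed.

Lemma cmod_lin_prod s z : cmod (lin_prod s).[z] = \prod_(c <- s) cmod (z - c).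
Proof.
rewrite /lin_prod horner_prod cmod_prod; apply: eq_bigr => c _.
by rewrite hornerXsubC.
Qed.

Lemma log_deriv_lin s z : (lin_prod s).[z] != 0 ->
  (lin_prod s)^`().[z] / (lin_prod s).[z] = \sum_(c <- s) (z - c)^-1 /\
  (lin_prod s)^`()^`().[z] / (lin_prod s).[z] -
    ((lin_prod s)^`().[z] / (lin_prod s).[z]) ^+ 2 = - \sum_(c <- s) (z - c)^-1 ^+ 2.
Proof.
rewrite /lin_prod; elim: s => [|c s IH].
  by rewrite !big_nil !derivC horner0 !mul0r expr0n /= subrr oppr0.
rewrite !big_cons derivM derivXsubC mul1r derivD derivM derivXsubC mul1r.
rewrite !hornerD !hornerM hornerXsubC.
rewrite mulf_eq0 negb_or => /andP[zc pz]; have [<- H2] := IH pz.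
split; first by field; rewrite zc pz.
rewrite opprD -H2; field; rewrite zc pz //.
Qed.

(** The size of the square root of a Schwarzian with double poles along [s]. At a point of [s] the
    corresponding term is [0], by [0^-1 = 0]. *)
Definition inv_dist_sum (s : seq C) z : R := \sum_(c <- s) (cmod (z - c))^-1.

Lemma inv_dist_sum_ge0 s z : 0 <= inv_dist_sum s z.
Proof. by apply: sumr_ge0 => c _; rewrite invr_ge0 cmod_ge0. Qed.

Lemma sum_sqr_le (s : seq C) (F : C -> R) : (forall c, 0 <= F c) ->
  \sum_(c <- s) F c ^+ 2 <= (\sum_(c <- s) F c) ^+ 2.
Proof.
move=> F0; elim: s => [|c s IH]; first by rewrite !big_nil expr0n.
rewrite !big_cons sqrrD.
have := F0 c; have : 0 <= \sum_(j <- s) F j by exact: sumr_ge0.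
move=> H1 H2; have := mulr_ge0 H2 H1; rewrite mulr2n; lra.
Qed.

(** [S_p = (p''/p')' - (p''/p')^2 / 2], and for [p' = a \prod (z - c)] this is [- \sum (z - c)^-2 -
    (\sum (z - c)^-1)^2 / 2]. *)
Lemma pschw_le p s z : p^`() = lead_coef p^`() *: lin_prod s ->
  cmod (pschw p z) <= 3 / 2 * inv_dist_sum s z ^+ 2.
Proof.
move=> E; have [/pschw_crit ->|pz] := eqVneq p^`().[z] 0.
  by rewrite cmod0 mulr_ge0 // sqr_ge0.
have -> : pschw p z = - (\sum_(c <- s) (z - c)^-1 ^+ 2) - 2^-1 * (\sum_(c <- s) (z - c)^-1) ^+ 2.
  rewrite /pschw; set a := lead_coef p^`() in E.
  move: pz; rewrite E !derivZ !hornerZ mulf_eq0 negb_or => /andP[a0 pz].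
  have [<- <-] := log_deriv_lin pz; by field; rewrite a0 pz.
have H1 : cmod (\sum_(c <- s) (z - c)^-1) <= inv_dist_sum s z.
  apply: le_trans (cmod_sum _ _ _) _.
  by apply: ler_sum => c _; rewrite cmodV.
have H2 : cmod (\sum_(c <- s) (z - c)^-1 ^+ 2) <= inv_dist_sum s z ^+ 2.
  apply: le_trans (cmod_sum _ _ _) _.
  apply: le_trans (sum_sqr_le s (F := fun c => (cmod (z - c))^-1) _); last first.
    by move=> c; rewrite invr_ge0 cmod_ge0.
  by apply: ler_sum => c _; rewrite cmodX cmodV.
apply: le_trans (cmodD _ _) _; rewrite !cmodN cmodM cmodX cmodV cmod_nat.
have : cmod (\sum_(c <- s) (z - c)^-1) ^+ 2 <= inv_dist_sum s z ^+ 2.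
  by rewrite lerXn2r ?nnegrE ?cmod_ge0 ?inv_dist_sum_ge0.
lra.
Qed.

Lemma sqrt_pschw_le p s z : p^`() = lead_coef p^`() *: lin_prod s ->
  Num.sqrt (cmod (pschw p z)) <= 2 * inv_dist_sum s z.
Proof.
move=> /pschw_le H; have i0 := inv_dist_sum_ge0 s z.
have p0 : 0 <= 2 * inv_dist_sum s z by rewrite mulr_ge0.
rewrite -(ger0_norm p0) -sqrtr_sqr ler_wsqrtr //.
apply: le_trans (H z) _; rewrite exprMn.
have := sqr_ge0 (inv_dist_sum s z); lra.
Qed.

Lemma sqrtrD_le (x y : R) : 0 <= x -> 0 <= y -> Num.sqrt (x + y) <= Num.sqrt x + Num.sqrt y.
Proof.
move=> x0 y0; have s0 : 0 <= Num.sqrt x + Num.sqrt y by rewrite addr_ge0 ?sqrtr_ge0.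
rewrite -(ger0_norm s0) -sqrtr_sqr ler_wsqrtr // sqrrD !sqr_sqrtr //.
have := mulr_ge0 (sqrtr_ge0 x) (sqrtr_ge0 y); rewrite mulr2n; lra.
Qed.

Lemma sqrt_cmod_sum n (F : 'I_n -> C) :
  Num.sqrt (cmod (\sum_(k < n) F k)) <= \sum_(k < n) Num.sqrt (cmod (F k)).
Proof.
elim: n F => [|n IH] F; first by rewrite !big_ord0 cmod0 sqrtr0.
rewrite !big_ord_recr /=.
apply: le_trans (ler_wsqrtr (cmodD _ _)) _.
apply: le_trans (sqrtrD_le (cmod_ge0 _) (cmod_ge0 _)) _.
by apply: lerD.
Qed.

Lemma sqrt_pschw_iter_le f s n z : f^`() = lead_coef f^`() *: lin_prod s ->
  Num.sqrt (cmod (pschw (pol_iter f n) z)) <=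
  \sum_(k < n) 2 * (cmod (pol_iter f k)^`().[z] * inv_dist_sum s (pol_iter f k).[z]).
Proof.
move=> E; have [/pschw_crit ->|pz] := eqVneq (pol_iter f n)^`().[z] 0.
  rewrite cmod0 sqrtr0 sumr_ge0 // => k _.
  by rewrite !mulr_ge0 ?cmod_ge0 ?inv_dist_sum_ge0.
rewrite (pschw_iter pz); apply: le_trans (sqrt_cmod_sum _) _.
apply: ler_sum => k _; rewrite cmodM sqrtrM ?cmod_ge0 // cmodX sqrtr_sqr ger0_norm ?cmod_ge0 //.
rewrite mulrCA mulrC; apply: ler_wpM2l; first exact: cmod_ge0.
exact: sqrt_pschw_le.
Qed.

End Schwarzian.

(** * The basin of infinity *)

Section Infinity.
Variable R : realType.
Local Notation C := R[i].
Implicit Types (p q f : {poly R[i]}) (z w c a b : C) (g h : C -> C).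

(* [g w = a + O(1/w)] at infinity *)
Definition asym g a := exists A rho : R, [/\ 0 <= A, 1 <= rho &
  forall w, rho <= cmod w -> cmod (g w - a) <= A / cmod w].

Lemma asym_cst a : asym (fun=> a) a.
Proof.
exists 0, 1; split => // w _; by rewrite subrr cmod0 mul0r.
Qed.

Lemma asymD g h a b : asym g a -> asym h b -> asym (fun w => g w + h w) (a + b).
Proof.
move=> [A [r [A0 r1 Hg]]] [B [s [B0 s1 Hh]]].
exists (A + B), (Num.max r s); split; [exact: addr_ge0|by rewrite le_max r1|].
move=> w; rewrite ge_max => /andP[/Hg H1 /Hh H2].
by rewrite opprD addrACA; apply: le_trans (cmodD _ _) _; rewrite mulrDl lerD.
Qed.

Lemma asymM g h a b : asym g a -> asym h b -> asym (fun w => g w * h w) (a * b).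
Proof.
move=> [A [r [A0 r1 Hg]]] [B [s [B0 s1 Hh]]].
exists ((cmod a + A) * B + A * cmod b), (Num.max r s); split.
- by rewrite addr_ge0 // mulr_ge0 ?addr_ge0 ?cmod_ge0.
- by rewrite le_max r1.
move=> w; rewrite ge_max => /andP[rw sw].
have w0 : 0 < cmod w by apply: lt_le_trans rw; lra.
have w1 : A / cmod w <= A.
  by rewrite ler_pdivrMr // ler_peMr //; lra.
have H1 := Hg w rw; have H2 := Hh w sw.
have ga : cmod (g w) <= cmod a + A.
  have := cmodB_le (g w) a; lra.
have -> : g w * h w - a * b = g w * (h w - b) + (g w - a) * b by ring.
apply: le_trans (cmodD _ _) _; rewrite !cmodM mulrDl; apply: lerD.
  by rewrite -mulrA; apply: ler_pM; rewrite ?cmod_ge0.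
by rewrite mulrAC; apply: ler_wpM2r; rewrite ?cmod_ge0.
Qed.

Lemma asym_neq0 g a : asym g a -> a != 0 -> exists2 rho : R, 1 <= rho &
  forall w, rho <= cmod w -> cmod a / 2 <= cmod (g w).
Proof.
move=> [A [r [A0 r1 Hg]]]; rewrite -cmod_gt0 => a0.
exists (r + 2 * A / cmod a) => [|w rw].
  have : 0 <= 2 * A / cmod a by rewrite divr_ge0 ?mulr_ge0 // ltW.
  lra.
have q0 : 0 <= 2 * A / cmod a by rewrite divr_ge0 ?mulr_ge0 // ltW.
have w0 : 0 < cmod w by lra.
have H := Hg w ltac:(lra).
have H2 : A / cmod w <= cmod a / 2.
  rewrite ler_pdivrMr // -ler_pdivrMl ?divr_gt0 // invf_div.
  have -> : 2 / cmod a * A = 2 * A / cmod a by ring.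
  lra.
rewrite cmodC in H; have := cmodB_le a (g w); lra.
Qed.

Lemma asymV g a : asym g a -> a != 0 -> asym (fun w => (g w)^-1) a^-1.
Proof.
move=> Hg a0; have [s s1 Hs] := asym_neq0 Hg a0.
move: Hg => [A [r [A0 r1 Hg]]].
have ca : 0 < cmod a by rewrite cmod_gt0.
exists (A / (cmod a / 2 * cmod a)), (Num.max r s); split.
- by rewrite divr_ge0 // mulr_ge0 ?divr_ge0 // ltW.
- by rewrite le_max r1.
move=> w; rewrite ge_max => /andP[rw sw].
have H1 := Hg w rw; have H2 := Hs w sw.
have gw : 0 < cmod (g w) by apply: lt_le_trans H2; rewrite divr_gt0.
have gw0 : g w != 0 by rewrite -cmod_gt0.
have -> : (g w)^-1 - a^-1 = (a - g w) / (g w * a) by field; rewrite a0 gw0.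
rewrite cmodM cmodV cmodM cmodC -mulrA [_^-1 / _]mulrC mulrA.
apply: ler_pM; rewrite ?cmod_ge0 ?invr_ge0 ?mulr_ge0 ?cmod_ge0 //.
rewrite lef_pV2 ?posrE ?mulr_gt0 ?divr_gt0 //.
by rewrite ler_wpM2r // ltW.
Qed.

Lemma asym_ext g h a (rho : R) : (forall w, rho <= cmod w -> g w = h w) -> asym g a -> asym h a.
Proof.
move=> E [A [r [A0 r1 Hg]]]; exists A, (Num.max r rho); split => //.
  by rewrite le_max r1.
by move=> w; rewrite ge_max => /andP[rw sw]; rewrite -E // Hg.
Qed.

Lemma asym_poly p n : (size p <= n.+1)%N -> asym (fun w => p.[w] / w ^+ n) p`_n.
Proof.
move=> sp; exists (\sum_(i < n) cmod p`_i), 1; split => //.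
  by apply: sumr_ge0 => i _; exact: cmod_ge0.
move=> w w1; have w0 : 0 < cmod w by lra.
have wn0 : w != 0 by rewrite -cmod_gt0.
rewrite (horner_coef_wide _ sp) big_ord_recr /= mulrDl mulfK ?expf_neq0 // addrK.
rewrite cmodM cmodV cmodX mulr_suml.
apply: (@le_trans _ _ ((\sum_(i < n) cmod p`_i * cmod w ^+ i) / cmod w ^+ n)).
  rewrite ler_wpM2r ?invr_ge0 ?exprn_ge0 ?cmod_ge0 //.
  apply: le_trans (cmod_sum _ _ _) _.
  by apply: ler_sum => i _; rewrite cmodM cmodX.
rewrite mulr_suml; apply: ler_sum => i _.
rewrite -mulrA; apply: ler_wpM2l; first exact: cmod_ge0.
rewrite ler_pdivrMr ?exprn_gt0 //; case: n sp i => [|n] sp i; first by case: i.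
by rewrite [cmod w ^+ n.+1]exprS mulKf ?gt_eqF // ler_weXn2l // -ltnS ltn_ord.
Qed.

Section Dynamics.
Variables (d : nat) (f : {poly R[i]}).
Hypotheses (d_ge2 : (2 <= d)%N) (deg_f : size f = d.+1).

Local Notation lam := (lead_coef f).

Lemma lam_neq0 : lam != 0.
Proof. by rewrite lead_coef_eq0 -size_poly_eq0 deg_f. Qed.

Lemma lamE : f`_d = lam.
Proof. by rewrite lead_coefE deg_f. Qed.

Lemma dR_gt0 : 0 < d%:R :> R.
Proof. by rewrite ltr0n (leq_trans _ d_ge2). Qed.

Lemma dC_neq0 : d%:R != 0 :> C.
Proof. by rewrite pnatr_eq0 -lt0n (leq_trans _ d_ge2). Qed.

Lemma asym_f : asym (fun w => f.[w] / w ^+ d) lam.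
Proof. by rewrite -lamE; apply: asym_poly; rewrite deg_f. Qed.

Lemma size_deriv_le p n : (size p <= n.+1)%N -> (size p^`() <= n)%N.
Proof.
move=> sp; apply/leq_sizeP => j nj; rewrite coef_deriv nth_default ?mul0rn //.
exact: leq_trans sp _.
Qed.

Lemma asym_wV (n m : nat) p : (m <= n)%N -> (size p <= (n - m).+1)%N ->
  asym (fun w => w ^+ m * p.[w] / w ^+ n) p`_(n - m).
Proof.
move=> mn sp; apply: (asym_ext (rho := 1)) (asym_poly sp) => w w1.
have wn0 : w != 0 by rewrite -cmod_gt0; lra.
rewrite -{2}(subnKC mn) exprD invfM mulrACA mulfV ?mul1r // expf_neq0 //.
Qed.

Lemma asym_f1 : asym (fun w => w * f^`().[w] / w ^+ d) (d%:R * lam).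
Proof.
have s1 : (size f^`() <= (d - 1).+1)%N.
  by apply: size_deriv_le; rewrite deg_f subn1 prednK // (leq_trans _ d_ge2).
have := asym_wV (ltnW d_ge2) s1.
by rewrite coef_deriv subn1 prednK ?(leq_trans _ d_ge2) // lamE mulr_natl.
Qed.

Lemma asym_f2 : asym (fun w => w ^+ 2 * f^`()^`().[w] / w ^+ d) (d%:R * (d%:R - 1) * lam).
Proof.
have s2 : (size f^`()^`() <= (d - 2).+1)%N.
  do 2 apply: size_deriv_le; rewrite deg_f -addn3 -[d.+1]addn1.
  by rewrite -{1}(subnK d_ge2) -addnA.
have := asym_wV d_ge2 s2.
rewrite !coef_deriv -[in f`__]addn2 subnK // lamE.
have -> : (d - 2).+1 = d.-1 by rewrite subn2; case: (d) d_ge2 => [|[]].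
have -> : d.-1.+1 = d by rewrite prednK // (leq_trans _ d_ge2).
rewrite -[_ *+ d.-1]mulr_natl -[lam *+ d]mulr_natl.
have -> : d.-1%:R = d%:R - 1 :> C by rewrite -subn1 natrB // (leq_trans _ d_ge2).
by rewrite mulrCA mulrA.
Qed.

Lemma asym_f3 : asym (fun w => w ^+ 3 * f^`()^`()^`().[w] / w ^+ d)
  (d%:R * (d%:R - 1) * (d%:R - 2) * lam).
Proof.
have [d2|d3] := leqP d 2.
  (* For [d = 2] the subtraction [d - 3] is truncated; the third derivative is [0], in agreement
     with the factor [d - 2]. *)
  have -> : d%:R = 2 :> C by congr _%:R; apply/eqP; rewrite eqn_leq d2.
  have -> : f^`()^`()^`() = 0.
    by apply/eqP; rewrite -size_poly_leq0; do 3 apply: size_deriv_le; rewrite deg_f.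
  rewrite subrr mulr0 mul0r; apply: (asym_ext (rho := 0)) (asym_cst 0) => w _.
  by rewrite horner0 mulr0 mul0r.
have s3 : (size f^`()^`()^`() <= (d - 3).+1)%N.
  do 3 apply: size_deriv_le; rewrite deg_f.
  by rewrite -{1}(subnK d3) !addnS addn0.
have := asym_wV d3 s3.
rewrite !coef_deriv.
have -> : (d - 3).+3 = d by rewrite -{2}(subnK d3) !addnS addn0.
have -> : (d - 3).+2 = d.-1 by rewrite -{2}(subnK d3) !addnS addn0.
have -> : (d - 3).+1 = (d - 2)%N by rewrite -{2}(subnK d3) !addnS addn0 subSS subSS subn0.
rewrite lamE -[_ *+ (d - 2)]mulr_natl -[_ *+ d.-1]mulr_natl -[lam *+ d]mulr_natl.
have -> : d.-1%:R = d%:R - 1 :> C by rewrite -subn1 natrB // (leq_trans _ d_ge2).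
rewrite natrB //.
by have -> : (d%:R - 2) * ((d%:R - 1) * (d%:R * lam)) = d%:R * (d%:R - 1) * (d%:R - 2) * lam :> C by ring.
Qed.

(** Gathers what is used near infinity. The third estimate drives the convergence of logarithmic
    derivatives, the fourth compares [S_f] with the Schwarzian [(1 - d^2) / (2 w^2)] of [w^d], and
    the last drives the Green function. *)
Lemma escape_constants : exists A K R0 : R, [/\ 0 <= A, 0 <= K, 1 <= R0 &
  forall w, R0 <= cmod w ->
   [/\ 2 * cmod w <= cmod f.[w], f^`().[w] != 0,
       cmod (w * f^`().[w] / (d%:R * f.[w]) - 1) <= A / cmod w,
       cmod (w ^+ 2 * pschw f w + (d%:R ^+ 2 - 1) / 2) <= A / cmod w
     & `|ln (cmod f.[w]) - d%:R * ln (cmod w)| <= K]].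
Proof.
have l0 := lam_neq0; have d0 := dC_neq0.
have dl0 : d%:R * lam != 0 by rewrite mulf_neq0.
have [r1 r11 Hr1] := asym_neq0 asym_f l0.
have [r2 r21 Hr2] := asym_neq0 asym_f1 dl0.
have [A3 [r3 [A30 r31 Hr3]]] := asymM asym_f1 (asymV (asymM (asym_cst d%:R) asym_f) dl0).
have V := asymV asym_f1 dl0.
have V2 := asymM asym_f2 V.
have [A4 [r4 [A40 r41 Hr4]]] := asymD (asymM asym_f3 V)
  (asymM (asym_cst (- (3 / 2))) (asymM V2 V2)).
have [A5 [r5 [A50 r51 Hr5]]] := asym_f.
have cl : 0 < cmod lam by rewrite cmod_gt0.
(* The summand [4 / cmod lam] gives [|f w| >= |lam| |w|^d / 2 >= 2 |w|]; the others make the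
   asymptotic estimates valid. *)
pose R0 := r1 + r2 + r3 + r4 + r5 + 4 / cmod lam.
have q0 : 0 <= 4 / cmod lam by rewrite divr_ge0 // ltW.
pose K := `|ln (cmod lam / 2)| + `|ln (cmod lam + A5)|.
exists (A3 + A4), K, R0; split; rewrite ?addr_ge0 //; first by rewrite /R0; lra.
move=> w; rewrite /R0 => wR.
have w1 : 1 <= cmod w by lra.
have w0 : 0 < cmod w by lra.
have wn0 : w != 0 by rewrite -cmod_gt0.
have wd0 : w ^+ d != 0 by rewrite expf_neq0.
have cwd : 0 < cmod w ^+ d by rewrite exprn_gt0.
have H1 := Hr1 w ltac:(lra); have H2 := Hr2 w ltac:(lra).
have H3 := Hr3 w ltac:(lra); have H4 := Hr4 w ltac:(lra).
have H5 := Hr5 w ltac:(lra).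
have fw0 : f.[w] != 0.
  have : 0 < cmod (f.[w] / w ^+ d) by apply: lt_le_trans H1; rewrite divr_gt0.
  by rewrite cmod_gt0 mulf_eq0 negb_or => /andP[].
have fw1 : f^`().[w] != 0.
  have : 0 < cmod (w * f^`().[w] / w ^+ d).
    by apply: lt_le_trans H2; rewrite divr_gt0 // cmod_gt0.
  by rewrite cmod_gt0 !mulf_eq0 !negb_or -andbA => /and3P[].
split => //.
- rewrite cmodM cmodV cmodX ler_pdivlMr // in H1; apply: le_trans H1.
  have E : cmod w ^+ d = cmod w * cmod w * cmod w ^+ (d - 2).
    by rewrite -expr2 -exprD subnKC.
  have p1 : 1 <= cmod w ^+ (d - 2) by rewrite exprn_ege1.
  have c4 : 4 <= cmod lam * cmod w.
    rewrite mulrC -ler_pdivrMr //; lra.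
  have m0 : 0 <= cmod lam / 2 * (cmod w * cmod w) by rewrite !mulr_ge0 // ltW.
  rewrite E mulrA; apply: (@le_trans _ _ (cmod lam / 2 * (cmod w * cmod w))).
    rewrite mulrA; apply: ler_wpM2r; first exact: ltW.
    by rewrite mulrAC ler_pdivlMr // -natrM.
  by rewrite ler_peMr.
- rewrite mulfV // in H3.
  have -> : w * f^`().[w] / (d%:R * f.[w]) =
    w * f^`().[w] / w ^+ d * (d%:R * (f.[w] / w ^+ d))^-1.
    by field; rewrite fw0 d0 wd0.
  apply: le_trans H3 _; rewrite ler_wpM2r ?invr_ge0 ?cmod_ge0 // lerDl //.
- have -> : w ^+ 2 * pschw f w + (d%:R ^+ 2 - 1) / 2 =
    w ^+ 3 * f^`()^`()^`().[w] / w ^+ d * (w * f^`().[w] / w ^+ d)^-1 +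
    - (3 / 2) * (w ^+ 2 * f^`()^`().[w] / w ^+ d * (w * f^`().[w] / w ^+ d)^-1 *
       (w ^+ 2 * f^`()^`().[w] / w ^+ d * (w * f^`().[w] / w ^+ d)^-1)) -
    (d%:R * (d%:R - 1) * (d%:R - 2) * lam / (d%:R * lam) +
     - (3 / 2) * (d%:R * (d%:R - 1) * lam / (d%:R * lam) * (d%:R * (d%:R - 1) * lam / (d%:R * lam)))).
    by rewrite /pschw; field; rewrite fw1 wd0 l0 d0 wn0.
  apply: le_trans H4 _; rewrite ler_wpM2r ?invr_ge0 ?cmod_ge0 // lerDr //.
have -> : ln (cmod f.[w]) - d%:R * ln (cmod w) = ln (cmod (f.[w] / w ^+ d)).
  by rewrite cmodM cmodV cmodX ln_div ?posrE ?exprn_gt0 ?cmod_gt0 // lnXn // mulr_natl.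
set x := cmod (f.[w] / w ^+ d) in H1 *.
have x0 : 0 < x by apply: lt_le_trans H1; rewrite divr_gt0.
have xup : x <= cmod lam + A5.
  have := cmodB_le (f.[w] / w ^+ d) lam; rewrite -/x.
  have : A5 / cmod w <= A5 by rewrite ler_pdivrMr // ler_peMr.
  lra.
have L1 : ln (cmod lam / 2) <= ln x by rewrite ler_ln ?posrE // divr_gt0.
have L2 : ln x <= ln (cmod lam + A5) by rewrite ler_ln ?posrE //; lra.
rewrite ler_norml /K; apply/andP.
have := ler_norm (ln (cmod lam + A5)); have := ler_norm (- ln (cmod lam / 2)).
have := normr_ge0 (ln (cmod lam + A5)); have := normr_ge0 (ln (cmod lam / 2)).
rewrite normrN => ? ? ? ?; split; lra.
Qed.

End Dynamics.
End Infinity.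

(** * Iterates near infinity *)

Section Escape.
Variable R : realType.
Local Notation C := R[i].
Implicit Types (z w c : C) (n m k : nat).
Variables (d : nat) (f : {poly R[i]}) (A K R0 : R).
Hypotheses (d_ge2 : (2 <= d)%N) (A0 : 0 <= A) (K0 : 0 <= K) (R01 : 1 <= R0).
Hypothesis esc : forall w, R0 <= cmod w ->
   [/\ 2 * cmod w <= cmod f.[w], f^`().[w] != 0,
       cmod (w * f^`().[w] / (d%:R * f.[w]) - 1) <= A / cmod w,
       cmod (w ^+ 2 * pschw f w + (d%:R ^+ 2 - 1) / 2) <= A / cmod w
     & `|ln (cmod f.[w]) - d%:R * ln (cmod w)| <= K].

Local Notation fn := (pol_iter f).

Lemma pow2_gt0 n : 0 < 2 ^+ n :> R.
Proof. by rewrite exprn_gt0. Qed.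

Lemma dn_neq0 n : d%:R ^+ n != 0 :> C.
Proof. by rewrite expf_neq0 // dC_neq0. Qed.

Lemma esc_grow z n : R0 <= cmod z -> 2 ^+ n * cmod z <= cmod (fn n).[z].
Proof.
move=> Rz; have z1 : 0 < cmod z by move: R01; lra.
elim: n => [|n IH]; first by rewrite expr0 mul1r hornerX.
rewrite pol_iterS horner_comp exprS -mulrA.
have n1 : 1 <= 2 ^+ n :> R by rewrite exprn_ege1 // ler1n.
have H : R0 <= cmod (fn n).[z].
  by apply: le_trans IH; apply: le_trans Rz _; rewrite ler_peMl // ltW.
have [H1 _ _ _ _] := esc H; apply: le_trans H1.
by rewrite ler_wpM2l.
Qed.

Lemma esc_ge z n : R0 <= cmod z -> R0 <= cmod (fn n).[z].
Proof.
move=> Rz; apply: le_trans (esc_grow n Rz); apply: le_trans Rz _.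
by rewrite ler_peMl ?cmod_ge0 // exprn_ege1 // ler1n.
Qed.

Lemma esc_neq0 z : R0 <= cmod z -> z != 0.
Proof. by move=> Rz; rewrite -cmod_gt0; move: R01; lra. Qed.

Lemma esc_deriv_neq0 z n : R0 <= cmod z -> (fn n)^`().[z] != 0.
Proof.
move=> Rz; elim: n => [|n IH]; first by rewrite derivX hornerC oner_eq0.
rewrite pol_iterS deriv_comp hornerM horner_comp mulf_neq0 //.
by have [] := esc (esc_ge n Rz).
Qed.

(* logarithmic derivative of [f ^ n], normalised; it tends to twice the
   Wirtinger derivative of the Green function *)
Definition nlogd n z : C := (fn n)^`().[z] / (d%:R ^+ n * (fn n).[z]).

Lemma nlogdS n z : (fn n).[z] != 0 -> nlogd n.+1 z = nlogd n z *
  ((fn n).[z] * f^`().[(fn n).[z]] / (d%:R * f.[(fn n).[z]])).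
Proof.
move=> w0; rewrite /nlogd pol_iterS deriv_comp hornerM !horner_comp.
have [->|fw0] := eqVneq f.[(fn n).[z]] 0; first by rewrite !mulr0 invr0 !mulr0.
by rewrite exprS; field; rewrite w0 fw0 dC_neq0 // dn_neq0.
Qed.

(** Bounds all partial products of [1 + A / 2^k], since [A / 2^k] sums to [2 A]. *)
Let B := expR (2 * A).

Lemma B_gt0 : 0 < B. Proof. exact: expR_gt0. Qed.

Lemma esc_ratio z n : R0 <= cmod z ->
  cmod ((fn n).[z] * f^`().[(fn n).[z]] / (d%:R * f.[(fn n).[z]]) - 1) <= A / 2 ^+ n /\
  cmod ((fn n).[z] ^+ 2 * pschw f (fn n).[z] + (d%:R ^+ 2 - 1) / 2) <= A / 2 ^+ n.
Proof.
move=> Rz; have [_ _ H1 H2 _] := esc (esc_ge n Rz).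
have G := esc_grow n Rz.
have W : 2 ^+ n <= cmod (fn n).[z].
  by apply: le_trans G; rewrite ler_peMr ?exprn_ge0 //; move: R01; lra.
have V : A / cmod (fn n).[z] <= A / 2 ^+ n.
  rewrite ler_wpM2l // lef_pV2 ?posrE ?pow2_gt0 //.
  exact: lt_le_trans (pow2_gt0 n) W.
by split; [apply: le_trans H1 V|apply: le_trans H2 V].
Qed.

Lemma Q_bound z n : R0 <= cmod z -> cmod (z * nlogd n z) <= B.
Proof.
move=> Rz; suff H : cmod (z * nlogd n z) <= expR (2 * A - 2 * A / 2 ^+ n).
  apply: le_trans H _; rewrite ler_expR lerBlDr lerDl.
  by rewrite divr_ge0 ?mulr_ge0 // ltW ?pow2_gt0.
elim: n => [|n IH].
  rewrite /nlogd /pol_iter /= derivX hornerC hornerX expr0 mul1r divr1 mul1r subrr expR0.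
  by rewrite mulfV ?esc_neq0 // cmod1.
have w0 : (fn n).[z] != 0 by apply: esc_neq0; exact: esc_ge.
rewrite nlogdS // mulrA cmodM.
have [H _] := esc_ratio n Rz; set r := _ / _ in H *.
have r1 : cmod r <= expR (A / 2 ^+ n).
  apply: le_trans (expR_ge1Dx _).
  have -> : r = 1 + (r - 1) by ring.
  by apply: le_trans (cmodD _ _) _; rewrite cmod1 lerD2l.
have -> : 2 * A - 2 * A / 2 ^+ n.+1 = (2 * A - 2 * A / 2 ^+ n) + A / 2 ^+ n.
  by rewrite exprS; field; rewrite gt_eqF ?pow2_gt0.
by rewrite expRD; apply: ler_pM; rewrite ?cmod_ge0.
Qed.

Lemma Q_step z n : R0 <= cmod z ->
  cmod (z * nlogd n.+1 z - z * nlogd n z) <= B * A / 2 ^+ n.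
Proof.
move=> Rz; have w0 : (fn n).[z] != 0 by apply: esc_neq0; exact: esc_ge.
rewrite nlogdS //; have [H _] := esc_ratio n Rz; set r := _ / _ in H *.
have -> : z * (nlogd n z * r) - z * nlogd n z = z * nlogd n z * (r - 1) by ring.
by rewrite cmodM -mulrA; apply: ler_pM; rewrite ?cmod_ge0 ?Q_bound.
Qed.

Lemma Q_cauchy z n k : R0 <= cmod z ->
  cmod (z * nlogd (n + k)%N z - z * nlogd n z) <= 2 * (B * A) / 2 ^+ n.
Proof.
move=> Rz; have BA : 0 <= B * A by apply: mulr_ge0 => //; exact: ltW B_gt0.
suff H : cmod (z * nlogd (n + k)%N z - z * nlogd n z) <=
    2 * (B * A) / 2 ^+ n - 2 * (B * A) / 2 ^+ (n + k).
  apply: le_trans H _; rewrite lerBlDr lerDl.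
  by apply: divr_ge0; [exact: mulr_ge0|exact: ltW (pow2_gt0 _)].
elim: k => [|k IH]; first by rewrite addn0 !subrr cmod0.
rewrite addnS -(subrK (z * nlogd (n + k)%N z) (z * nlogd (n + k).+1 z)) -addrA.
apply: le_trans (cmodD _ _) _; have S := Q_step (n + k) Rz.
have -> : 2 * (B * A) / 2 ^+ (n + k).+1 = 2 * (B * A) / 2 ^+ (n + k) - B * A / 2 ^+ (n + k).
  by rewrite exprS; field; rewrite gt_eqF ?pow2_gt0.
lra.
Qed.

Definition logd z : C := xget 0 [set l | clim (fun n => nlogd n z) l].

Lemma logd_unique z l : clim (fun n => nlogd n z) l -> logd z = l.
Proof.
move=> H; apply/esym; apply: (clim_unique H).
by apply: (@xgetPex _ 0 [set l | clim (fun n => nlogd n z) l]); exists l.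
Qed.

Lemma logd_cvg z : R0 <= cmod z -> clim (fun n => nlogd n z) (logd z).
Proof.
move=> Rz; have z0 := esc_neq0 Rz.
have BA : 0 <= 2 * (B * A) by rewrite !mulr_ge0 // ltW // B_gt0.
have [l Hl] : exists l, clim (fun n => z * nlogd n z) l.
  apply: clim_cauchy => e e0; have [N HN] := exp2_small e0 BA.
  by exists N => n k Nn; apply: le_trans (Q_cauchy n k Rz) _; apply: ltW; exact: HN.
have H : clim (fun n => nlogd n z) (z^-1 * l).
  have -> : (fun n => nlogd n z) = (fun n => z^-1 * (z * nlogd n z)).
    by apply/funext => n; rewrite mulKf.
  exact: climZ.
by rewrite (logd_unique H).
Qed.

Lemma logd_rate z n : R0 <= cmod z ->
  cmod (z * nlogd n z - z * logd z) <= 2 * (B * A) / 2 ^+ n.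
Proof.
move=> Rz; rewrite cmodC; apply: clim_le (climZ z (logd_cvg Rz)) _.
exists n => m nm; rewrite -(subnKC nm); exact: Q_cauchy.
Qed.

Lemma logd_bound z : R0 <= cmod z -> cmod (z * logd z) <= B.
Proof.
move=> Rz; rewrite -[_ * _]subr0; apply: clim_le (climZ z (logd_cvg Rz)) _.
by exists 0%N => n _; rewrite subr0 Q_bound.
Qed.

Lemma sqr_diff_le (x y : C) (M e : R) : cmod x <= M -> cmod y <= M -> cmod (x - y) <= e ->
  cmod (x ^+ 2 - y ^+ 2) <= 2 * M * e.
Proof.
move=> xM yM xy; have -> : x ^+ 2 - y ^+ 2 = (x + y) * (x - y) by ring.
rewrite cmodM; apply: ler_pM; rewrite ?cmod_ge0 //.
apply: le_trans (cmodD _ _) _; lra.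
Qed.

(** With [Q n = z * nlogd n z], the defect [e n = z^2 d^(-2n) S_{f^n} + Q n ^ 2 / 2] obeys
    [e (n+1) = e n / d^2 + O(2^-n)]: the leading part [- (d^2 - 1) / 2] of [w^2 S_f] cancels against
    the change of coefficient of [Q n ^ 2]. As [1 / d^2 <= 1 / 4], the rate [2^-n] persists. *)
Lemma schw_rate : exists2 M : R, 0 <= M & forall z n, R0 <= cmod z ->
  cmod (pschw (fn n) z / d%:R ^+ (2 * n) + logd z ^+ 2 / 2) * cmod z ^+ 2 <= M / 2 ^+ n.
Proof.
have B0 := B_gt0.
pose K1 := B ^+ 2 * A + B ^+ 2 * A.
have K10 : 0 <= K1 by rewrite addr_ge0 // mulr_ge0 // sqr_ge0.
(* [M1 / 4 + K1 <= M1 / 2] closes the recursion; the summand [1] covers [e 0 = 1 / 2]. *)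
pose M1 := 4 * K1 + 1.
exists (M1 + 2 * B ^+ 2 * A); first by rewrite /M1 !addr_ge0 // !mulr_ge0 // ltW.
move=> z n Rz; have z0 := esc_neq0 Rz.
pose Q n := z * nlogd n z.
pose e n := z ^+ 2 * pschw (fn n) z / d%:R ^+ (2 * n) + Q n ^+ 2 / 2.
have eS m : e m.+1 = e m / d%:R ^+ 2 + (Q m.+1 ^+ 2 - Q m ^+ 2) / 2 +
    Q m ^+ 2 / d%:R ^+ 2 * ((fn m).[z] ^+ 2 * pschw f (fn m).[z] + (d%:R ^+ 2 - 1) / 2).
  rewrite /e pol_iterS pschw_comp; last by rewrite -pol_iterS; exact: esc_deriv_neq0.
  have w0 : (fn m).[z] != 0 by apply: esc_neq0; exact: esc_ge.
  have dm := dn_neq0 m.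
  have d0 : d%:R != 0 :> C := dC_neq0 R d_ge2.
  have -> : (fn m)^`().[z] = Q m / z * (d%:R ^+ m * (fn m).[z]).
    by rewrite /Q /nlogd; field; rewrite z0 dm w0.
  have E : d%:R ^+ (2 * m.+1) = d%:R ^+ 2 * (d%:R ^+ m) ^+ 2 :> C.
    by rewrite mulnS exprD mulnC exprM.
  have E2 : d%:R ^+ (2 * m) = (d%:R ^+ m) ^+ 2 :> C by rewrite mulnC exprM.
  rewrite E E2; set x := d%:R ^+ m in dm *; set S := pschw f _; set T := pschw (fn m) z.
  by field; rewrite dm d0 z0.
have He m : cmod (e m) <= M1 / 2 ^+ m.
  elim: m => [|m IH].
    rewrite /e /Q /nlogd /pol_iter /=.
    have -> : pschw 'X z = 0.
      by rewrite /pschw derivX -polyC1 !derivC horner0 !mul0r expr0n /= mulr0 subrr.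
    rewrite mulr0 mul0r add0r derivX hornerC hornerX expr0 mul1r mul1r mulfV // expr1n mul1r divr1.
    by rewrite cmodV cmod_nat /M1; lra.
  rewrite eS; apply: le_trans (cmodD _ _) _; apply: le_trans (lerD (cmodD _ _) (lexx _)) _.
  have cd2 : cmod (d%:R ^+ 2 : C)^-1 = (d%:R ^+ 2)^-1 by rewrite cmodV cmodX cmod_nat.
  rewrite cmod_half [cmod (e m / _)]cmodM cd2 [cmod (_ / d%:R ^+ 2 * _)]cmodM.
  rewrite [cmod (Q m ^+ 2 / _)]cmodM cd2 [cmod (Q m ^+ 2)]cmodX.
  have d2 : 2 <= d%:R :> R by rewrite ler_nat.
  have d4 : (d%:R ^+ 2)^-1 <= 4^-1 :> R.
    rewrite lef_pV2 ?posrE ?exprn_gt0 ?ltr0n ?(leq_trans _ d_ge2) //.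
    by rewrite -[4%:R]/((2 * 2)%N%:R) natrM expr2 ler_pM.
  have dv0 : 0 <= (d%:R ^+ 2)^-1 :> R by rewrite invr_ge0 sqr_ge0.
  have T1 : cmod (e m) / d%:R ^+ 2 <= M1 / 2 ^+ m * 4^-1 by apply: ler_pM; rewrite ?cmod_ge0.
  have T2 := sqr_diff_le (Q_bound m.+1 Rz) (Q_bound m Rz) (Q_step m Rz).
  have [_ T3] := esc_ratio m Rz.
  set X := cmod (_ + _) in T3 *; have X0 : 0 <= X by exact: cmod_ge0.
  have T4 : cmod (Q m) ^+ 2 / d%:R ^+ 2 * X <= B ^+ 2 * (A / 2 ^+ m).
    apply: ler_pM => //; first by rewrite mulr_ge0 ?sqr_ge0.
    rewrite -[leRHS]mulr1; apply: ler_pM; rewrite ?sqr_ge0 //.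
      by rewrite lerXn2r ?nnegrE ?cmod_ge0 ?Q_bound // ltW.
    by apply: le_trans d4 _; lra.
  have -> : M1 / 2 ^+ m.+1 = M1 / 2 ^+ m * 4^-1 + K1 / 2 ^+ m + 4^-1 / 2 ^+ m.
    by rewrite /M1 exprS; field; rewrite gt_eqF ?pow2_gt0.
  have p2 : 0 <= 4^-1 / 2 ^+ m :> R by rewrite divr_ge0 ?invr_ge0 // ltW // pow2_gt0.
  have -> : K1 / 2 ^+ m = 2 * B * (B * A / 2 ^+ m) * 2^-1 + B ^+ 2 * (A / 2 ^+ m).
    by rewrite /K1; field; rewrite gt_eqF ?pow2_gt0.
  move: T1 T2 T4 p2; rewrite -/(Q m.+1) -/(Q m); lra.
rewrite -cmodX -cmodM.
have -> : (pschw (fn n) z / d%:R ^+ (2 * n) + logd z ^+ 2 / 2) * z ^+ 2 =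
   e n - (Q n ^+ 2 - (z * logd z) ^+ 2) / 2.
  by rewrite /e; field; exact: dn_neq0.
apply: le_trans (cmodD _ _) _; rewrite cmodN cmod_half.
have T := sqr_diff_le (Q_bound n Rz) (logd_bound Rz) (logd_rate n Rz).
have -> : (M1 + 2 * B ^+ 2 * A) / 2 ^+ n = M1 / 2 ^+ n + 2 * B * (2 * (B * A) / 2 ^+ n) / 2.
  by field; rewrite gt_eqF ?pow2_gt0.
apply: lerD; first exact: He.
by rewrite ler_wpM2r ?invr_ge0 // /Q.
Qed.

End Escape.

(** * The Green function on the basin of infinity *)

Section Green.
Variable R : realType.
Local Notation C := R[i].
Local Notation Co := (R[i]^o).
Implicit Types (z w c : C) (n m k : nat) (f : {poly R[i]}).

(** Only an upper bound, that is [limsup e <= 0]: this form passes to smaller sequences without sign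
    conditions. *)
Definition vanishing (e : nat -> R) := forall x : R, 0 < x -> exists N, forall n, (N <= n)%N -> e n <= x.

Lemma vanishing_exp2 (x : R) : 0 <= x -> vanishing (fun n => x / 2 ^+ n).
Proof.
move=> x0 y y0; have [N HN] := exp2_small y0 x0.
by exists N => n /HN /ltW.
Qed.

Lemma vanishing_shift m (e : nat -> R) : vanishing (fun n => e (n + m)%N) -> vanishing e.
Proof.
move=> H x /H [N HN]; exists (N + m)%N => n Nn.
have mn : (m <= n)%N by apply: leq_trans Nn; exact: leq_addl.
by rewrite -(subnK mn); apply: HN; rewrite leq_subRL // addnC.
Qed.

Lemma vanishing_sqrt (e : nat -> R) : vanishing e -> vanishing (fun n => Num.sqrt (e n)).
Proof.
move=> H x x0; have [N HN] := H (x ^+ 2) (exprn_gt0 _ x0).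
exists N => n /HN ex; rewrite -(ger0_norm (ltW x0)) -sqrtr_sqr.
exact: ler_wsqrtr.
Qed.

Lemma vanishingD (e1 e2 : nat -> R) : vanishing e1 -> vanishing e2 ->
  vanishing (fun n => e1 n + e2 n).
Proof.
move=> H1 H2 x x0; have x2 : 0 < x / 2 by rewrite divr_gt0.
have [N HN] := H1 _ x2; have [M HM] := H2 _ x2.
exists (maxn N M) => n; rewrite geq_max => /andP[/HN ? /HM ?]; lra.
Qed.

Lemma vanishingZ (x : R) (e : nat -> R) : 0 <= x -> vanishing e -> vanishing (fun n => x * e n).
Proof.
move=> x0 H y y0; have x1 : 0 < x + 1 by lra.
have [N HN] := H _ (divr_gt0 y0 x1); exists N => n /HN h.
apply: le_trans (ler_wpM2l x0 h) _.
by rewrite mulrCA ler_piMr ?(ltW y0) // ler_pdivrMr // mul1r lerDl.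
Qed.

Lemma vanishing_le (e1 e2 : nat -> R) : (forall n, e1 n <= e2 n) -> vanishing e2 -> vanishing e1.
Proof.
by move=> H H2 x /H2 [N HN]; exists N => n /HN; exact: le_trans.
Qed.

Lemma clim_unshift m (u : nat -> C) l : clim (fun n => u (n + m)%N) l -> clim u l.
Proof. by move=> H; apply: (@vanishing_shift m (fun n => cmod (u n - l))). Qed.

Lemma clim_real_cvg (v : nat -> R) l : clim (fun n => (v n)%:C%C) l -> v @ \oo --> complex.Re l.
Proof.
move=> H; apply/cvgrPdist_le => e /H [N HN]; exists N => // n /= /HN.
apply: le_trans; have := Re_le_cmod ((v n)%:C%C - l); rewrite distrC ReB //.
Qed.

Lemma real_lim_le (u : nat -> R) (l a b : R) : u @ \oo --> l ->
  (exists N, forall n, (N <= n)%N -> `|u n - a| <= b) -> `|l - a| <= b.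
Proof.
move=> /cvgrPdist_le H [N HN]; apply/ler_addgt0Pr => e /H [M _ HM].
have H1 := HN _ (leq_maxl N M); have H2 := HM _ (leq_maxr N M).
have -> : l - a = (l - u (maxn N M)) + (u (maxn N M) - a) by ring.
apply: le_trans (ler_normD _ _) _; rewrite addrC; exact: lerD.
Qed.

Lemma pol_iter_comp f n m : pol_iter f (n + m) = pol_iter f n \Po pol_iter f m.
Proof.
elim: n => [|n IH]; first by rewrite add0n comp_polyX.
by rewrite addSn !pol_iterS IH comp_polyA.
Qed.

(** If the differential is [t |-> Re (k t)], the partial derivatives are [Re k] and [- Im k]. *)
Lemma rdiff_d_dz (G : C -> R) z (k : C) : rdiff G z k -> d_dz (G : Co -> R) z = k / 2.
Proof.
move=> H; rewrite /d_dz.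
have zE : z = (complex.Re z +i* complex.Im z)%C by case: (z).
set x := complex.Re z in zE *; set y := complex.Im z in zE *.
have E1 (s : R) : (s +i* y)%C = (0 +i* y)%C + s%:C%C * 1 :> C by apply/eqP; rewrite eq_complex /=; apply/andP; split; apply/eqP; ring.
have E2 (s : R) : (x +i* s)%C = x%:C%C + s%:C%C * 'i%C :> C by apply/eqP; rewrite eq_complex /=; apply/andP; split; apply/eqP; ring.
have D1 : derive1 (fun s : R => G (s +i* y)%C) x = complex.Re k.
  have -> : (fun s : R => G (s +i* y)%C) = (fun s : R => G ((0 +i* y)%C + s%:C%C * 1)).
    by apply/funext => s; rewrite E1.
  have := @rdiff_path _ G (0 +i* y)%C 1 x k.
  by rewrite -E1 -zE mulr1 => /(_ H) D; rewrite derive1E derive_val.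
have D2 : derive1 (fun s : R => G (x +i* s)%C) y = - complex.Im k.
  have -> : (fun s : R => G (x +i* s)%C) = (fun s : R => G (x%:C%C + s%:C%C * 'i%C)).
    by apply/funext => s; rewrite E2.
  have := @rdiff_path _ G x%:C%C 'i%C y k.
  by rewrite -E2 -zE => /(_ H) D; rewrite derive1E derive_val ReiNIm.
rewrite D1 D2 opprK.
have -> : (complex.Re k +i* complex.Im k)%C = k by case: (k).
by rewrite mulrC.
Qed.

Variables (d : nat) (f : {poly R[i]}) (A K R0 : R).
Hypotheses (d_ge2 : (2 <= d)%N) (deg_f : size f = d.+1).
Hypotheses (A0 : 0 <= A) (K0 : 0 <= K) (R01 : 1 <= R0).
Hypothesis esc : forall w, R0 <= cmod w ->
   [/\ 2 * cmod w <= cmod f.[w], f^`().[w] != 0,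
       cmod (w * f^`().[w] / (d%:R * f.[w]) - 1) <= A / cmod w,
       cmod (w ^+ 2 * pschw f w + (d%:R ^+ 2 - 1) / 2) <= A / cmod w
     & `|ln (cmod f.[w]) - d%:R * ln (cmod w)| <= K].

Local Notation fn := (pol_iter f).
Local Notation nlogd := (nlogd d f).
Local Notation logd := (logd d f).

Let d0 : 0 < d%:R :> R. Proof. exact: dR_gt0. Qed.

Let d1 : 1 <= d%:R :> R. Proof. by rewrite ler1n (leq_trans _ d_ge2). Qed.

(** The approximants of [green] without the truncation in [log_plus], hence differentiable; they
    agree with the truncated ones once [|f^n z| >= 1]. *)
Definition gn n z : R := ln (cmod (fn n).[z]) / d%:R ^+ n.

Lemma green_term n z : 1 <= cmod (fn n).[z] ->
  d%:R ^- n * log_plus (cabs (iter n (horner f) z)) = gn n z.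
Proof.
move=> H; rewrite /gn mulrC; congr (_ / _).
by rewrite -[cabs _]/(cmod (iter n (horner f) z)) pol_iterE /log_plus max_r // ln_ge0.
Qed.

Lemma gn_cauchy z : R0 <= cmod z -> exists l, clim (fun n => (gn n z)%:C%C) l.
Proof.
move=> Rz.
have S n : `|gn n.+1 z - gn n z| <= K / 2 ^+ n.+1.
  have [_ _ _ _ H] := esc (esc_ge R01 esc n Rz).
  rewrite /gn pol_iterS horner_comp; set x := ln _ in H *; set y := ln _ in H *.
  have -> : x / d%:R ^+ n.+1 - y / d%:R ^+ n = (x - d%:R * y) / d%:R ^+ n.+1.
    by rewrite exprS; field; rewrite ?expf_neq0 ?andbT; exact: lt0r_neq0 d0.
  rewrite normrM; apply: ler_pM; rewrite ?normr_ge0 //.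
  have p0 : 0 <= (d%:R ^+ n.+1)^-1 :> R by rewrite invr_ge0 exprn_ge0 // ltW.
  rewrite (ger0_norm p0) lef_pV2 ?posrE ?exprn_gt0 //.
  by rewrite lerXn2r ?nnegrE ?ler0n // ler_nat.
have H n k : `|gn (n + k) z - gn n z| <= K / 2 ^+ n - K / 2 ^+ (n + k).
  elim: k => [|k IH]; first by rewrite addn0 !subrr normr0.
  rewrite addnS; have -> : gn (n + k).+1 z - gn n z =
    (gn (n + k).+1 z - gn (n + k) z) + (gn (n + k) z - gn n z) by ring.
  apply: le_trans (ler_normD _ _) _; have := S (n + k)%N.
  have E : K / 2 ^+ (n + k) = K / 2 ^+ (n + k).+1 + K / 2 ^+ (n + k).+1.
    by rewrite exprS; field; rewrite gt_eqF // exprn_gt0.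
  rewrite E in IH; lra.
apply: clim_cauchy => e e0; have [N HN] := exp2_small e0 K0.
exists N => n k Nn; rewrite -rmorphB /= cmod_real.
apply: le_trans (H n k) _; apply: le_trans (ltW (HN n Nn)).
by rewrite lerBlDr lerDl divr_ge0 // exprn_ge0.
Qed.

Lemma gn_shift m n z : gn (n + m) z = gn n (fn m).[z] / d%:R ^+ m.
Proof.
by rewrite /gn pol_iter_add exprD invfM mulrA.
Qed.

Lemma gn_cvg m z : R0 <= cmod (fn m).[z] ->
  (fun n => gn (n + m) z) @ \oo --> green f z.
Proof.
move=> Rz; have [l Hl] := gn_cauchy Rz.
have H : (fun n => gn (n + m) z) @ \oo --> complex.Re ((d%:R ^- m : R)%:C%C * l).
  apply: clim_real_cvg.
  have -> : (fun n => (gn (n + m) z)%:C%C) = (fun n => (d%:R ^- m : R)%:C%C * (gn n (fn m).[z])%:C%C).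
    by apply/funext => n; rewrite gn_shift mulrC rmorphM.
  exact: climZ.
suff <- : complex.Re ((d%:R ^- m : R)%:C%C * l) = green f z by [].
apply/esym; rewrite /green deg_f /=; apply: cvg_lim => //.
rewrite -(cvg_shiftn m).
have E : (fun n => gn (n + m) z) =
    (fun n => d%:R ^- (n + m) * log_plus (cabs (iter (n + m) (horner f) z))).
  apply/funext => n; rewrite green_term // pol_iter_add.
  by apply: le_trans (esc_ge R01 esc n Rz).
by rewrite E in H.
Qed.

Lemma nlogd_shift m n z : R0 <= cmod (fn m).[z] ->
  nlogd (n + m) z = (fn m)^`().[z] / d%:R ^+ m * nlogd n (fn m).[z].
Proof.
move=> Rz; rewrite /nlogd pol_iter_comp deriv_comp hornerM !horner_comp exprD.
have w0 := esc_neq0 R01 (esc_ge R01 esc n Rz).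
by field; rewrite w0 !dn_neq0.
Qed.

Lemma logd_shift m z : R0 <= cmod (fn m).[z] ->
  logd z = (fn m)^`().[z] / d%:R ^+ m * logd (fn m).[z].
Proof.
move=> Rz; apply: logd_unique; apply: (@clim_unshift m).
under eq_fun do rewrite nlogd_shift //.
by apply: climZ; exact: (logd_cvg d_ge2 A0 R01 esc Rz).
Qed.

Lemma cts_horner_near m z0 (r : R) : r < cmod (fn m).[z0] ->
  \forall z \near cnbhs z0, r < cmod (fn m).[z].
Proof.
move=> Hr; have e0 : 0 < cmod (fn m).[z0] - r by rewrite subr_gt0.
apply: filterS (@cts_horner _ (fn m) z0 _ e0) => z; rewrite cmodC.
have := cmodB_le (fn m).[z0] (fn m).[z]; lra.
Qed.

Lemma green_basin m z0 : R0 < cmod (fn m).[z0] -> exists r M : R, [/\ 0 < r, 0 <= M &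
  forall z, disc z0 r z -> [/\ R0 < cmod (fn m).[z], cderivable logd z, cmod (logd z) <= M,
    cmod (fn m)^`().[z] <= M & d_dz (green f : Co -> R) z = logd z / 2]].
Proof.
move=> Rz0.
have [M M0 HM] := cts_bounded (@cts_horner _ (fn m)^`() z0).
have [r r0 Hr] : \forall z \near cnbhs z0, R0 < cmod (fn m).[z] /\ cmod (fn m)^`().[z] < M.
  by apply: filterS2 (cts_horner_near Rz0) HM.
have dm1 : 1 <= d%:R ^+ m :> R by rewrite exprn_ege1.
pose Bq := expR (2 * A).
have Bq0 : 0 < Bq by exact: expR_gt0.
have dm_le (x : R) : 0 <= x -> x / d%:R ^+ m <= x.
  by move=> x0; rewrite ler_pdivrMr ?(lt_le_trans ltr01) // ler_peMr.
have coef_le z : disc z0 r z -> cmod ((fn m)^`().[z] / d%:R ^+ m) <= M.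
  move=> Dz; have [_ H] := Hr z Dz; rewrite cmodM cmodV cmodX cmod_nat.
  by apply: le_trans (dm_le _ (cmod_ge0 _)) _; exact: ltW.
have big z : disc z0 r z -> R0 <= cmod (fn m).[z] by move=> /Hr [/ltW].
have w1 z : disc z0 r z -> 1 <= cmod (fn m).[z].
  by move=> /big; apply: le_trans.
have rate n z : disc z0 r z -> cmod (nlogd (n + m) z - logd z) <= M * (2 * (Bq * A)) / 2 ^+ n.
  move=> Dz; have Rz := big z Dz; have wz := w1 z Dz.
  rewrite nlogd_shift // (logd_shift Rz) -mulrBr cmodM -mulrA.
  apply: ler_pM; rewrite ?cmod_ge0 ?coef_le //.
  have := logd_rate d_ge2 A0 R01 esc n Rz; rewrite -mulrBr cmodM.
  by apply: le_trans; rewrite ler_peMl ?cmod_ge0.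
have BA : 0 <= M * (2 * (Bq * A)) by rewrite !mulr_ge0 // ltW.
have lb z : disc z0 r z -> cmod (logd z) <= M * Bq.
  move=> Dz; have Rz := big z Dz; have wz := w1 z Dz.
  rewrite (logd_shift Rz) cmodM; apply: ler_pM; rewrite ?cmod_ge0 ?coef_le //.
  have := logd_bound d_ge2 A0 R01 esc Rz; rewrite cmodM.
  by apply: le_trans; rewrite ler_peMl ?cmod_ge0.
have hl : holo_on (disc z0 r) logd.
  apply: (@holo_ulim _ z0 r (fun n z => nlogd (n + m) z)) => [n z Dz|e e0].
    have w0 : (fn (n + m)).[z] != 0.
      by rewrite pol_iter_add; apply: (esc_neq0 R01); apply: (esc_ge R01 esc); exact: big.
    have dw : d%:R ^+ (n + m) * (fn (n + m)).[z] != 0 by rewrite mulf_neq0 // dn_neq0.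
    have := cderM (cder_horner (fn (n + m))^`() z)
      (@cderV _ (fun w => d%:R ^+ (n + m) * (fn (n + m)).[w]) z _ dw (cderZ (d%:R ^+ (n + m)) (cder_horner (fn (n + m)) z))).
    by move=> H; eexists; exact: H.
  have [N HN] := vanishing_exp2 BA e0; exists N => n Nn z Dz.
  by apply: le_trans (rate n z Dz) _; exact: HN.
have D0 := disc_center z0 r0.
pose La := pint logd z0.
have dLa z : disc z0 r z -> cder La z (logd z) by exact: primitive.
have key z : disc z0 r z -> green f z = green f z0 - complex.Re (La z0) + complex.Re (La z).
  move=> Dz; apply/eqP; rewrite -subr_eq0 -normr_eq0 eq_le normr_ge0 andbT.
  apply/ler_addgt0Pr => e e0; rewrite add0r.
  pose a := complex.Re (La z) - complex.Re (La z0).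
  have H : `|green f z - green f z0 - a| <= e.
    apply: (@real_lim_le (fun n => gn (n + m) z - gn (n + m) z0)).
      by apply: cvgB; apply: gn_cvg; exact: big.
    have BAr : 0 <= M * (2 * (Bq * A)) * r by rewrite mulr_ge0 // ltW.
    have [N HN] := vanishing_exp2 BAr e0; exists N => n Nn.
    have [|c sc E] := @rdiff_mvt _ (fun z => gn (n + m) z - complex.Re (La z)) z0 z
      (fun z => nlogd (n + m) z - logd z).
      move=> c sc; have Dc : disc z0 r c := segment_disc D0 Dz sc.
      apply: rdiffB; last by apply: rdiff_Re; exact: dLa.
      have w0 : (fn (n + m)).[c] != 0.
        by rewrite pol_iter_add; apply: (esc_neq0 R01); apply: (esc_ge R01 esc); exact: big.
      have := rdiffZ (d%:R ^- (n + m)) (rdiff_ln_cmod w0 (cder_horner (fn (n + m)) c)).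
      have -> : ((d%:R ^- (n + m))%:C)%C * ((fn (n + m))^`().[c] / (fn (n + m)).[c]) = nlogd (n + m) c.
        rewrite fmorphV rmorphXn rmorph_nat /nlogd /=; field.
        by rewrite w0 dn_neq0.
      by apply: rdiff_near; exists 1 => // v _; rewrite /gn mulrC.
    have -> : gn (n + m) z - gn (n + m) z0 - a =
      gn (n + m) z - complex.Re (La z) - (gn (n + m) z0 - complex.Re (La z0)).
      by rewrite /a; ring.
    rewrite E; apply: le_trans (Re_le_cmod _) _; rewrite cmodM.
    apply: le_trans (HN n Nn); rewrite [leRHS]mulrAC.
    apply: ler_pM; rewrite ?cmod_ge0 //; last exact: ltW.
    by apply: rate; exact: segment_disc D0 Dz _ sc.
  have -> : green f z - (green f z0 - complex.Re (La z0) + complex.Re (La z)) =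
    green f z - green f z0 - a by rewrite /a; ring.
  exact: H.
exists r, (M * Bq + M); split => //.
  by rewrite addr_ge0 // ?mulr_ge0 // ltW.
move=> z Dz; have [H1 H2] := Hr z Dz; have MB : 0 <= M * Bq by rewrite mulr_ge0 // ltW.
split => //.
- exact: hl.
- by apply: le_trans (lb z Dz) _; rewrite lerDl ltW.
- by apply: le_trans (ltW H2) _; rewrite lerDr.
apply: rdiff_d_dz.
have := rdiffB (rdiff_Re (dLa z Dz)) (rdiff_cst (complex.Re (La z0) - green f z0) z).
rewrite subr0; apply: rdiff_near.
apply: filterS (disc_near Dz) => w Dw; rewrite [RHS]key //; ring.
Qed.

(** The chain rule for [f^n = f^(n-m) \o f^m]: the outer Schwarzian is evaluated where [schw_rate]
    applies, and the inner one is fixed, so that after division by [d^(2n)] it tends to [0] with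
    poles in a list [s] independent of [n]. *)
Lemma schw_basin m z0 : R0 < cmod (fn m).[z0] -> exists r, exists s : seq C, exists e : nat -> R,
  [/\ 0 < r, vanishing e, forall n, 0 <= e n &
  forall n z, (m <= n)%N -> disc z0 r z ->
    Num.sqrt (cmod (pschw (fn n) z / d%:R ^+ (2 * n) + logd z ^+ 2 / 2)) <=
      e n + e n * inv_dist_sum s z].
Proof.
move=> Rz0; have [r [M [r0 M0 H]]] := green_basin Rz0.
have [s Es] := poly_factor (fn m)^`().
have [M1 M10 HM1] := schw_rate d_ge2 A0 R01 esc.
pose e1 n := Num.sqrt (M ^+ 2 * (M1 / 2 ^+ n)).
pose e n := e1 (n - m)%N + 2 / 2 ^+ n.
have e10 n : 0 <= e1 n by exact: sqrtr_ge0.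
have e20 n : 0 <= 2 / 2 ^+ n :> R by rewrite divr_ge0 // exprn_ge0.
exists r, s, e; split => //.
- apply: vanishingD; last by apply: vanishing_exp2.
  apply: (@vanishing_shift m); under eq_fun do rewrite addnK.
  apply: vanishing_sqrt; apply: vanishingZ; first exact: sqr_ge0.
  exact: vanishing_exp2.
- by move=> n; rewrite addr_ge0.
move=> n z mn Dz; have [/ltW Rz _ _ cM _] := H z Dz.
have i0 := inv_dist_sum_ge0 s z.
(* At a critical point of [f^m] both terms are [0]: [logd z] contains the factor [(f^m)' z], and the
   Schwarzian takes its default value. *)
have [fz|fz] := eqVneq (fn m)^`().[z] 0.
  rewrite (logd_shift Rz) fz mul0r mul0r expr0n /= mul0r addr0.
  rewrite pschw_crit ?mul0r ?cmod0 ?sqrtr0 ?addr_ge0 ?mulr_ge0 ?addr_ge0 //.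
  by rewrite -(subnK mn) pol_iter_comp deriv_comp hornerM fz mulr0.
set w := (fn m).[z] in Rz *; pose k := (n - m)%N.
have nk : n = (k + m)%N by rewrite /k subnK.
have E : pschw (fn n) z / d%:R ^+ (2 * n) + logd z ^+ 2 / 2 =
   ((fn m)^`().[z] / d%:R ^+ m) ^+ 2 * (pschw (fn k) w / d%:R ^+ (2 * k) + logd w ^+ 2 / 2) +
   pschw (fn m) z / d%:R ^+ (2 * n).
  rewrite (logd_shift Rz) -/w nk pol_iter_comp pschw_comp; last first.
    rewrite deriv_comp hornerM horner_comp mulf_neq0 //.
    exact: (esc_deriv_neq0 R01 esc k Rz).
  rewrite -/w mulnDr exprD !(mulnC 2) !exprM.
  by field; rewrite !dn_neq0.
rewrite E; apply: le_trans (ler_wsqrtr (cmodD _ _)) _.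
apply: le_trans (sqrtrD_le (cmod_ge0 _) (cmod_ge0 _)) _.
have dm1 : 1 <= d%:R ^+ m :> R by rewrite exprn_ege1.
have T1 : Num.sqrt (cmod (((fn m)^`().[z] / d%:R ^+ m) ^+ 2 *
    (pschw (fn k) w / d%:R ^+ (2 * k) + logd w ^+ 2 / 2))) <= e1 k.
  apply: ler_wsqrtr; rewrite cmodM cmodX; apply: ler_pM; rewrite ?sqr_ge0 ?cmod_ge0 //.
    rewrite lerXn2r ?nnegrE ?cmod_ge0 // cmodM cmodV cmodX cmod_nat.
    apply: le_trans cM; rewrite ler_pdivrMr ?(lt_le_trans ltr01) // ler_peMr ?cmod_ge0 //.
  apply: le_trans (HM1 w k Rz); rewrite ler_peMr ?cmod_ge0 // exprn_ege1 //.
  exact: le_trans R01 Rz.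
have T2 : Num.sqrt (cmod (pschw (fn m) z / d%:R ^+ (2 * n))) <= 2 / 2 ^+ n * inv_dist_sum s z.
  rewrite cmodM cmodV cmodX cmod_nat sqrtrM ?cmod_ge0 // mulrC.
  have -> : Num.sqrt (d%:R ^+ (2 * n))^-1 = (d%:R ^+ n)^-1 :> R.
    by rewrite mulnC exprM -exprVn sqrtr_sqr ger0_norm // invr_ge0 exprn_ge0 // ler0n.
  have -> : 2 / 2 ^+ n * inv_dist_sum s z = (2 ^+ n)^-1 * (2 * inv_dist_sum s z) by ring.
  apply: ler_pM; rewrite ?sqrtr_ge0 ?invr_ge0 ?exprn_ge0 ?ler0n //; last exact: sqrt_pschw_le.
  by rewrite lef_pV2 ?posrE ?exprn_gt0 // lerXn2r ?nnegrE ?ler0n // ler_nat.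
rewrite /e -/k.
have p1 : 0 <= e1 k * inv_dist_sum s z by rewrite mulr_ge0.
have := e20 n; rewrite mulrDl; lra.
Qed.

End Green.

(** * Bounded orbits *)

Section Growth.
Variable R : realType.
Local Notation C := R[i].
Implicit Types (z w c a b : C) (n m k : nat) (f g : {poly R[i]}).

Lemma vanishing_rec (th : R) (x y : nat -> R) : 0 <= th -> th < 1 ->
  (forall k, x k.+1 <= th * x k + y k) -> vanishing y -> vanishing x.
Proof.
move=> t0 t1 H Hy e e0.
have e1 : 0 < e / 2 * (1 - th) by rewrite mulr_gt0 ?divr_gt0 // subr_gt0.
have [N HN] := Hy _ e1.
have B j : x (j + N)%N <= th ^+ j * `|x N| + e / 2.
  elim: j => [|j IH].
    by rewrite add0n expr0 mul1r; have := ler_norm (x N); lra.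
  apply: le_trans (H _) _; have := HN (j + N)%N (leq_addl _ _).
  have := ler_wpM2l t0 IH; rewrite exprS mulrDr mulrA; lra.
have : (fun j : nat => th ^+ j) @ \oo --> (0 : R).
  by apply: cvg_expr; rewrite ger0_norm.
move=> /cvgrPdist_le G.
have x1 : 0 < `|x N| + 1 by have := normr_ge0 (x N); lra.
have e2 : 0 < e / 2 / (`|x N| + 1) by rewrite !divr_gt0.
have [M _ HM] := G _ e2.
exists (M + N)%N => n Nn.
have Nn' : (N <= n)%N by apply: leq_trans Nn; exact: leq_addl.
rewrite -(subnK Nn'); apply: le_trans (B _) _.
have Mn : (M <= n - N)%N by rewrite leq_subRL // addnC.
have := HM _ Mn; rewrite /= sub0r normrN ger0_norm ?exprn_ge0 // => h.
have : th ^+ (n - N) * `|x N| <= e / 2.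
  apply: (@le_trans _ _ (e / 2 / (`|x N| + 1) * (`|x N| + 1))).
    by apply: ler_pM => //; rewrite ?exprn_ge0 // lerDl.
  by rewrite divfK ?gt_eqF.
lra.
Qed.

(** The candidates [2 k j] are at least [2 k] apart, so each [x] spoils at most one of them. *)
Lemma pigeonhole_radius (k : R) (xs : seq R) (js : seq nat) : 0 < k -> uniq js ->
  (size xs < size js)%N ->
  exists2 j, j \in js & forall x, x \in xs -> k <= `|x - 2 * k * j%:R|.
Proof.
move=> k0; elim: xs js => [|x xs IH] js uj sj.
  by case: js uj sj => [//|j js] _ _; exists j; rewrite ?mem_head.
have [/hasP[j0 j0s bad]|/hasPn good] := boolP (has (fun j => `|x - 2 * k * j%:R| < k) js).
  have [||j jj Hj] := IH (rem j0 js); first exact: rem_uniq.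
    by rewrite size_rem // -ltnS prednK // (leq_trans _ sj).
  have [jn js'] : j != j0 /\ j \in js by move: jj; rewrite mem_rem_uniq // inE => /andP[].
  exists j => // y; rewrite inE => /orP[/eqP ->|]; last exact: Hj.
  rewrite leNgt; apply/negP => bad'.
  have : `|2 * k * j%:R - 2 * k * j0%:R| < 2 * k.
    have -> : 2 * k * j%:R - 2 * k * j0%:R = (x - 2 * k * j0%:R) - (x - 2 * k * j%:R) by ring.
    by apply: le_lt_trans (ler_normB _ _) _; lra.
  rewrite -mulrBr normrM gtr0_norm ?mulr_gt0 // gtr_pMr ?mulr_gt0 //.
  apply/negP; rewrite -leNgt.
  have -> : j%:R - j0%:R = ((j%:Z - j0%:Z)%:~R : R) by rewrite rmorphB /= !pmulrn.
  by rewrite -intr_norm ler1z -gtz0_ge1 normr_gt0 subr_eq0 eqz_nat.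
have [||j jj Hj] := IH (behead js); first by case: (js) uj => //= ? ? /andP[].
  by rewrite size_behead -ltnS prednK // (leq_trans _ sj).
exists j; first exact: mem_behead.
move=> y; rewrite inE => /orP[/eqP ->|]; last exact: Hj.
by rewrite leNgt; apply: good; exact: mem_behead.
Qed.

Definition path_cts (y : R -> C) := forall t e : R, 0 < e -> \forall s \near t, cmod (y s - y t) < e.

Lemma path_ivt (y : R -> C) a (t1 r : R) : path_cts y -> 0 <= t1 -> y 0 = a ->
  0 <= r -> r <= cmod (y t1 - a) -> exists2 t, 0 <= t <= t1 & cmod (y t - a) = r.
Proof.
move=> cy t10 y0 r0 rt.
have cu : continuous (fun t => cmod (y t - a)).
  move=> t; apply/cvgrPdist_lt => e e0; near=> s.
  have H : cmod (y s - y t) < e by near: s; exact: cy.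
  rewrite distrC ltr_norml.
  have := cmodB_le (y s - a) (y t - a); have := cmodB_le (y t - a) (y s - a).
  have -> : y t - a - (y s - a) = y t - y s by ring.
  have -> : y s - a - (y t - a) = y s - y t by ring.
  rewrite [cmod (y t - y s)]cmodC => ? ?; apply/andP; split; lra.
have [|t tI E] := @IVT R (fun t => cmod (y t - a)) 0 t1 r t10 (continuous_subspaceT cu).
  by rewrite /= y0 subrr cmod0 ge_min r0 /= le_max rt orbT.
by exists t => //; move: tI; rewrite in_itv.
Unshelve. all: by end_near. Qed.

Lemma path_cts_horner g y : path_cts y -> path_cts (fun t => g.[y t]).
Proof.
move=> cy t e e0; have [r r0 Hr] := @cts_horner _ g (y t) _ e0.
by near=> s; apply: Hr; near: s; exact: cy.
Unshelve. all: by end_near. Qed.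

(* As [g - g(a)] has a root away from [a], at most [D - 1] of its roots are close to
   [a]; on a suitable circle around [a] all of them are at a definite distance. *)
Lemma path_growth g D (de : R) (y : R -> C) (t1 r : R) : size g = D.+1 -> (0 < D)%N ->
  path_cts y -> 0 <= t1 -> 0 < r -> r <= de / 2 -> r <= cmod (y t1 - y 0) ->
  (exists2 b, g.[b] = g.[y 0] & de <= cmod (b - y 0)) ->
  exists2 t, 0 <= t <= t1 &
    cmod (lead_coef g) * (r / (2 * D.+1%:R)) ^+ D.-1 * (de / 2) <= cmod (g.[y t] - g.[y 0]).
Proof.
move=> sg D0 cy t10 r0 rd rt [b gb db].
set a := y 0 in rt gb db *.
pose p := g - g.[a]%:P.
have g0 : g != 0 by rewrite -size_poly_eq0 sg.
have sc : (size (- g.[a]%:P)%R < size g)%N.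
  by rewrite size_polyN sg (leq_ltn_trans (size_polyC_leq1 _)).
have lp : lead_coef p = lead_coef g by rewrite /p lead_coefDl.
have sp : size p = D.+1 by rewrite /p size_polyDl.
have p0 : p != 0 by rewrite -size_poly_eq0 sp.
have [s Es] := poly_factor p.
have ss : size s = D by rewrite (size_factor p0 Es) sp.
have bs : b \in s.
  have : root p b by rewrite rootE /p hornerD hornerN hornerC gb subrr.
  by rewrite Es rootZ ?lead_coef_eq0 // root_prod_XsubC.
(* The [D + 1] candidate radii [2 k j] with [j <= D] do not exceed [r], and there are only [D] roots
   to avoid. *)
pose k := r / (2 * D.+1%:R).
have D1 : 0 < D.+1%:R :> R by rewrite ltr0n.
have k0 : 0 < k by rewrite /k divr_gt0 // mulr_gt0.
have [||j jI Hj] := @pigeonhole_radius k [seq cmod (x - a) | x <- s] (iota 0 D.+1) k0.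
- exact: iota_uniq.
- by rewrite size_map size_iota ss.
have jD : (j <= D)%N by move: jI; rewrite mem_iota add0n ltnS.
pose u := 2 * k * j%:R.
have u0 : 0 <= u by rewrite !mulr_ge0 ?ler0n // ltW.
have ur : u <= r.
  rewrite /u /k; have -> : 2 * (r / (2 * D.+1%:R)) * j%:R = r * (j%:R / D.+1%:R).
    by field; rewrite gt_eqF.
  by rewrite ler_piMr ?(ltW r0) // ler_pdivrMr // mul1r ler_nat leqW.
have [t tI Et] := path_ivt cy t10 erefl u0 (le_trans ur rt).
exists t => //.
have far x : x \in s -> k <= cmod (y t - x).
  move=> xs; have := Hj _ (map_f (fun x => cmod (x - a)) xs); rewrite -/u.
  move=> H; apply: le_trans H _; rewrite -Et ler_norml.
  have := cmodB_le (x - a) (y t - a); have := cmodB_le (y t - a) (x - a).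
  have -> : y t - a - (x - a) = y t - x by ring.
  have -> : x - a - (y t - a) = x - y t by ring.
  rewrite [cmod (x - y t)]cmodC => ? ?; apply/andP; split; lra.
(* The path is still within [r <= de / 2] of [a], so the remote root [b] contributes a factor
   independent of [r]; this is what lowers the exponent from [D] to [D - 1]. *)
have farb : de / 2 <= cmod (y t - b).
  have := cmodB_le (b - a) (y t - a); rewrite Et.
  have -> : b - a - (y t - a) = b - y t by ring.
  rewrite [cmod (b - y t)]cmodC; lra.
have -> : g.[y t] - g.[a] = p.[y t] by rewrite /p hornerD hornerN hornerC.
rewrite Es hornerZ cmodM lp -mulrA ler_wpM2l ?cmod_ge0 //.
rewrite cmod_lin_prod (perm_big _ (perm_to_rem bs)) big_cons mulrC.
have k1 : 0 <= k by exact: ltW.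
apply: ler_pM => //; rewrite ?exprn_ge0 //; first lra.
have <- : size (rem b s) = D.-1 by rewrite size_rem // ss.
have : forall x, x \in rem b s -> k <= cmod (y t - x) by move=> x /mem_rem; exact: far.
elim: (rem b s) => [|x xs IH] Hx; first by rewrite big_nil expr0.
rewrite big_cons /= exprS; apply: ler_pM; rewrite ?exprn_ge0 //; first by apply: Hx; rewrite mem_head.
by apply: IH => v vx; apply: Hx; rewrite inE vx orbT.
Qed.

(** Let [b0] be a second preimage for [a0], and let [a] be near [a0]. If every root of [g - g a]
    were [m / 4] away from [b0], then [|g b0 - g a| >= |lead_coef g| (m / 4)^D], against continuity.
    So some root is near [b0] and far from [a]; compactness makes the distance uniform. *)
Lemma second_preimage_unif g D (rho : R) : size g = D.+1 -> (0 < D)%N ->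
  (forall a, exists2 b, b != a & g.[b] = g.[a]) ->
  exists2 de : R, 0 < de & forall a, cmod a <= rho ->
    exists2 b, g.[b] = g.[a] & de <= cmod (b - a).
Proof.
move=> sg D0 H.
have := @compact_cdisc R rho; rewrite compact_near_coveringP.
move=> /(_ R (0 : R)^'+ (fun de a => exists2 b, g.[b] = g.[a] & de <= cmod (b - a))).
case => [a0 _|].
  have [b0 ba gb] := H a0.
  pose m := cmod (b0 - a0).
  have m0 : 0 < m by rewrite /m cmod_gt0 subr_eq0.
  have m4 : 0 < m / 4 by rewrite divr_gt0.
  have g0 : g != 0 by rewrite -size_poly_eq0 sg.
  have lg : 0 < cmod (lead_coef g) by rewrite cmod_gt0 lead_coef_eq0.
  have e0 : 0 < cmod (lead_coef g) * (m / 4) ^+ D by rewrite mulr_gt0 // exprn_gt0.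
  have [r r0 Hr] := @cts_horner _ g a0 _ e0.
  near=> a de => /=.
  have am : cmod (a - a0) < m / 4.
    by near: a; apply/nbhs_cnbhs; exists (m / 4).
  have ga : cmod (g.[a] - g.[a0]) < cmod (lead_coef g) * (m / 4) ^+ D.
    by near: a; apply/nbhs_cnbhs; exists r.
  have dm : de <= m / 4 by near: de; exact: nbhs_right_le.
  pose p := g - g.[a]%:P.
  have sc : (size (- g.[a]%:P)%R < size g)%N.
    by rewrite size_polyN sg (leq_ltn_trans (size_polyC_leq1 _)).
  have lp : lead_coef p = lead_coef g by rewrite /p lead_coefDl.
  have sp : size p = D.+1 by rewrite /p size_polyDl.
  have p0 : p != 0 by rewrite -size_poly_eq0 sp.
  have [s Es] := poly_factor p.
  have ss : size s = D by rewrite (size_factor p0 Es) sp.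
  have [/hasP[b bs bb]|/hasPn no] := boolP (has (fun x => cmod (b0 - x) < m / 4) s).
    exists b.
      have : root p b by rewrite Es rootZ ?lead_coef_eq0 // root_prod_XsubC.
      by rewrite rootE /p hornerD hornerN hornerC subr_eq0 => /eqP.
    have := cmodD (b0 - b) (b - a); have := cmodD (b0 - a) (a - a0).
    have -> : b0 - a + (a - a0) = b0 - a0 by ring.
    have -> : b0 - b + (b - a) = b0 - a by ring.
    by rewrite -/m; lra.
  exfalso; move: ga; apply/negP; rewrite -leNgt.
  rewrite cmodC -gb; have -> : g.[b0] - g.[a] = p.[b0] by rewrite /p hornerD hornerN hornerC.
  rewrite Es hornerZ cmodM lp ler_wpM2l ?cmod_ge0 // cmod_lin_prod -ss.
  elim: (s) no => [|x xs IH] no; first by rewrite big_nil.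
  rewrite big_cons /= exprS; apply: ler_pM; rewrite ?exprn_ge0 // ?(ltW m4) //.
    by rewrite leNgt; apply: no; rewrite mem_head.
  by apply: IH => v vx; apply: no; rewrite inE vx orbT.
move=> d0 [/= d0pos Hd]; exists (d0 / 2); first by rewrite divr_gt0.
move=> a ar; apply: (Hd (d0 / 2)) => //=; last by rewrite divr_gt0.
by rewrite sub0r normrN gtr0_norm ?divr_gt0 //; lra.
Unshelve. all: by end_near. Qed.

(* exponents in the lower bound [c0 ^ growth_exp k] for the diameter of the image under [g ^ k] *)
Fixpoint growth_exp D k : nat := if k is k'.+1 then (1 + D.-1 * growth_exp D k')%N else 1%N.

(** The multiplier [D - 1] is less than [D]: the ratio contracts by [1 - 1 / D] at each step, up to
    an error [D^-(k+1)]. *)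
Lemma growth_exp_vanishing D : (1 < D)%N ->
  vanishing (fun k => (growth_exp D k)%:R / D%:R ^+ k : R).
Proof.
move=> D1; have D0 : 0 < D%:R :> R by rewrite ltr0n ltnW.
have V : D%:R^-1 <= 2^-1 :> R by rewrite lef_pV2 ?posrE // ler_nat.
have V0 : 0 < D%:R^-1 :> R by rewrite invr_gt0.
apply: (@vanishing_rec (1 - D%:R^-1) _ (fun k => 1 / 2 ^+ k)); last exact: vanishing_exp2.
- lra.
- lra.
move=> k; rewrite /= natrD natrM.
have -> : D.-1%:R = D%:R - 1 :> R by rewrite -subn1 natrB // ltnW.
set x := (growth_exp D k)%:R.
have -> : (1 + (D%:R - 1) * x) / D%:R ^+ k.+1 = (1 - D%:R^-1) * (x / D%:R ^+ k) + (D%:R ^+ k.+1)^-1.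
  by rewrite exprS; field; rewrite ?expf_neq0 ?(lt0r_neq0 D0).
rewrite lerD2l mul1r lef_pV2 ?posrE ?exprn_gt0 // exprS.
apply: (@le_trans _ _ (D%:R ^+ k)); first by rewrite lerXn2r ?nnegrE ?ler0n // ler_nat.
by rewrite ler_peMl ?exprn_ge0 ?ler0n // ler1n ltnW.
Qed.

(** [path_growth] is applied to the image path on a shrinking time interval that always starts at
    [0], so only the orbit of [y 0] has to remain bounded. *)
Lemma iterated_growth g D (rho : R) : size g = D.+1 -> (1 < D)%N ->
  (forall a, exists2 b, b != a & g.[b] = g.[a]) ->
  exists2 c1 : R, 0 < c1 & forall (y : R -> C) (c0 : R), path_cts y ->
    (forall k, cmod (pol_iter g k).[y 0] <= rho) -> 0 < c0 -> c0 <= c1 -> c0 <= cmod (y 1 - y 0) ->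
    forall k, exists2 t, 0 <= t <= 1 &
      c0 ^+ growth_exp D k <= cmod ((pol_iter g k).[y t] - (pol_iter g k).[y 0]).
Proof.
move=> sg D1 H; have D0 : (0 < D)%N by exact: ltnW.
have [de de0 Hde] := second_preimage_unif rho sg D0 H.
have g0 : g != 0 by rewrite -size_poly_eq0 sg.
have lg : 0 < cmod (lead_coef g) by rewrite cmod_gt0 lead_coef_eq0.
have D1' : 0 < 2 * D.+1%:R :> R by rewrite mulr_gt0 // ltr0n.
pose c2 := cmod (lead_coef g) * (2 * D.+1%:R) ^- D.-1 * (de / 2).
have c20 : 0 < c2 by rewrite /c2 !mulr_gt0 ?invr_gt0 ?exprn_gt0.
(* Below [1] powers decrease, below [de / 2] the radii are admissible, and below [c2] one factor
   [c0] absorbs the constant of [path_growth]: this is the [1 +] in [growth_exp]. *)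
exists (Num.min 1 (Num.min (de / 2) c2)); first by rewrite !lt_min ltr01 divr_gt0.
move=> y c0 cy yb c00; rewrite !le_min => /and3P[c01 c0d c0c] yr.
elim=> [|k [t /andP[t0 t1] Ht]].
  by exists 1; rewrite ?lexx ?ler01 // /pol_iter /= !hornerX expr1.
have cyk := path_cts_horner (pol_iter g k) cy.
have r0 : 0 < c0 ^+ growth_exp D k by rewrite exprn_gt0.
have e1 : (0 < growth_exp D k)%N by case: (k).
have rd : c0 ^+ growth_exp D k <= de / 2.
  apply: le_trans c0d; rewrite -(prednK e1) exprS ler_piMr ?(ltW c00) //.
  by rewrite exprn_ile1 // ltW.
have [s /andP[s0 st] Hs] := path_growth sg D0 cyk t0 r0 rd Ht (Hde _ (yb k)).
exists s; first by rewrite s0 (le_trans st).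
rewrite pol_iterS !horner_comp; apply: le_trans Hs.
rewrite expr_div_n -exprM /= exprS [(growth_exp D k * _)%N]mulnC.
rewrite (_ : _ * (de / 2) = c2 * c0 ^+ (D.-1 * growth_exp D k)); last by rewrite /c2; ring.
by rewrite ler_wpM2r // exprn_ge0 // ltW.
Qed.

End Growth.

(** * Logarithmic derivatives of polynomials *)

Section LogDerivative.
Variable R : realType.
Local Notation C := R[i].
Implicit Types (z w c q : C) (n k : nat) (g h : {poly R[i]}).

Lemma holo_horner (A : set C) g : holo_on A (horner g).
Proof. by move=> z _; exists g^`().[z]; exact: cder_horner. Qed.

(** The maximum principle up to a factor [4], read off Cauchy's formula; the loss is harmless
    because only logarithms of such bounds matter. *)
Lemma square_bound_center z (rho B : R) h : 0 < rho -> 0 <= B ->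
  (forall x, square z rho x -> cmod h.[x] <= B) -> cmod h.[z] <= 4 * B.
Proof.
move=> rho0 B0 HB.
have rr : 2 * rho < 3 * rho by rewrite ltr_pM2r // ltr_nat.
have D0 : disc z (rho / 2) z by apply: disc_center; rewrite divr_gt0.
have ch : cts_on (square z rho) (horner h) by move=> x _; exact: cts_horner.
have := cauchy_int_le 1 rho0 B0 ch HB.
rewrite (cauchy_formula rho0 rr (@holo_horner _ h) D0) cmodM expr1.
have -> : 8 * rho * (B * (2 / rho)) = 16 * B by field; rewrite gt_eqF.
have B3 : 4 <= cmod (cauchy_int z rho (fun=> 1) 1 z).
  rewrite (_ : cauchy_int _ _ _ _ _ = loop z rho (fun x => (x - z)^-1)).
    exact: loop_inv_ge.
  by apply: loop_ext => x _; rewrite mul1r expr1.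
have := ler_wpM2l (cmod_ge0 h.[z]) B3; lra.
Qed.

Lemma disc_sub z w (r s : R) : cmod (w - z) + s <= r -> disc w s `<=` disc z r.
Proof.
move=> H v Dv; rewrite /disc -(subrK w v) -addrA; apply: le_lt_trans (cmodD _ _) _.
move: Dv; rewrite /disc; lra.
Qed.

Lemma ln_cmod_primitive h q (s : R) l z : 0 < s -> (forall z, disc q s z -> h.[z] != 0) ->
  (forall z, disc q s z -> cder l z (h^`().[z] / h.[z])) -> disc q s z ->
  ln (cmod h.[z]) - ln (cmod h.[q]) = complex.Re (l z) - complex.Re (l q).
Proof.
move=> s0 h0 dl Dz; have D0 := disc_center q s0.
have [v sv|v sv E] := @rdiff_mvt _ (fun z => ln (cmod h.[z]) - complex.Re (l z)) q z (fun=> 0).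
  have Dv : disc q s v := segment_disc D0 Dz sv.
  have := rdiffB (rdiff_ln_cmod (h0 v Dv) (cder_horner h v)) (rdiff_Re (dl v Dv)).
  by rewrite subrr.
move: E; rewrite mul0r /=; lra.
Qed.

(* [l / (2 La - l)] maps the disc to the unit disc when [Re l <= La]. *)
Lemma borel_caratheodory h q (s La : R) : 0 < s -> 0 < La ->
  (forall z, disc q s z -> h.[z] != 0) ->
  (forall z, disc q s z -> ln (cmod h.[z]) - ln (cmod h.[q]) <= La) ->
  forall z, disc q (s / 192) z -> cmod (h^`().[z] / h.[z]) <= 768 * La / s.
Proof.
move=> s0 La0 h0 hLa z Dz; have D0 := disc_center q s0.
pose dl z := h^`().[z] / h.[z].
have hdl : holo_on (disc q s) dl.
  move=> x Dx; have := cderM (cder_horner h^`() x) (@cderV _ (horner h) x _ (h0 x Dx) (cder_horner h x)).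
  by move=> H; eexists; exact: H.
pose l := pint dl q.
have dL x : disc q s x -> cder l x (dl x) by exact: primitive.
have lq : l q = 0.
  rewrite /l; have := pint_linear 0 0 q q; rewrite subrr mulr0 mul0r mul0r addr0 => <-.
  have cs : cts_on (segment q q) dl by apply: cts_onS (holo_cts hdl); exact: segment_disc.
  apply/eqP; rewrite -subr_eq0 -cmod_eq0 eq_le cmod_ge0 andbT.
  have [M M0 HM] := segment_bounded cs.
  have := pint_le cs HM; rewrite subrr cmod0 mulr0.
  rewrite pint_linear subrr mulr0 mul0r mul0r addr0 subr0; exact.
have ReL x : disc q s x -> complex.Re (l x) <= La.
  move=> Dx; have := ln_cmod_primitive s0 h0 dL Dx; rewrite lq /= subr0 => <-.
  exact: hLa.
pose La2 : C := (2 * La)%:C%C.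
have cLa2 : cmod La2 = 2 * La by rewrite cmod_real ger0_norm // mulr_ge0 // ltW.
have rLa2 : complex.Re La2 = 2 * La by [].
have iLa2 : complex.Im La2 = 0 by [].
clearbody La2.
have La2n0 : La2 != 0 by rewrite -cmod_gt0 cLa2 mulr_gt0.
have ReD x : disc q s x -> La <= complex.Re (La2 - l x).
  by move=> Dx; rewrite ReB rLa2; have := ReL x Dx; lra.
have den0 x : disc q s x -> La2 - l x != 0.
  move=> Dx; rewrite -cmod_gt0; apply: lt_le_trans La0 _.
  by apply: le_trans (ReD x Dx) _; apply: le_trans (ler_norm _) _; exact: Re_le_cmod.
pose w x := l x / (La2 - l x).
have w1 x : disc q s x -> cmod (w x) <= 1.
  move=> Dx; rewrite /w cmodM cmodV ler_pdivrMr ?cmod_gt0 ?den0 // mul1r.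
  rewrite -(@ler_pXn2r _ 2) ?nnegrE ?cmod_ge0 // !cmod_sqr.
  have := ReL x Dx; rewrite ReB rLa2.
  have -> : complex.Im (La2 - l x) = - complex.Im (l x).
    by move: iLa2; case: (La2) (l x) => ? ? [? ?] /= ->; rewrite sub0r.
  by move=> H; nra.
have dw x : disc q s x -> cder w x (dl x * La2 / (La2 - l x) ^+ 2).
  move=> Dx; have := cderM (dL x Dx) (@cderV _ (fun y => La2 - l y) x _ (den0 x Dx) (cderB (cder_cst La2 x) (dL x Dx))).
  rewrite (_ : dl x * _ + _ = dl x * La2 / (La2 - l x) ^+ 2) //.
  by field; exact: den0.
have hw : holo_on (disc q s) w by move=> x /dw H; eexists; exact: H.
have s2 : 0 < s / 2 by rewrite divr_gt0.
have w2 x : disc q (s / 2) x -> cmod (c1der w x) <= 96 / s.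
  move=> Dx; have sub : disc x (s / 2) `<=` disc q s.
    by apply: disc_sub; move: Dx; rewrite /disc; lra.
  have := @cauchy_estimate _ x (s / 2) w 1 s2 _ _.
  have -> : 48 * 1 / (s / 2) = 96 / s by field; rewrite gt_eqF.
  by apply=> y /sub; [exact: hw|exact: w1].
have Dz2 : disc q (s / 2) z by move: Dz s0; rewrite /disc; lra.
have Dz1 : disc q s z by move: Dz s0; rewrite /disc; lra.
have wq : w q = 0 by rewrite /w lq mul0r.
(* The radius [s / 192] comes from here: [|w'| <= 96 / s] and [w q = 0] give [|w| <= 1 / 2]. *)
have wz : cmod (w z) <= 2^-1.
  have D02 : disc q (s / 2) q by exact: disc_center.
  have := @cder_mvt _ w q z (c1der w) (96 / s).
  rewrite wq subr0 => H; apply: le_trans (H _ _) _ => [x sx|x sx|].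
  - by apply: holo_cder hw _; apply: segment_disc D0 Dz1 _ sx.
  - by apply: w2; exact: segment_disc D02 Dz2 _ sx.
  apply: (@le_trans _ _ (96 / s * (s / 192))).
    rewrite ler_wpM2l ?divr_ge0 // ?ltW //.
  by have -> : 96 / s * (s / 192) = 2^-1 by field; rewrite gt_eqF.
have d0 := den0 z Dz1.
(* Inverting the map: [|2 La - l| <= 4 La], and [l' = w' (2 La - l)^2 / (2 La)] is at most
   [(96 / s) (4 La)^2 / (2 La) = 768 La / s]. *)
have E1 : La2 - l z = La2 / (1 + w z).
  have w1n : 1 + w z = La2 / (La2 - l z) by rewrite /w; field.
  by rewrite w1n; field; rewrite d0 La2n0.
have E2 : dl z = c1der w z * (La2 - l z) ^+ 2 / La2.
  by rewrite (cder_unique (holo_cder hw Dz1) (dw z Dz1)); field; rewrite La2n0 d0.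
have W2 : 2^-1 <= cmod (1 + w z).
  by have := cmodB_le (1 : C) (- w z); rewrite opprK cmodN cmod1; lra.
have D4 : cmod (La2 - l z) <= 4 * La.
  rewrite E1 cmodM cmodV cLa2 ler_pdivrMr; first by have := ler_wpM2l (ltW La0) W2; lra.
  by apply: lt_le_trans W2.
rewrite -/(dl z) E2 cmodM cmodV cmodM cmodX cLa2.
have H2 := w2 z Dz2.
have s96 : 0 <= 96 / s by rewrite divr_ge0 // ltW.
have D42 : cmod (La2 - l z) ^+ 2 <= (4 * La) ^+ 2.
  by rewrite lerXn2r ?nnegrE ?cmod_ge0 // mulr_ge0 // ltW.
apply: (@le_trans _ _ (96 / s * (4 * La) ^+ 2 / (2 * La))).
  rewrite ler_wpM2r ?invr_ge0 ?mulr_ge0 ?(ltW La0) //.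
  by apply: ler_pM; rewrite ?cmod_ge0 ?sqr_ge0.
rewrite le_eqVlt; apply/orP; left; apply/eqP; field.
by rewrite !gt_eqF.
Qed.

Lemma lin_prod_filter (P : pred C) (t : seq C) :
  lin_prod t = lin_prod [seq x <- t | P x] * lin_prod [seq x <- t | ~~ P x].
Proof. by rewrite /lin_prod !big_filter (bigID P). Qed.

Lemma lin_prod_ge (s : seq C) z (r : R) : 0 <= r -> (forall x, x \in s -> r <= cmod (z - x)) ->
  r ^+ size s <= cmod (lin_prod s).[z].
Proof.
move=> r0; rewrite cmod_lin_prod; elim: s => [|x s IH] H; first by rewrite big_nil.
rewrite big_cons /= exprS; apply: ler_pM; rewrite ?exprn_ge0 //; first by apply: H; rewrite mem_head.
by apply: IH => v vs; apply: H; rewrite inE vs orbT.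
Qed.

Lemma lin_prod_le (s : seq C) z (r : R) : (forall x, x \in s -> cmod (z - x) <= r) ->
  cmod (lin_prod s).[z] <= r ^+ size s.
Proof.
rewrite cmod_lin_prod; elim: s => [|x s IH] H; first by rewrite big_nil.
rewrite big_cons /= exprS; apply: ler_pM; rewrite ?cmod_ge0 //.
- by apply: prodr_ge0 => c _; exact: cmod_ge0.
- by apply: H; rewrite mem_head.
by apply: IH => v vs; apply: H; rewrite inE vs orbT.
Qed.

(** The zeros within [sg = ta / 16] of [q] are divided out, leaving [h] without zeros there. Each
    removed factor is at most [sg] at [q] but at least [ta / 8 = 2 sg] on the squares used to bound
    [h]. This gain of [2] per zero is Jensen's inequality: it bounds the number of zeros as well as
    the growth of [h], to which [borel_caratheodory] applies. *)
Lemma log_deriv_local g q (ta M eta : R) : 0 < ta ->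
  (forall z, disc q ta z -> cmod g.[z] <= M) -> 0 < eta -> eta <= cmod g.[q] ->
  exists s : seq C, (size s)%:R * ln 2 <= ln (4 * M / eta) /\
    forall z, disc q (ta / 3072) z -> g.[z] != 0 ->
      cmod (g^`().[z] / g.[z]) <= inv_dist_sum s z + 12288 * ln (4 * M / eta) / ta.
Proof.
move=> ta0 gM eta0 gq.
have D0 := disc_center q ta0.
have qM := gM q D0.
have M0 : 0 < M by lra.
pose La := ln (4 * M / eta).
have eM : 4 <= 4 * M / eta by rewrite ler_pdivlMr //; lra.
have La0 : 0 < La by rewrite /La ln_gt0 //; lra.
have [t Et] := poly_factor g.
set mu := lead_coef g in Et.
pose sg := ta / 16; have sg0 : 0 < sg by rewrite divr_gt0.
pose P (x : C) := cmod (x - q) < sg.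
pose s := [seq x <- t | P x]; pose u := [seq x <- t | ~~ P x].
pose h := mu *: lin_prod u.
have gE : g = lin_prod s * h by rewrite {1}Et (lin_prod_filter P) scalerAr.
have gz z : g.[z] = (lin_prod s).[z] * h.[z] by rewrite gE hornerM.
have gq0 : g.[q] != 0 by rewrite -cmod_gt0; lra.
have [sq0 hq0] : (lin_prod s).[q] != 0 /\ h.[q] != 0.
  by move: gq0; rewrite gz mulf_eq0 negb_or => /andP.
have mu0 : mu != 0 by move: hq0; rewrite /h hornerZ mulf_eq0 negb_or => /andP[].
pose n0 := size s.
have h0 z : disc q sg z -> h.[z] != 0.
  move=> Dz; rewrite /h hornerZ mulf_neq0 //.
  rewrite -rootE /lin_prod root_prod_XsubC mem_filter negb_and /= negbK.
  by rewrite (_ : P z) //; exact: Dz.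
have sP x : x \in s -> cmod (x - q) < sg by rewrite mem_filter => /andP[].
have near_le : cmod (lin_prod s).[q] <= sg ^+ n0.
  by apply: lin_prod_le => x /sP; rewrite cmodC; exact: ltW.
have ta8 : 0 < ta / 8 by rewrite divr_gt0.
have hq_ge : eta / sg ^+ n0 <= cmod h.[q].
  rewrite ler_pdivrMr ?exprn_gt0 //; apply: le_trans gq _.
  by rewrite gz cmodM mulrC ler_wpM2l ?cmod_ge0.
have hz_le z : disc q sg z -> cmod h.[z] <= 4 * (M / (ta / 8) ^+ n0).
  move=> Dz; apply: (@square_bound_center _ (ta / 2)); first by rewrite divr_gt0.
    by rewrite divr_ge0 ?exprn_ge0 // ltW.
  move=> x sx; have ta2 : 0 < ta / 2 by rewrite divr_gt0.
  have /andP[x1 x2] := squareP ta2 sx.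
  have Dx : disc q ta x.
    rewrite /disc -(subrK z x) -addrA; apply: le_lt_trans (cmodD _ _) _.
    by move: Dz; rewrite /disc /sg; lra.
  rewrite ler_pdivlMr ?exprn_gt0 //; apply: le_trans (gM x Dx).
  rewrite gz cmodM mulrC ler_wpM2r ?cmod_ge0 //; apply: lin_prod_ge => [|y /sP yq]; first exact: ltW.
  have := cmodD (x - y) ((y - q) - (z - q)); have := cmodD (y - q) (- (z - q)); rewrite cmodN.
  have -> : x - y + (y - q - (z - q)) = x - z by ring.
  by move: Dz yq; rewrite /disc /sg; lra.
have hq0' : 0 < cmod h.[q] by rewrite cmod_gt0.
have ratio z : disc q sg z -> 2 ^+ n0 * cmod h.[z] <= 4 * M / eta * cmod h.[q].
  move=> Dz; apply: (@le_trans _ _ (4 * M / eta * (eta / sg ^+ n0))); last first.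
    by rewrite ler_wpM2l // divr_ge0 ?mulr_ge0 // ltW.
  apply: le_trans (ler_wpM2l (exprn_ge0 n0 (ler0n R 2)) (hz_le z Dz)) _.
  have E : (ta / 8) ^+ n0 = 2 ^+ n0 * sg ^+ n0.
    by rewrite -exprMn /sg; congr (_ ^+ _); field.
  rewrite E le_eqVlt; apply/orP; left; apply/eqP; field.
  by rewrite !gt_eqF ?exprn_gt0.
have Dq : disc q sg q by exact: disc_center.
exists s; split.
  have := ratio q Dq; rewrite ler_pM2r // => H.
  rewrite mulr_natl -lnXn // ler_ln ?posrE ?exprn_gt0 //; lra.
have lnr z : disc q sg z -> ln (cmod h.[z]) - ln (cmod h.[q]) <= La.
  move=> Dz; have hz0 : 0 < cmod h.[z] by rewrite cmod_gt0 h0.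
  have p1 : 0 < 4 * M / eta by lra.
  have p2 : 0 < 4 * M / eta * cmod h.[q] by exact: mulr_gt0.
  rewrite lerBlDr /La -lnM ?posrE // ler_ln ?posrE //.
  by apply: le_trans (ratio z Dz); rewrite ler_peMl ?cmod_ge0 // exprn_ege1 // ler1n.
move=> z Dz gz0.
(* Constants: [ta / 3072 = sg / 192] and [12288 = 768 * 16]. *)
have Dz' : disc q (sg / 192) z by move: Dz; rewrite /disc /sg; lra.
have BC := borel_caratheodory sg0 La0 h0 lnr Dz'.
have [sz0 hz0] : (lin_prod s).[z] != 0 /\ h.[z] != 0.
  by move: gz0; rewrite gz mulf_eq0 negb_or => /andP.
have -> : g^`().[z] / g.[z] = (lin_prod s)^`().[z] / (lin_prod s).[z] + h^`().[z] / h.[z].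
  by rewrite gE derivM !(hornerD, hornerM); field; rewrite sz0 hz0.
apply: le_trans (cmodD _ _) _; apply: lerD.
  have [-> _] := log_deriv_lin sz0; apply: le_trans (cmod_sum _ _ _) _.
  by apply: ler_sum => c _; rewrite cmodV.
apply: le_trans BC _; rewrite -/La /sg le_eqVlt; apply/orP; left; apply/eqP; field.
by rewrite gt_eqF.
Qed.

Lemma avoid_seq (s : seq C) q (r : R) : 0 < r -> exists2 w, disc q r w & w \notin s.
Proof.
move=> r0; pose x k : C := q + (r / k.+2%:R)%:C%C.
have inj : injective x.
  move=> i j /addrI [] /(congr1 (fun t => r^-1 * t)); rewrite !mulKf ?gt_eqF // => /invr_inj.
  by move=> /eqP; rewrite eqr_nat => /eqP [].
have [/allP H|] := boolP (all (mem s) (map x (iota 0 (size s).+1))).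
  have := uniq_leq_size (_ : uniq (map x (iota 0 (size s).+1))) H.
  by rewrite map_inj_uniq // iota_uniq => /(_ isT); rewrite size_map size_iota ltnn.
move=> /allPn [w /mapP[k _ ->] ws]; exists (x k) => //.
rewrite /disc /x addrAC subrr add0r cmod_real ger0_norm ?divr_ge0 ?ler0n ?(ltW r0) //.
by rewrite ltr_pdivrMr ?ltr0n // ltr_pMr // ltr1n.
Qed.

Lemma pol_iter_double g j : pol_iter g (2 * j) = pol_iter (g \Po g) j.
Proof.
elim: j => [|j IH] //; rewrite mulnS !addSn add0n !pol_iterS IH.
by rewrite comp_polyA.
Qed.

Section Interior.
Variables (d : nat) (f : {poly R[i]}) (R0 : R).
Hypotheses (d_ge2 : (2 <= d)%N) (deg_f : size f = d.+1).
Hypothesis nonexc : forall a : C, exists2 b, b != a & (f \Po f).[b] = (f \Po f).[a].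

Local Notation fn := (pol_iter f).

Lemma size_ff : size (f \Po f) = (d * d).+1.
Proof.
have := size_comp_poly f f; rewrite deg_f /=; case: (size _) => [|n] /= E; last by rewrite E.
by move: d_ge2; case: (d) E.
Qed.

Lemma segment_path p q : path_cts (fun t : R => p + t%:C%C * (q - p)).
Proof. by move=> t e e0; exact: segment_path_cts. Qed.

(** [iterated_growth] concerns the iterates of [f \Po f]. For odd [k] it is applied to the image
    path [f.[y t]], so [q] has to be chosen with both [q != p] and [f.[q] != f.[p]]. *)
Lemma interior_growth p (r : R) : 0 < r ->
  (forall z k, disc p r z -> cmod (fn k).[z] <= R0) ->
  exists2 c0 : R, 0 < c0 < 1 & forall k, exists2 q, disc p r q &
    c0 ^+ growth_exp (d * d) k./2 <= cmod ((fn k).[q] - (fn k).[p]).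
Proof.
move=> r0 bnd.
have d0 : (0 < d)%N by exact: leq_trans d_ge2.
have dd : (1 < d * d)%N by apply: leq_trans d_ge2 _; rewrite leq_pmulr.
have [c1 c10 Hc1] := iterated_growth R0 size_ff dd nonexc.
have f0 : f - f.[p]%:P != 0.
  rewrite -size_poly_eq0 size_polyDl ?deg_f // size_polyN.
  by apply: leq_ltn_trans (size_polyC_leq1 _) _.
have [s Es] := poly_factor (f - f.[p]%:P).
have [q Dq] := avoid_seq (p :: s) p r0.
rewrite inE negb_or => /andP[qp qs].
have fqp : 0 < cmod (f.[q] - f.[p]).
  rewrite cmod_gt0; have -> : f.[q] - f.[p] = (f - f.[p]%:P).[q].
    by rewrite hornerD hornerN hornerC.
  by rewrite -rootE Es rootZ ?lead_coef_eq0 // root_prod_XsubC.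
have qp0 : 0 < cmod (q - p) by rewrite cmod_gt0 subr_eq0.
pose c0 := Num.min 2^-1 (Num.min c1 (Num.min (cmod (q - p)) (cmod (f.[q] - f.[p])))).
have c00 : 0 < c0 by rewrite !lt_min c10 qp0 fqp invr_gt0 ltr0n.
have [le1 le2 le3 le4] : [/\ c0 <= 2^-1, c0 <= c1, c0 <= cmod (q - p) & c0 <= cmod (f.[q] - f.[p])].
  by rewrite /c0; split; rewrite !ge_min lexx ?orbT.
exists c0; first by rewrite c00 /=; lra.
have Dp := disc_center p r0.
pose y (t : R) := p + t%:C%C * (q - p).
have y0 : y 0 = p by rewrite /y rmorph0 mul0r addr0.
have y1 : y 1 = q by rewrite /y rmorph1 mul1r addrCA subrr addr0.
have cy : path_cts y by exact: segment_path.
have Dy t : 0 <= t <= 1 -> disc p r (y t).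
  by move=> t01; apply: segment_disc Dp Dq _ _; exists t.
move=> k; have := odd_double_half k; case: (odd k) => /= <-.
  rewrite add1n /= uphalf_double -mul2n.
  have [||t t01 Ht] := Hc1 (fun t => f.[y t]) c0 (path_cts_horner f cy) _ c00 le2 _ k./2.
  - move=> j; rewrite -pol_iter_double y0.
    have := bnd p (2 * j).+1 Dp; rewrite -addn1 pol_iter_add.
    by rewrite /pol_iter /= comp_polyXr.
  - by rewrite y0 y1.
  exists (y t); first exact: Dy.
  move: Ht; rewrite y0 -pol_iter_double.
  have E x : (fn (2 * k./2).+1).[x] = (fn (2 * k./2)).[f.[x]].
    by rewrite -addn1 pol_iter_add /pol_iter /= comp_polyXr.
  by rewrite !E.
rewrite add0n doubleK -mul2n.
have [||t t01 Ht] := Hc1 y c0 cy _ c00 le2 _ k./2.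
- by move=> j; rewrite -pol_iter_double y0; exact: bnd.
- by rewrite y0 y1.
exists (y t); first exact: Dy.
by move: Ht; rewrite y0 -pol_iter_double.
Qed.

End Interior.
End LogDerivative.

(** * The estimate around points with bounded orbits *)

Section InteriorEstimate.
Variable R : realType.
Local Notation C := R[i].
Implicit Types (z w c q : C) (n k : nat).
Variables (d : nat) (f : {poly R[i]}) (R0 : R).
Hypotheses (d_ge2 : (2 <= d)%N) (deg_f : size f = d.+1).
Hypothesis nonexc : forall a : C, exists2 b, b != a & (f \Po f).[b] = (f \Po f).[a].

Local Notation fn := (pol_iter f).

Lemma vanishing_half (e : nat -> R) : vanishing e -> vanishing (fun n => e n./2).
Proof.
move=> H x /H [N HN]; exists N.*2 => n Nn; apply: HN.
by rewrite -(doubleK N) half_leq.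
Qed.

Lemma inv_dist_sum_cat (s t : seq C) z :
  inv_dist_sum (s ++ t) z = inv_dist_sum s z + inv_dist_sum t z.
Proof. by rewrite /inv_dist_sum big_cat. Qed.

Lemma inv_dist_sum_flatten (ss : seq (seq C)) z :
  inv_dist_sum (flatten ss) z = \sum_(s <- ss) inv_dist_sum s z.
Proof.
elim: ss => [|s ss IH]; first by rewrite /inv_dist_sum !big_nil.
by rewrite /= inv_dist_sum_cat IH big_cons.
Qed.

Lemma size_flatten_le (T : Type) (ss : seq (seq T)) (x : R) :
  (forall s, List.In s ss -> (size s)%:R <= x) -> (size (flatten ss))%:R <= (size ss)%:R * x.
Proof.
elim: ss => [|s ss IH] H /=; first by rewrite mul0r.
rewrite size_cat natrD -natr1 mulrDl mul1r addrC; apply: lerD; last by apply: H; left.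
by apply: IH => t ts; apply: H; right.
Qed.

Lemma In_map (T S : Type) (g : T -> S) (s : seq T) y : List.In y (map g s) ->
  exists2 x, List.In x s & y = g x.
Proof.
elim: s => [//|x s IH] /= [<-|/IH [v vs ->]]; first by exists x => //; left.
by exists v => //; right.
Qed.

Lemma In_mem (T : eqType) (s : seq T) x : List.In x s -> x \in s.
Proof.
by elim: s => [//|v s IH] /= [->|/IH H]; rewrite inE ?eqxx // H orbT.
Qed.

(* Somewhere on the disc [f^k - c] exceeds [c0 ^ E k / 2] with [E k = o(d ^ k)], so up to
   [O(E k)] simple poles its logarithmic derivative is [O(E k)]. *)
Lemma interior_estimate p (rho : R) : 0 < rho ->
  (forall z k, disc p rho z -> cmod (fn k).[z] <= R0) ->
  exists r : R, exists e : nat -> R, [/\ 0 < r, vanishing e &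
    forall n, exists S : seq C, exists a b : R, [/\ 0 <= a, 0 <= b,
      a + b * (size S)%:R <= e n &
      forall z, disc p r z ->
        Num.sqrt (cmod (pschw (fn n) z / d%:R ^+ (2 * n))) <= a + b * inv_dist_sum S z]].
Proof.
move=> rho0 bnd.
have d0 : 0 < d%:R :> R by rewrite ltr0n (leq_trans _ d_ge2).
have d2 : 2 <= d%:R :> R by rewrite ler_nat.
have dd : (1 < d * d)%N by apply: leq_trans d_ge2 _; rewrite leq_pmulr // (leq_trans _ d_ge2).
(* [log_deriv_local] is centred at a point [q] that depends on [k] and [c]; halving the radius makes
   its disc contain [disc p r] for every [q] in [disc p r]. *)
pose r := rho / 2 / 3072 / 2; have r0 : 0 < r by rewrite /r; lra.
have Dp := disc_center p rho0.
have R00 : 0 <= R0 by apply: le_trans (bnd p 0%N Dp); exact: cmod_ge0.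
have subr : disc p r `<=` disc p rho.
  by move=> z; rewrite /disc /r => H; apply: lt_le_trans H _; lra.
have [c0 /andP[c00 c01] Hc0] := interior_growth d_ge2 deg_f nonexc r0
  (fun z k Dz => bnd z k (subr z Dz)).
pose E k := growth_exp (d * d) k./2.
have [cs Ecs] := poly_factor f^`().
(* Bounds [|f^k - c|] for all [k] and all critical points [c] of [f]; the summand [1] keeps
   [ln (8 * M)] nonnegative. *)
pose M := R0 + \sum_(c <- cs) cmod c + 1.
have cs0 : 0 <= \sum_(c <- cs) cmod c by apply: sumr_ge0 => c _; exact: cmod_ge0.
have M1 : 1 <= M by rewrite /M; lra.
have ccs c : c \in cs -> cmod c <= \sum_(c <- cs) cmod c.
  move=> cc; rewrite (perm_big _ (perm_to_rem cc)) big_cons lerDl.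
  by apply: sumr_ge0 => v _; exact: cmod_ge0.
have gM k c z : c \in cs -> disc p rho z -> cmod (fn k - c%:P).[z] <= M.
  move=> cc Dz; rewrite hornerD hornerN hornerC; apply: le_trans (cmodD _ _) _.
  by rewrite cmodN; have := ccs c cc; have := bnd z k Dz; rewrite /M; lra.
pose eta k := c0 ^+ E k / 2.
have eta0 k : 0 < eta k by rewrite /eta divr_gt0 // exprn_gt0.
pose La k := ln (4 * M / eta k).
have LaE k : La k = ln (8 * M) + (E k)%:R * - ln c0.
  have M8 : 0 < 8 * M by lra.
  have cE0 : 0 < c0 ^+ E k by rewrite exprn_gt0.
  rewrite /La; have -> : 4 * M / eta k = 8 * M / c0 ^+ E k.
    rewrite /eta; move: cE0; move: (c0 ^+ _) => y y0.
    by field; rewrite gt_eqF.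
  by rewrite ln_div ?posrE // lnXn // mulrN -[ln c0 *+ _]mulr_natl.
pose C1 := 12288 / (rho / 2).
have C10 : 0 < C1 by rewrite /C1 divr_gt0 ?ltr0n //; lra.
have local k c : c \in cs -> exists s : seq C, (size s)%:R * ln 2 <= La k /\
    forall z, disc p r z -> (fn k - c%:P).[z] != 0 ->
      cmod ((fn k)^`().[z] / ((fn k).[z] - c)) <= inv_dist_sum s z + C1 * La k.
  move=> cc.
  (* If [|f^k - c|] were below [eta k] both at [p] and at the point given by [interior_growth],
     their images would be too close; hence the half in [eta]. *)
  have [q Dq qe] : exists2 q, disc p r q & eta k <= cmod (fn k - c%:P).[q].
    have [q Dq Hq] := Hc0 k.
    have gE x : (fn k - c%:P).[x] = (fn k).[x] - c by rewrite hornerD hornerN hornerC.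
    have [H|H] := leP (eta k) (cmod (fn k - c%:P).[q]); first by exists q.
    exists p; first exact: disc_center.
    have := cmodD ((fn k).[q] - c) (- ((fn k).[p] - c)).
    have -> : (fn k).[q] - c + - ((fn k).[p] - c) = (fn k).[q] - (fn k).[p] by ring.
    rewrite cmodN -!gE; move: Hq H; rewrite /eta -/(E k); lra.
  have ta0 : 0 < rho / 2 by rewrite divr_gt0.
  have subq : disc q (rho / 2) `<=` disc p rho.
    by apply: disc_sub; move: Dq; rewrite /disc /r; lra.
  have [s [s1 s2]] := log_deriv_local ta0 (fun z Dz => gM k c z cc (subq z Dz)) (eta0 k) qe.
  exists s; split => // z Dz gz.
  have Dz' : disc q (rho / 2 / 3072) z.
    rewrite /disc; have := cmodD (z - p) (- (q - p)); rewrite cmodN.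
    have -> : z - p + - (q - p) = z - q by ring.
    by move: Dz Dq; rewrite /disc /r; lra.
  have := s2 z Dz' gz; rewrite derivB derivC subr0 hornerD hornerN hornerC.
  by move=> H; apply: le_trans H _; rewrite lerD2l -/(La k) /C1 mulrAC.
have [x|sk Hsk] := @choice _ _ (fun (x : nat * C) (s : seq C) => x.2 \in cs ->
   (size s)%:R * ln 2 <= La x.1 /\
    forall z, disc p r z -> (fn x.1 - x.2%:P).[z] != 0 ->
      cmod ((fn x.1)^`().[z] / ((fn x.1).[z] - x.2)) <= inv_dist_sum s z + C1 * La x.1).
  have [xc|xc] := boolP (x.2 \in cs); last by exists [::].
  by have [s Hs] := local x.1 x.2 xc; exists s.
have ln2 : 0 < ln 2 :> R by rewrite ln_gt0 // ltr1n.
have La0 k : 0 <= La k.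
  rewrite LaE; apply: addr_ge0; first by rewrite ln_ge0 //; lra.
  by rewrite mulr_ge0 ?ler0n // oppr_ge0 ln_le0 // ltW.
(* [W (k+1) <= W k / 2 + La k / d^k], and [La k = o(d^k)] since [E k] is [o((d^2)^(k/2))]; so [W]
   vanishes. *)
pose W n := (\sum_(k < n) La k) / d%:R ^+ n.
pose m := (size cs)%:R : R.
have m0 : 0 <= m by rewrite ler0n.
have dn0 n : 0 < d%:R ^+ n :> R by rewrite exprn_gt0.
have Wv : vanishing W.
  have vE : vanishing (fun k => (E k)%:R / d%:R ^+ k : R).
    have H := vanishing_half (growth_exp_vanishing dd).
    apply: vanishing_le H => k; rewrite -/(E k) ler_wpM2l ?ler0n //.
    rewrite lef_pV2 ?posrE ?exprn_gt0 //; last by rewrite ltr0n ltnW.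
    rewrite natrM -expr2 -exprM ler_weXn2l //; first lra.
    by rewrite mul2n -[X in (_ <= X)%N](odd_double_half k) leq_addl.
  apply: (@vanishing_rec _ 2^-1 W (fun k => La k / d%:R ^+ k)); rewrite ?invr_ge0 ?ler0n //; first lra.
    move=> k; rewrite /W big_ord_recr /= mulrDl; apply: lerD.
      have -> : (\sum_(i < k) La i) / d%:R ^+ k.+1 = d%:R^-1 * ((\sum_(i < k) La i) / d%:R ^+ k).
        by rewrite exprS invfM; ring.
      rewrite ler_wpM2r ?lef_pV2 ?posrE //.
      by rewrite divr_ge0 ?(ltW (dn0 _)) // sumr_ge0.
    rewrite ler_wpM2l // lef_pV2 ?posrE // exprS ler_peMl ?(ltW (dn0 _)) //; lra.
  have H := vanishingD (@vanishing_exp2 R (ln (8 * M)) _)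
    (vanishingZ (_ : 0 <= - ln c0) vE).
  apply: vanishing_le (H _ _) => [k||].
  - rewrite LaE mulrDl; apply: lerD.
      rewrite ler_wpM2l ?ln_ge0 //; first lra.
      by rewrite lef_pV2 ?posrE ?exprn_gt0 // lerXn2r ?nnegrE ?ler0n.
    by rewrite le_eqVlt; apply/orP; left; apply/eqP; ring.
  - by rewrite ln_ge0 //; lra.
  - by rewrite oppr_ge0 ln_le0 // ltW.
pose B := 2 * m * (C1 + (ln 2)^-1).
have B0 : 0 <= B by rewrite !mulr_ge0 // addr_ge0 ?invr_ge0 // ltW.
exists r, (fun n => B * W n); split => //; first exact: vanishingZ.
move=> n.
pose S := flatten [seq flatten [seq sk (k, c) | c <- cs] | k <- iota 0 n].
have sum0 : 0 <= \sum_(k < n) La k by exact: sumr_ge0.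
have b0 : 0 <= 2 / d%:R ^+ n :> R by rewrite divr_ge0 // ltW.
exists S, (2 / d%:R ^+ n * (m * C1 * \sum_(k < n) La k)), (2 / d%:R ^+ n); split => //.
- exact: mulr_ge0 b0 (mulr_ge0 (mulr_ge0 m0 (ltW C10)) sum0).
- rewrite -mulrDr.
  have sS : (size S)%:R <= m * (\sum_(k < n) La k) / ln 2.
    rewrite /S -(big_mkord xpredT La) /index_iota subn0.
    elim: (iota 0 n) => [|k ks IH]; first by rewrite /= big_nil mulr0 mul0r.
    rewrite /= size_cat natrD big_cons mulrDr mulrDl; apply: lerD => //.
    have := @size_flatten_le _ [seq sk (k, c) | c <- cs] (La k / ln 2).
    rewrite size_map -/m mulrA => H; apply: H => s sIn.
    have [c /In_mem cc ->] := In_map sIn.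
    by rewrite ler_pdivlMr //; case: (Hsk (k, c) cc).
  apply: (@le_trans _ _ (2 / d%:R ^+ n * (m * C1 * (\sum_(k < n) La k) + m * (\sum_(k < n) La k) / ln 2))).
    by rewrite ler_wpM2l // lerD2l.
  by rewrite le_eqVlt; apply/orP; left; apply/eqP; rewrite /B /W; ring.
move=> z Dz.
have -> : cmod (pschw (fn n) z / d%:R ^+ (2 * n)) = cmod (pschw (fn n) z) * (d%:R ^+ n)^-1 ^+ 2.
  by rewrite cmodM cmodV cmodX cmod_nat mulnC exprM exprVn.
rewrite sqrtrM ?cmod_ge0 // sqrtr_sqr ger0_norm ?invr_ge0 ?(ltW (dn0 n)) //.
rewrite -mulrDr;
set X := m * C1 * _ + _.
have -> : 2 / d%:R ^+ n * X = 2 * X * (d%:R ^+ n)^-1 by rewrite mulrAC.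
apply: ler_wpM2r; first by rewrite invr_ge0 ltW.
apply: le_trans (sqrt_pschw_iter_le n z Ecs) _; rewrite -mulr_sumr; apply: ler_wpM2l => //.
rewrite /X /S -(big_mkord xpredT La) -(big_mkord xpredT (fun k => cmod (fn k)^`().[z] * inv_dist_sum cs (fn k).[z])).
rewrite /index_iota subn0.
elim: (iota 0 n) => [|k ks IH].
  by rewrite !big_nil mulr0 /= /inv_dist_sum big_nil addr0.
rewrite !big_cons /= inv_dist_sum_cat mulrDr.
have -> x y u v : x + y + (u + v) = (x + u) + (y + v) :> R by ring.
apply: lerD IH => //.
rewrite inv_dist_sum_flatten big_map /m {1}/inv_dist_sum mulr_sumr.
have -> : (size cs)%:R * C1 * La k = \sum_(c <- cs) C1 * La k.
  by rewrite big_const_seq count_predT iter_addr_0 -[RHS]mulr_natl mulrA.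
rewrite -big_split /=; rewrite big_seq_cond [leRHS]big_seq_cond.
apply: ler_sum => c /andP[cc _]; case: (Hsk (k, c) cc) => _ H.
(* At a zero of [f^k - c] the left-hand side is [0] because [0^-1 = 0]. *)
have [E0|E0] := eqVneq ((fn k).[z] - c) 0.
  rewrite E0 cmod0 invr0 mulr0 addr_ge0 ?inv_dist_sum_ge0 //.
  by rewrite mulr_ge0 // ltW.
by rewrite addrC -cmodV -cmodM; apply: H => //; rewrite hornerD hornerN hornerC.
Qed.

End InteriorEstimate.

(** * Integrals of square roots *)

Section Integrals.
Variable R : realType.
Local Notation C := R[i].
Local Open Scope ereal_scope.

Local Notation leb := (@lebesgue_measure R).
Local Notation mu := (leb \x leb).

Definition box (c : C) (r : R) : set (R * R) :=
  ball (complex.Re c) r `*` ball (complex.Im c) r.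

Lemma measurable_ballR (x r : R) : measurable (ball x r : set R).
Proof. by rewrite ball_itv; exact: measurable_itv. Qed.

Lemma measurable_box c r : measurable (box c r).
Proof. by apply: measurableX; exact: measurable_ballR. Qed.

Lemma measure_box c r : (0 <= r)%R -> mu (box c r) = (4 * r ^+ 2)%:E.
Proof.
move=> r0; rewrite /box product_measure1E; [|exact: measurable_ballR..].
have L x := @lebesgue_measure_ball R x r r0.
change (lebesgue_measure (ball (complex.Re c) r) * lebesgue_measure (ball (complex.Im c) r) = (4 * r ^+ 2)%:E).
rewrite !L -EFinM; congr (_%:E).
by rewrite -mulr_natl; ring.
Qed.

(* No measurability is needed: these integrals are suprema over simple functions. *)
Lemma integral_le_nonmeas (D1 D2 : set (R * R)) (g1 g2 : R * R -> \bar R) :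
  D1 `<=` D2 -> (forall x, D1 x -> 0 <= g1 x) -> (forall x, D2 x -> 0 <= g2 x) ->
  (forall x, D1 x -> g1 x <= g2 x) ->
  \int[mu]_(x in D1) g1 x <= \int[mu]_(x in D2) g2 x.
Proof.
move=> D12 g10 g20 g12; rewrite !ge0_integralE //; apply: ge_ereal_sup => _ [h /= hf] <-.
apply: ereal_sup_ubound; exists h => //= x; apply: le_trans (hf x) _.
rewrite /patch; case: ifPn => [|x1]; first by rewrite inE => x1; rewrite mem_set; [exact: g12|exact: D12].
by case: ifPn => // /set_mem; exact: g20.
Qed.

(* Dominates [1 / |z - c| - 1]. Being infinite at [c], it absorbs whatever value a
   quadratic differential is given at a pole. *)
Definition kernel (c : C) (p : R * R) : \bar R :=
  \sum_(0 <= j <oo) (2 ^+ j.+1 * \1_(box c (2 ^- j)) p)%:E.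

Lemma kernel_term_ge0 (c : C) (p : R * R) j : 0 <= (2 ^+ j.+1 * \1_(box c (2 ^- j)) p)%:E :> \bar R.
Proof. by rewrite lee_fin mulr_ge0 ?exprn_ge0 // indicE. Qed.

Lemma kernel_ge0 c p : 0 <= kernel c p.
Proof. by apply: nneseries_ge0 => n _ _; exact: kernel_term_ge0. Qed.

Lemma kernel_ge c p j : box c (2 ^- j) p -> (2 ^+ j.+1)%:E <= kernel c p.
Proof.
move=> bp.
have H := @nneseries_lim_ge R _ xpredT 0%N j.+1 (fun n _ _ => kernel_term_ge0 c p n).
apply: le_trans H; rewrite big_nat_recr //= indicE mem_set // mulr1.
by rewrite leeDr // sume_ge0 // => i _; exact: kernel_term_ge0.
Qed.

Lemma kernel_center (z : C) (x : R) : x%:E <= kernel z (complex.Re z, complex.Im z).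
Proof.
have [j /(_ j (leqnn j))] := exp2_small ltr01 (normr_ge0 x).
have y0 : (0 < 2 ^+ j :> R)%R by rewrite exprn_gt0.
rewrite ltr_pdivrMr // mul1r => xj.
apply: (@le_trans _ _ (2 ^+ j.+1)%:E); last first.
  by apply: kernel_ge; split; apply: ballxx; rewrite invr_gt0.
rewrite lee_fin exprS; have := ler_norm x; lra.
Qed.

(** If [2^-(j+1) <= |z - c| < 2^-j], then [z] lies in the box of half-side [2^-j], whose weight
    [2^(j+1)] already suffices. *)
Lemma inv_dist_le_kernel (c z : C) :
  (cmod (z - c))^-1%:E <= 1 + kernel c (complex.Re z, complex.Im z).
Proof.
have K0 := kernel_ge0 c (complex.Re z, complex.Im z).
have [->|zc] := eqVneq z c.
  by rewrite subrr cmod0 invr0; apply: adde_ge0 => //; exact: kernel_ge0.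
have r0 : (0 < cmod (z - c))%R by rewrite cmod_gt0 subr_eq0.
have [r1|r1] := leP 1%R (cmod (z - c)%R).
  apply: (@le_trans _ _ 1); last by rewrite leeDl.
  by rewrite lee_fin invf_le1.
have ex : exists j, (1 / 2 ^+ j <= cmod (z - c))%R.
  by have [N HN] := exp2_small r0 (@ler01 R); exists N; apply/ltW/HN.
case: (ex_minnP ex) => -[|j] Hj minj; first by move: Hj; rewrite expr0 divr1 leNgt r1.
apply: (@le_trans _ _ (2 ^+ j.+1)%:E).
  by rewrite lee_fin invf_ple ?posrE ?exprn_gt0 //; move: Hj; rewrite div1r.
apply: le_trans (leeDr _ _); last by [].
apply: kernel_ge.
have rj : (cmod (z - c) < 2 ^- j)%R.
  by rewrite ltNge -div1r; apply/negP => /minj; rewrite ltnn.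
split; rewrite /ball /= distrC; apply: le_lt_trans rj.
  have -> : (complex.Re z - complex.Re c = complex.Re (z - c))%R by case: (z) (c) => ? ? [].
  exact: Re_le_cmod.
have -> : (complex.Im z - complex.Im c = complex.Im (z - c))%R by case: (z) (c) => ? ? [].
exact: Im_le_cmod.
Qed.

Lemma measurable_kernel c (D : set (R * R)) : measurable_fun D (fun p => kernel c p).
Proof.
apply: ge0_emeasurable_sum => [j x _ _|j _]; first exact: kernel_term_ge0.
apply/measurable_EFinP; apply: measurable_funM => //.
by apply: measurable_indic; exact: measurable_box.
Qed.

(** The term of index [j] contributes at most [2^(j+1) * 4 * 4^-j = 16 / 2^(j+1)]. *)
Lemma integral_kernel (D : set (R * R)) c : measurable D ->
  \int[mu]_(x in D) kernel c x <= 16%:E.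
Proof.
move=> mD; rewrite /kernel integral_nneseries //.
- apply: le_trans (@epsilon_trick0 R 16 xpredT _); last by [].
  apply: lee_nneseries => j; first by move=> _ _; apply: integral_ge0 => x _; exact: kernel_term_ge0.
  move=> _ .
  under eq_integral do rewrite EFinM.
  rewrite ge0_integralZl //; last first.
    by apply/measurable_EFinP; apply: measurable_funTS; apply: measurable_indic; exact: measurable_box.
  rewrite integral_indic //; last exact: measurable_box.
  apply: (@le_trans _ _ ((2 ^+ j.+1)%:E * mu (box c (2 ^- j)))).
    apply: lee_wpmul2l; first by rewrite lee_fin exprn_ge0.
    apply: le_measure; rewrite ?inE; [|exact: measurable_box|by move=> ? []].
    by apply: measurableI => //; exact: measurable_box.
  rewrite measure_box ?invr_ge0 ?exprn_ge0 // -EFinM lee_fin natrX.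
  rewrite le_eqVlt; apply/orP; left; apply/eqP; rewrite exprS.
  have : (2 ^+ j != 0 :> R)%R by rewrite expf_neq0.
  by move: (2 ^+ j)%R => y y0; field.
- move=> j; apply/measurable_EFinP; apply: measurable_funM => //.
  by apply: measurable_funTS; apply: measurable_indic; exact: measurable_box.
Qed.

(** [20 = 4 + 16], the area of the box plus the integral of the kernel. When [b > 0] the bound is
    not asked at points of [S]: the kernel is infinite there and dominates any value of [h]. *)
Lemma int_sqrt_le (N : set C) (h : C -> C) (t0 : C) (S : seq C) (a b : R) :
  (forall t, N t -> box t0 1 (complex.Re t, complex.Im t)) -> (0 <= a)%R -> (0 <= b)%R ->
  (forall t, N t -> ((0 < b)%R -> t \notin S) -> (Num.sqrt (cmod (h t)) <= a + b * inv_dist_sum S t)%R) ->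
  int_sqrt N h <= ((a + b * (size S)%:R) * 20)%:E.
Proof.
move=> Nbox a0 b0 Hh.
pose g (p : R * R) : \bar R := a%:E + b%:E * \sum_(c <- S) (1 + kernel c p).
have k10 c p : 0 <= 1 + kernel c p by apply: adde_ge0 => //; exact: kernel_ge0.
have sum0 p : 0 <= \sum_(c <- S) (1 + kernel c p) by apply: sume_ge0.
have g0 p : 0 <= g p by rewrite adde_ge0 ?lee_fin // mule_ge0 ?lee_fin.
have mB : measurable (box t0 1) by exact: measurable_box.
have mk c : measurable_fun (box t0 1) (fun p => 1 + kernel c p).
  by apply: emeasurable_funD => //; apply: measurable_funTS; exact: measurable_kernel.
have ms : measurable_fun (box t0 1) (fun p => \sum_(c <- S) (1 + kernel c p)) by exact: emeasurable_sum.
apply: (@le_trans _ _ (\int[mu]_(p in box t0 1) g p)).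
  rewrite /int_sqrt; apply: integral_le_nonmeas => //.
  - by move=> [x y] /= Nxy; exact: Nbox Nxy.
  - move=> [x y] /= Nxy; rewrite cabsE; set t := (x +i* y)%C.
    have [/andP[bp tS]|H] := boolP ((0 < b)%R && (t \in S)).
      rewrite /g (perm_big _ (perm_to_rem tS)) big_cons /=.
      set v := Num.sqrt _.
      apply: (@le_trans _ _ (b%:E * (v / b)%:E)).
        by rewrite -EFinM lee_fin mulrC divfK ?gt_eqF.
      apply: (@le_trans _ _ (b%:E * kernel t (x, y))).
        by apply: lee_wpmul2l; rewrite ?lee_fin //; exact: (@kernel_center t).
      apply: le_trans (leeDr _ _); last by rewrite lee_fin.
      apply: lee_wpmul2l; rewrite ?lee_fin //.
      apply: (@le_trans _ _ (1 + kernel t (x, y))); first by rewrite leeDr.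
      by rewrite leeDl // sume_ge0.
    have /(Hh _ Nxy) : ((0 < b)%R -> t \notin S) by move: H; rewrite negb_and => /orP[/negP|].
    rewrite -lee_fin => /le_trans; apply.
    rewrite EFinD EFinM /g; apply: leeD => //; apply: lee_wpmul2l; rewrite ?lee_fin //.
    rewrite /inv_dist_sum -sumEFin; apply: lee_sum => c _; exact: (inv_dist_le_kernel c t).
rewrite /g ge0_integralD //; [|by move=> p _; rewrite mule_ge0 ?lee_fin|exact: measurable_funeM].
rewrite ge0_integralZl ?lee_fin //.
rewrite ge0_integral_sum // integral_cst //= measure_box // expr1n mulr1.
apply: (@le_trans _ _ (a%:E * 4%:E + b%:E * \sum_(c <- S) 20%:E)); last first.
  rewrite sumEFin -!EFinM -EFinD lee_fin big_const_seq count_predT iter_addr_0 -[(20 *+ _)%R]mulr_natl.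
  have : (0 <= b * (size S)%:R)%R by rewrite mulr_ge0.
  lra.
apply: leeD => //; apply: lee_wpmul2l; rewrite ?lee_fin //; apply: lee_sum => c _.
rewrite ge0_integralD //; [|by move=> p _; exact: kernel_ge0|exact: measurable_kernel].
rewrite integral_cst //= measure_box // expr1n mulr1 mul1e.
have -> : 20%:E = 4%:E + 16%:E :> \bar R by rewrite -EFinD; congr (_%:E); ring.
by apply: leeD => //; exact: integral_kernel.
Qed.

End Integrals.

(** * The Fatou set *)

Section Charts.
Variable R : realType.
Local Notation C := R[i].
Local Notation Co := (R[i]^o).
Local Notation sphere := (one_point_compactification Co).
Implicit Types (z w t : C) (U : set sphere).

Lemma open_Some U z : open U -> U (Some z) -> exists2 r : R, 0 < r & forall w, disc z r w -> U (Some w).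
Proof.
move=> oU Uz; have /nbhs_Some [r r0 Hr] : nbhs (Some z : sphere) U by exact: open_nbhs_nbhs.
by exists r.
Qed.

Lemma holo_Some t : holomorphic_at (fun z : Co => Some z : sphere) t.
Proof.
split; first by move=> P /nbhs_Some /nbhs_cnbhs.
by apply/cderivableP; exists 1; apply: cder_id.
Qed.

Lemma open_cnbhs (V : set Co) : (forall t, V t -> cnbhs t V) -> open V.
Proof. by move=> H; rewrite openE => t /H /nbhs_cnbhs. Qed.

Lemma open_disc z (r : R) : open (disc z r : set Co).
Proof. by apply: open_cnbhs => t; exact: cnbhs_disc_in. Qed.

Lemma coord_Some U : open U ->
  local_coordinate U ((fun z => U (Some z)) : set Co) (fun z : Co => Some z : sphere).
Proof.
move=> oU; split.
- by apply: open_cnbhs => t /(open_Some oU) [r r0 Hr]; exists r => // w; exact: Hr.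
- by move=> x y _ _ [].
- by move=> _ [t Ut <-].
- by move=> t _; exact: holo_Some.
Qed.

Lemma qd_coef_Some (h : C -> C) t : qd_coef (h : Co -> Co) (fun z : Co => Some z : sphere) t = h t.
Proof.
rewrite qdE; have -> : acoord (fun z : Co => Some z : sphere) = id :> (C -> C) by [].
by rewrite /c1der (cderE (cder_id t)) expr1n mulr1.
Qed.

Definition inv_coord : Co -> sphere := @sphere_inv R \o Some.

Lemma inv_coord0 : inv_coord 0 = None.
Proof. by rewrite /inv_coord /= eqxx. Qed.

Lemma inv_coordE t : t != 0 -> inv_coord t = Some t^-1.
Proof. by rewrite /inv_coord /= => /negbTE ->. Qed.

Lemma near0_inv (M : R) : 0 < M -> forall t, disc 0 M^-1 t -> t != 0 -> M < cmod t^-1.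
Proof.
move=> M0 t; rewrite /disc subr0 => tM t0.
have ct : 0 < cmod t by rewrite cmod_gt0.
by rewrite cmodV -[M]invrK ltf_pV2 ?posrE ?invr_gt0.
Qed.

Lemma inv_coord_nbhs t U : nbhs (inv_coord t) U -> \forall s \near cnbhs t, U (inv_coord s).
Proof.
have [->|t0] := eqVneq t 0.
  rewrite inv_coord0 => NU; have [M M0 HM] := nbhs_infty NU.
  have UN : U None by case: NU => K [_ _]; apply; right.
  exists M^-1; first by rewrite invr_gt0.
  move=> s sM; have [->|s0] := eqVneq s 0; first by rewrite inv_coord0.
  by rewrite inv_coordE //; apply: HM; apply: near0_inv.
rewrite inv_coordE // => /nbhs_Some H.
have cV := ctsV t0 (@cts_id _ t).
have [r r0 Hr] := H.
apply: filterS2 (near_neq0 (@cts_id _ t) t0) (cV r r0) => s s0 Hs; rewrite inv_coordE //; apply: Hr; exact: Hs.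
Qed.

Lemma inv_coord_holo t : holomorphic_at inv_coord t.
Proof.
split; first by move=> U /inv_coord_nbhs /nbhs_cnbhs.
have [->|t0] := eqVneq t 0.
  rewrite inv_coord0; apply/cderivableP; exists 1; apply: cder_ext (cder_id 0) => s /=.
  by rewrite /inv_coord /=; case: eqVneq => //= s0; rewrite invr_eq0 (negbTE s0) /= invrK.
rewrite inv_coordE //; apply/cderivableP.
exists (- 1 / t ^+ 2); apply: cder_near (cderV t0 (cder_id t)).
apply: filterS (near_neq0 (@cts_id _ t) t0) => s s0.
by rewrite /= inv_coordE.
Qed.

Lemma coord_inv U : open U -> local_coordinate U ((fun t => U (inv_coord t)) : set Co) inv_coord.
Proof.
move=> oU; split.
- by apply: open_cnbhs => t Ut; apply: inv_coord_nbhs; exact: open_nbhs_nbhs.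
- move=> x y _ _; rewrite /inv_coord /=; case: eqVneq => [->|x0]; case: eqVneq => [->|y0] //.
  by case=> /invr_inj.
- by move=> _ [t Ut <-].
- by move=> t _; exact: inv_coord_holo.
Qed.

Lemma qd_coef_inv (h : C -> C) t : t != 0 -> qd_coef (h : Co -> Co) inv_coord t = h t^-1 / t ^+ 4.
Proof.
move=> t0; rewrite qdE.
have -> : acoord inv_coord t = t^-1 by rewrite /acoord inv_coordE.
have -> : c1der (acoord inv_coord) t = - 1 / t ^+ 2.
  apply: cderE; apply: cder_near (cderV t0 (cder_id t)).
  apply: filterS (near_neq0 (@cts_id _ t) t0) => s s0.
  by rewrite /acoord /= inv_coordE.
by field.
Qed.

Lemma disc_box t0 (r : R) t : r <= 1 -> disc t0 r t -> box t0 1 (complex.Re t, complex.Im t).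
Proof.
move=> r1; rewrite /disc => Ht.
split; rewrite /ball /= distrC; apply: lt_le_trans r1; apply: le_lt_trans Ht.
  have -> : complex.Re t - complex.Re t0 = complex.Re (t - t0) by case: (t) (t0) => ? ? [].
  exact: Re_le_cmod.
have -> : complex.Im t - complex.Im t0 = complex.Im (t - t0) by case: (t) (t0) => ? ? [].
exact: Im_le_cmod.
Qed.

(** In the coordinate [t = 1 / z] the square root of the coefficient is at most [sqrt M / |t|], a
    single pole at [0]. Strict positivity of [b] exempts the pole itself. *)
Lemma int_sqrt_inv (h : C -> C) (r M b : R) : 0 < r -> r <= 1 -> 0 < b -> 0 <= M -> Num.sqrt M <= b ->
  (forall z, r^-1 < cmod z -> cmod (h z) * cmod z ^+ 2 <= M) ->
  (int_sqrt (disc 0%R r : set Co) (qd_coef (h : Co -> Co) inv_coord) <= (b * 20)%:E)%E.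
Proof.
move=> r0 r1 b0 M0 Mb H.
have := @int_sqrt_le R (disc 0 r) (qd_coef (h : Co -> Co) inv_coord) 0 [:: 0] 0 b.
rewrite add0r mulr1; apply.
- by move=> t; exact: disc_box.
- by [].
- exact: ltW.
move=> t Dt /(_ b0); rewrite inE => t0; rewrite add0r.
have ct : 0 < cmod t by rewrite cmod_gt0.
rewrite /inv_dist_sum big_seq1 subr0 qd_coef_inv //.
have tr : r^-1 < cmod t^-1 by apply: near0_inv; rewrite ?invr_gt0 // invrK.
have -> : cmod (h t^-1 / t ^+ 4) = cmod (h t^-1) * cmod t^-1 ^+ 2 * (cmod t)^-1 ^+ 2.
  rewrite cmodM !cmodV cmodX -mulrA -exprD exprVn //.
have ct' : 0 <= (cmod t)^-1 by rewrite invr_ge0 ltW.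
rewrite sqrtrM; last by rewrite mulr_ge0 ?cmod_ge0 ?sqr_ge0.
rewrite sqrtr_sqr ger0_norm //; apply: ler_wpM2r => //.
by apply: le_trans Mb; apply: ler_wsqrtr; exact: H.
Qed.

End Charts.

(** * Bounded orbits in the Fatou set, and sums over poles *)

Section FatouPoints.
Variable R : realType.
Local Notation C := R[i].
Local Notation Co := (R[i]^o).
Local Notation sphere := (one_point_compactification Co).
Implicit Types (z w t c : C) (U : set sphere) (n k m : nat).

Lemma sqrt1D_le (x : R) : 0 <= x -> Num.sqrt (1 + x ^+ 2) <= 1 + x.
Proof.
move=> x0; apply: le_trans (sqrtrD_le ler01 (sqr_ge0 x)) _.
by rewrite sqrtr1 sqrtr_sqr ger0_norm.
Qed.

Lemma sqrt1D_gt0 (x : R) : 0 < Num.sqrt (1 + x ^+ 2).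
Proof. by rewrite sqrtr_gt0; have := sqr_ge0 x; lra. Qed.

Lemma chordal_sym (p q : sphere) : chordal p q = chordal q p.
Proof.
case: p q => [z|] [w|] //=.
by rewrite -[cabs (z - w)]/(cmod (z - w)) cmodC [X in _ / X]mulrC.
Qed.

(** For [|w| > 2 B + 1] one has [2 |w - z| >= 1 + |w|], so the chordal distance is at least
    [1 / (1 + B)], which is the chosen [e]. *)
Lemma chordal_bounded (B : R) : 0 <= B -> exists2 e : R, 0 < e & forall z (q : sphere),
  cmod z <= B -> chordal (Some z : sphere) q < e -> exists2 w, q = Some w & cmod w <= 2 * B + 1.
Proof.
move=> B0; exists (1 / (1 + B)); first by rewrite divr_gt0 //; lra.
have B1 : 0 < 1 + B by lra.
move=> z q zB; have sz := sqrt1D_gt0 (cmod z).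
have sB : Num.sqrt (1 + cmod z ^+ 2) <= 1 + B.
  by apply: le_trans (sqrt1D_le (cmod_ge0 z)) _; lra.
case: q => [w|] /=; rewrite !cabsE => H; last first.
  exfalso; move: H; rewrite ltNge => /negP; apply.
  rewrite ler_pdivlMr // mulrAC ler_pdivrMr // mul1r.
  have := sqrt1D_gt0 (cmod z); lra.
exists w => //; rewrite leNgt; apply/negP => wB.
move: H; rewrite ltNge => /negP; apply.
have sw := sqrt1D_gt0 (cmod w).
have w1 := sqrt1D_le (cmod_ge0 w).
rewrite ler_pdivlMr ?mulr_gt0 //.
apply: (@le_trans _ _ (1 / (1 + B) * ((1 + B) * (1 + cmod w)))).
  apply: ler_wpM2l; first by rewrite divr_ge0 // ltW.
  by apply: ler_pM => //; exact: ltW.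
rewrite mulrA divfK ?gt_eqF // mul1r.
have := cmodB_le w z; rewrite cmodC; lra.
Qed.

Lemma homo_ge_id (k : nat -> nat) : {homo k : i j / (i < j)%N} -> forall n, (n <= k n)%N.
Proof.
move=> H; elim=> [//|n IH]; apply: leq_ltn_trans IH _; exact: H.
Qed.

Lemma iter_poly_sphere (f : {poly R[i]}) n z :
  iter n (poly_sphere f) (Some z : sphere) = Some (pol_iter f n).[z].
Proof.
elim: n => [|n IH]; first by rewrite /= hornerX.
by rewrite iterS IH pol_iterS horner_comp.
Qed.

Variables (d : nat) (f : {poly R[i]}) (A K R0 : R).
Hypotheses (d_ge2 : (2 <= d)%N) (deg_f : size f = d.+1).
Hypotheses (A0 : 0 <= A) (K0 : 0 <= K) (R01 : 1 <= R0).
Hypothesis esc : forall w, R0 <= cmod w ->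
   [/\ 2 * cmod w <= cmod f.[w], f^`().[w] != 0,
       cmod (w * f^`().[w] / (d%:R * f.[w]) - 1) <= A / cmod w,
       cmod (w ^+ 2 * pschw f w + (d%:R ^+ 2 - 1) / 2) <= A / cmod w
     & `|ln (cmod f.[w]) - d%:R * ln (cmod w)| <= K].

Local Notation fn := (pol_iter f).

Lemma escape_unbounded (B : R) m z : R0 < cmod (fn m).[z] ->
  exists N, forall n, (N <= n)%N -> B < cmod (fn n).[z].
Proof.
move=> Rz; have [j Hj] := exp2_small ltr01 (normr_ge0 B).
exists (j + m)%N => n jn; rewrite -(subnK (leq_trans (leq_addl j m) jn)) pol_iter_add.
apply: lt_le_trans (esc_grow R01 esc _ (ltW Rz)).
have /Hj : (j <= n - m)%N by rewrite leq_subRL ?(leq_trans (leq_addl j m) jn) // addnC.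
move: (n - m)%N => l; rewrite ltr_pdivrMr ?exprn_gt0 // mul1r => Bl.
have l0 : 0 < 2 ^+ l :> R by rewrite exprn_gt0.
apply: le_lt_trans (ler_norm B) _; apply: lt_le_trans Bl _.
by rewrite ler_peMr ?ltW //; move: R01; lra.
Qed.

(* Normality keeps a subsequence of iterates bounded near a point with bounded orbit *)
Lemma fatou_nonescaping p : fatou_set f (Some p) -> (forall k, cmod (fn k).[p] <= R0) ->
  exists2 rho : R, 0 < rho & forall z k, disc p rho z -> cmod (fn k).[z] <= R0.
Proof.
move=> [U [oU Up nf]] bp.
have [k [kinc [G HG]]] := nf id; have [W [NW HW]] := HG _ Up.
have [r1 r10 Hr1] : cnbhs p (fun w => W (Some w)) by exact/nbhs_Some.
have R00 : 0 <= R0 by move: R01; lra.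
have B10 : 0 <= R0 + 1 by lra.
have B20 : 0 <= 2 * (R0 + 1) + 1 by lra.
have [e1 e10 He1] := chordal_bounded B10.
have [e2 e20 He2] := chordal_bounded B20.
have e0 : 0 < Num.min e1 e2 by rewrite lt_min e10.
have [N HN] := HW _ e0.
have [r2 r20 Hr2] := @cts_horner _ (fn (k N)) p 1 ltr01.
exists (Num.min r1 r2); first by rewrite lt_min r10.
move=> z m; rewrite /disc lt_min => /andP[/Hr1 Wz /Hr2 zN].
rewrite leNgt; apply/negP => esc_m.
have zB : cmod (fn (k N)).[z] <= R0 + 1.
  by have := cmodB_le (fn (k N)).[z] (fn (k N)).[p]; have := bp (k N); lra.
have Gz n : (N <= n)%N -> chordal (Some (fn (k n)).[z]) (G (Some z)) < Num.min e1 e2.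
  by move=> Nn; rewrite -iter_poly_sphere; exact: HN.
(* The single iterate [f^(k N)] is bounded near [p] by continuity, which bounds the limit [G z];
   this in turn bounds all later terms of the subsequence, so [z] cannot escape. *)
have [g gE gB] : exists2 g, G (Some z) = Some g & cmod g <= 2 * (R0 + 1) + 1.
  by apply: (He1 _ _ zB); have := Gz N (leqnn N); rewrite lt_min => /andP[].
have [M HM] := escape_unbounded (2 * (2 * (R0 + 1) + 1) + 1) esc_m.
have kM : (M <= k (maxn M N))%N.
  by apply: leq_trans (homo_ge_id kinc _); exact: leq_maxl.
have := Gz _ (leq_maxr M N); rewrite gE lt_min chordal_sym => /andP[_ /(He2 _ _ gB)].
by move=> [w [<-]]; rewrite leNgt HM.
Qed.

Lemma green_nonescaping p (rho : R) : 0 < rho ->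
  (forall z k, disc p rho z -> cmod (fn k).[z] <= R0) ->
  forall z, disc p rho z -> d_dz (green f : Co -> R) z = 0.
Proof.
move=> rho0 bnd.
have g0 z : disc p rho z -> green f z = 0.
  move=> Dz; rewrite /green; apply: cvg_lim => //; rewrite deg_f /=.
  apply/cvgrPdist_le => e e0.
  have [N HN] := exp2_small e0 (ln_ge0 R01).
  exists N => // n /= /HN He; rewrite sub0r normrN.
  have dn0 : 0 < d%:R ^+ n :> R by rewrite exprn_gt0 // ltr0n (leq_trans _ d_ge2).
  have l0 : 0 <= log_plus (cabs (iter n (horner f) z)) by rewrite le_max lexx.
  rewrite ger0_norm; last by apply: mulr_ge0 => //; rewrite invr_ge0 ltW.
  apply: le_trans (ltW He); rewrite mulrC; apply: ler_pM => //.
  - rewrite /log_plus cabsE pol_iterE ge_max ln_ge0 //=.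
    have [->|w0] := eqVneq (cmod (fn n).[z]) 0; first by rewrite ln0 // ln_ge0.
    by rewrite ler_ln ?posrE ?(lt_le_trans ltr01 R01) ?bnd // lt_neqAle eq_sym w0 cmod_ge0.
  - rewrite lef_pV2 ?posrE //.
    by apply: lerXn2r; rewrite ?nnegrE ?ler0n // ler_nat.
move=> z Dz; rewrite -[RHS](mul0r 2^-1); apply: rdiff_d_dz.
apply: (@rdiff_near _ (fun=> 0)); last exact: rdiff_cst.
by apply: filterS (cnbhs_disc_in Dz) => w Dw; rewrite g0.
Qed.

(** Close to [z0], no element of [s] is nearer to [z] than [z0] is, so each term times [|z - z0|] is
    at most [1]. This is the double pole bound for Schwarzians. *)
Lemma inv_dist_sum_near (s : seq C) z0 : exists2 r : R, 0 < r & forall z, disc z0 r z -> z != z0 ->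
  z \notin s /\ inv_dist_sum s z * cmod (z - z0) <= (size s)%:R.
Proof.
elim: s => [|c s [r r0 IH]].
  by exists 1 => // z _ _; rewrite /inv_dist_sum big_nil mul0r.
have [->|cz] := eqVneq c z0.
  exists r => // z Dz zz0; have [zs H] := IH z Dz zz0.
  rewrite inE negb_or zz0 zs; split => //.
  rewrite /inv_dist_sum big_cons mulrDl mulVf; last by rewrite gt_eqF // cmod_gt0 subr_eq0.
  by rewrite -natr1 addrC lerD2r.
have cz0 : 0 < cmod (z0 - c) by rewrite cmod_gt0 subr_eq0 eq_sym.
exists (Num.min r (cmod (z0 - c) / 2)); first by rewrite lt_min r0 divr_gt0.
move=> z; rewrite /disc lt_min => /andP[Dz zc] zz0.
have [zs H] := IH z Dz zz0.
have zc0 : cmod (z - z0) <= cmod (z - c).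
  have := cmodD (z - c) (- (z - z0)); rewrite cmodN.
  have -> : z - c + - (z - z0) = z0 - c by ring.
  move: zc; lra.
have pz : 0 < cmod (z - z0) by rewrite cmod_gt0 subr_eq0.
have pc : 0 < cmod (z - c) by exact: lt_le_trans zc0.
split; first by rewrite inE negb_or zs -subr_eq0 -cmod_gt0 pc.
rewrite /inv_dist_sum big_cons mulrDl -natr1 addrC; apply: lerD => //.
by rewrite ler_pdivrMl // mulr1.
Qed.

Lemma inv_dist_sum_far (s : seq C) : exists2 rho : R, 0 < rho & forall z, rho < cmod z ->
  z \notin s /\ inv_dist_sum s z * cmod z <= 2 * (size s)%:R.
Proof.
elim: s => [|c s [r r0 IH]].
  by exists 1 => // z _; rewrite /inv_dist_sum big_nil mul0r mulr0.
have c0 := cmod_ge0 c.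
exists (r + 2 * cmod c) => [|z zr]; first by lra.
have rz : r < cmod z by lra.
have [zs H] := IH z rz.
have zc : cmod z <= 2 * cmod (z - c) by have := cmodB_le z c; lra.
have pc : 0 < cmod (z - c) by lra.
split; first by rewrite inE negb_or zs -subr_eq0 -cmod_gt0 pc.
rewrite /inv_dist_sum big_cons mulrDl /= -(natr1 (size s)) mulrDr mulr1 addrC; apply: lerD => //.
by rewrite ler_pdivrMl // mulrC.
Qed.

End FatouPoints.

(** * Excluding one-point fibres of the second iterate *)

Section Exceptional.
Variable R : realType.
Local Notation C := R[i].
Local Notation Co := (R[i]^o).
Local Notation sphere := (one_point_compactification Co).
Implicit Types (z w t a b c v : C).

Section Affine.
Variables (kap a : C).
Hypothesis kap0 : kap != 0.

Definition affine_sphere (p : sphere) : sphere :=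
  if p is Some z then Some (kap * (z - a)) else None.

Lemma affine_sphere_bij : bijective affine_sphere.
Proof.
exists (fun p : sphere => if p is Some z then Some (kap^-1 * z + a) else None) => -[z|] //=.
  by rewrite mulKf // subrK.
by rewrite addrK mulVKf.
Qed.

Lemma cder_affine z : cder (fun w => kap * (w - a)) z kap.
Proof.
rewrite -[X in cder _ _ X]mulr1; apply: cderZ; rewrite -[X in cder _ _ X]subr0.
by apply: cderB; [exact: cder_id|exact: cder_cst].
Qed.

Lemma affine_sphere_holo z : holomorphic_at (affine_sphere \o (fun w : Co => Some w : sphere)) z.
Proof.
split; last by apply/cderivableP; exists kap; apply: cder_ext (cder_affine z).
move=> U /nbhs_Some [r r0 Hr]; apply/nbhs_cnbhs.
by apply: filterS (cder_cts (cder_affine z) r0) => w Hw; exact: Hr.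
Qed.

(** In the coordinate [t = 1 / z] the map becomes [t |-> t / (kap (1 - a t))]. *)
Lemma affine_sphere_holo_inf : holomorphic_at (affine_sphere \o (@inv_coord R)) 0.
Proof.
split.
  move=> U; rewrite /= inv_coord0 /= => NU; apply/nbhs_cnbhs.
  have UN : U None by case: NU => K [_ _]; apply; right.
  have [M M0 HM] := nbhs_infty NU.
  have k0 : 0 < cmod kap by rewrite cmod_gt0.
  have M10 : 0 < M / cmod kap + cmod a.
    by apply: ltr_pwDl; [exact: divr_gt0|exact: cmod_ge0].
  exists (M / cmod kap + cmod a)^-1; first by rewrite invr_gt0.
  move=> t Dt; have [->|t0] := eqVneq t 0; first by rewrite /= inv_coord0.
  rewrite /= inv_coordE //=; apply: HM; rewrite cmodM mulrC -ltr_pdivrMr //.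
  have := near0_inv M10 Dt t0; have := cmodB_le t^-1 a; lra.
rewrite /= inv_coord0 /=; apply/cderivableP.
pose q t := kap * (1 - a * t).
have q0 : q 0 != 0 by rewrite /q mulr0 subr0 mulr1.
have [l Hl] : cderivable q 0.
  exists (kap * (0 - a * 1)); apply: cderZ; apply: cderB; first exact: cder_cst.
  by apply: cderZ; exact: cder_id.
have Hq := cderM (cder_id (0 : C)) (cderV q0 Hl).
eexists; apply: cder_near Hq.
apply: filterS (near_neq0 (cder_cts Hl) q0) => t qt.
rewrite /= /inv_coord /=; case: eqVneq => [->|t0] /=; first by rewrite mul0r.
have kt : kap * (t^-1 - a) = q t / t by rewrite /q; field.
have k1 : kap * (t^-1 - a) != 0 by rewrite kt mulf_neq0 // invr_eq0.
by rewrite (negbTE k1) /= kt invf_div.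
Qed.

Lemma affine_sphere_conformal : conformal_automorphism affine_sphere.
Proof.
split; [exact: affine_sphere_bij|exact: affine_sphere_holo|exact: affine_sphere_holo_inf].
Qed.

End Affine.

Variables (d : nat) (f : {poly R[i]}).
Hypotheses (d_ge2 : (2 <= d)%N) (deg_f : size f = d.+1).

Lemma size_fB w : size (f - w%:P) = d.+1.
Proof.
rewrite size_polyDl ?deg_f // size_polyN; apply: leq_ltn_trans (size_polyC_leq1 _) _.
by rewrite ltnS ltnW.
Qed.

Lemma fB_neq0 w : f - w%:P != 0.
Proof. by rewrite -size_poly_eq0 size_fB. Qed.

Lemma lead_fB w : lead_coef (f - w%:P) = lead_coef f.
Proof.
rewrite lead_coefDl // size_polyN deg_f; apply: leq_ltn_trans (size_polyC_leq1 _) _.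
by rewrite ltnS ltnW.
Qed.

Lemma fB_root w s z : f - w%:P = lead_coef (f - w%:P) *: lin_prod s -> (f.[z] == w) = (z \in s).
Proof.
move=> E; have := congr1 (fun p : {poly R[i]} => root p z) E.
rewrite rootZ ?lead_coef_eq0 ?fB_neq0 // /lin_prod root_prod_XsubC => <-.
by rewrite /root hornerD hornerN hornerC subr_eq0.
Qed.

Lemma preimage w : exists z, f.[z] = w.
Proof.
have [s E] := poly_factor (f - w%:P).
have := size_factor (fB_neq0 w) E; rewrite size_fB /=; case: s E => [|z s] E ss.
  by move: d_ge2; rewrite -ss.
by exists z; apply/eqP; rewrite (fB_root z E) inE eqxx.
Qed.

Lemma totally_ramified a : (forall b, f.[b] = f.[a] -> b = a) ->
  f = lead_coef f *: ('X - a%:P) ^+ d + f.[a]%:P.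
Proof.
move=> H; have [s E] := poly_factor (f - f.[a]%:P).
have ss := size_factor (fB_neq0 f.[a]) E; rewrite size_fB /= in ss.
have sE : s = nseq d a.
  rewrite -ss; apply/all_pred1P/allP => b bs /=; apply/eqP/H/eqP.
  by rewrite (fB_root b E).
rewrite -[LHS](subrK f.[a]%:P); congr (_ + _); rewrite {1}E lead_fB sE; congr (_ *: _).
by rewrite /lin_prod big_nseq iter_mulr_1.
Qed.

(* If [f \o f] takes the value [f (f a)] only at [a], then [f] is totally ramified over
   both [f a] and [f (f a)]; comparing critical points gives [f a = a], and [f] is affinely
   conjugate to a power. *)
Lemma nonexceptional : ~ conformally_conjugate (@poly_sphere R f) (@poly_sphere R 'X^d) ->
  forall a, exists2 b, b != a & (f \Po f).[b] = (f \Po f).[a].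
Proof.
move=> nconj a; apply: contrapT => nb; apply: nconj.
have Ha b : f.[f.[b]] = f.[f.[a]] -> b = a.
  move=> E; apply/eqP/negPn/negP => ba; apply: nb; exists b => //.
  by rewrite !horner_comp.
have E1 : f = lead_coef f *: ('X - a%:P) ^+ d + f.[a]%:P.
  by apply: totally_ramified => b E; apply: Ha; rewrite E.
set v := f.[a] in E1.
have E2 : f = lead_coef f *: ('X - v%:P) ^+ d + f.[v]%:P.
  apply: totally_ramified => w Ew; have [b Eb] := preimage w.
  by rewrite -Eb (Ha b) // Eb.
have l0 : lead_coef f != 0 := lam_neq0 deg_f.
have va : v = a.
  (* The derivative at [a] is [0] according to [E1], and [lam d (a - v)^(d-1)] according to [E2]. *)
  have D1 c e : f = lead_coef f *: ('X - c%:P) ^+ d + e%:P ->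
      f^`().[a] = lead_coef f * ((a - c) ^+ d.-1 *+ d).
    move=> E; rewrite {1}E derivD derivC addr0 derivZ deriv_exp derivXsubC mul1r.
    by rewrite hornerZ hornerMn horner_exp hornerXsubC.
  have := D1 _ _ E2; rewrite (D1 _ _ E1) subrr expr0n.
  have -> : (d.-1 == 0)%N = false by case: (d) d_ge2 => [|[]].
  rewrite mul0rn mulr0 => /esym /eqP; rewrite mulf_eq0 (negbTE l0) /= -mulr_natl mulf_eq0.
  by rewrite (negbTE (dC_neq0 R d_ge2)) expf_eq0 subr_eq0 => /andP[_ /eqP].
have d1 : (0 < d.-1)%N by case: (d) d_ge2 => [|[]].
(* In the coordinate [w = kap (z - a)] the map [f] becomes [lam kap^(1-d) w^d], so [kap^(d-1) = lam]
   is required. *)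
pose kap := d.-1.-root (lead_coef f).
have kE : kap ^+ d.-1 = lead_coef f by exact: rootCK.
have kap0 : kap != 0 by apply: contraNneq l0 => k0; rewrite -kE k0 expr0n -(prednK d1).
exists (affine_sphere kap a); split; first exact: affine_sphere_conformal.
move=> [z|] //=; congr Some.
rewrite {1}E1 va hornerD hornerC hornerZ horner_exp hornerXsubC addrK hornerXn.
rewrite exprMn mulrA -kE -exprS prednK // (leq_trans _ d_ge2) //.
Qed.

End Exceptional.

(** * Local charts adapted to the estimates, and poles of Schwarzians *)

Section Convergence.
Variable R : realType.
Local Notation C := R[i].
Local Notation Co := (R[i]^o).
Local Notation sphere := (one_point_compactification Co).
Implicit Types (z w t c : C) (U : set sphere) (n k m : nat) (h : C -> C).

Lemma int_sqrt_ge0 (N : set Co) (h : Co -> Co) : (0 <= int_sqrt N h)%E.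
Proof. by apply: integral_ge0 => x _; rewrite lee_fin sqrtr_ge0. Qed.

Lemma vanishing_cvge (u : nat -> \bar R) (e : nat -> R) : (forall n, 0 <= u n)%E -> vanishing e ->
  (exists N, forall n, (N <= n)%N -> (u n <= (e n)%:E)%E) -> u @ \oo --> 0%E.
Proof.
move=> u0 He [N HN].
apply: (@squeeze_cvge _ _ _ _ (fun=> 0%E) _ (fun n => (e n)%:E)).
- by exists N => // n /= Nn; rewrite u0 HN.
- exact: cvg_cst.
apply/cvg_EFin; first by apply: nearW.
apply/cvgrPdist_le => x /He [M HM]; exists (maxn M N) => // n /=; rewrite geq_max => /andP[Mn Nn].
have e0 : 0 <= e n by rewrite -lee_fin; exact: le_trans (u0 n) (HN n Nn).
by rewrite sub0r normrN ger0_norm //; exact: HM.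
Qed.

Lemma qd_coefB (h1 h2 : Co -> Co) (psi : Co -> sphere) :
  (fun t => qd_coef h1 psi t - qd_coef h2 psi t) = qd_coef (fun z => h1 z - h2 z) psi.
Proof. by apply/funext => t; rewrite /qd_coef mulrBl. Qed.

(** The chart and the neighbourhood are fixed before [h], [S], [a] and [b]: a single chart has to
    serve all differentials of the sequence. *)
Lemma chart_fin U z0 (r : R) : open U -> U (Some z0) -> 0 < r ->
  exists (V : set Co) (psi : Co -> sphere) (t : Co) (N : set Co), [/\ local_coordinate U V psi, V t /\ psi t = Some z0,
    [/\ open N, N t & N `<=` V] &
    forall h S (a b : R), 0 <= a -> 0 <= b ->
      (forall z, disc z0 r z -> Num.sqrt (cmod (h z)) <= a + b * inv_dist_sum S z) ->
      (int_sqrt N (qd_coef (h : Co -> Co) psi) <= ((a + b * (size S)%:R) * 20)%:E)%E].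
Proof.
move=> oU Uz r0; have [s s0 Hs] := open_Some oU Uz.
pose q := Num.min r (Num.min s 1).
have q0 : 0 < q by rewrite !lt_min r0 s0 ltr01.
have qle : [/\ q <= r, q <= s & q <= 1].
  by split; rewrite /q !ge_min lexx ?orbT.
case: qle => qr qs q1.
exists ((fun z => U (Some z)) : set Co), (fun z : Co => Some z : sphere), z0, (disc z0 q : set Co).
split; [exact: coord_Some|by []| |].
  split; [exact: open_disc|exact: disc_center|].
  by move=> z Dz; apply: Hs; exact: lt_le_trans Dz qs.
move=> h S a b a0 b0 H; apply: (int_sqrt_le (t0 := z0)) => //.
  by move=> t; exact: disc_box.
move=> t Dt _; rewrite qd_coef_Some; apply: H; exact: lt_le_trans Dt qr.
Qed.

Lemma chart_inf U (r : R) : open U -> U None -> 0 < r ->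
  exists (V : set Co) (psi : Co -> sphere) (t : Co) (N : set Co), [/\ local_coordinate U V psi, V t /\ psi t = None,
    [/\ open N, N t & N `<=` V] &
    forall h (M b : R), 0 < b -> 0 <= M -> Num.sqrt M <= b ->
      (forall z, r < cmod z -> cmod (h z) * cmod z ^+ 2 <= M) ->
      (int_sqrt N (qd_coef (h : Co -> Co) psi) <= (b * 20)%:E)%E].
Proof.
move=> oU UN r0.
have [s s0 Hs] : cnbhs 0 (fun t => U (@inv_coord R t)).
  by apply: inv_coord_nbhs; rewrite inv_coord0; exact: open_nbhs_nbhs.
pose q := Num.min r^-1 (Num.min s 1).
have q0 : 0 < q by rewrite !lt_min invr_gt0 r0 s0 ltr01.
have qle : [/\ q <= r^-1, q <= s & q <= 1].
  by split; rewrite /q !ge_min lexx ?orbT.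
case: qle => qr qs q1.
exists ((fun t => U (inv_coord t)) : set Co), (@inv_coord R), 0, (disc 0 q : set Co).
split; [exact: coord_inv|by split; rewrite ?inv_coord0| |].
  split; [exact: open_disc|exact: disc_center|].
  by move=> z; rewrite /disc subr0 => Dz; apply: Hs; rewrite subr0; exact: lt_le_trans Dz qs.
move=> h M b b0 M0 Mb H; apply: (int_sqrt_inv q0 q1 b0 M0 Mb) => z zq; apply: H.
by apply: le_lt_trans zq; rewrite -[r]invrK lef_pV2 ?posrE ?invr_gt0.
Qed.

Lemma open_fatou (f : {poly R[i]}) : open (fatou_set f).
Proof.
rewrite openE => p [U [oU Up nf]]; apply: filterS (open_nbhs_nbhs (conj oU Up)) => q Uq.
by exists U.
Qed.

Lemma cderivable_pschw (p : {poly R[i]}) c z : p^`().[z] != 0 -> cderivable (fun w => pschw p w / c) z.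
Proof.
move=> pz; rewrite /pschw.
have iv := cderV pz (cder_horner p^`() z).
have D1 := cderM (cder_horner p^`()^`()^`() z) iv.
have D2 := cderM (cder_horner p^`()^`() z) iv.
have D3 := cderB D1 (cderZ (3 / 2) (cderX 2 D2)).
by eexists; apply: cderM D3 (cder_cst c^-1 z).
Qed.

Lemma deriv_neq0_lin (p : {poly R[i]}) s z : p != 0 -> p = lead_coef p *: lin_prod s ->
  z \notin s -> p.[z] != 0.
Proof.
move=> p0 E zs; have : ~~ root p z by rewrite E rootZ ?lead_coef_eq0 // /lin_prod root_prod_XsubC.
by [].
Qed.

Lemma pschw_near (p : {poly R[i]}) c z0 : p^`() != 0 -> exists M : R,
  \forall z \near cnbhs z0, z != z0 ->
    cderivable (fun w => pschw p w / c) z /\ cmod (pschw p z / c) * cmod (z - z0) ^+ 2 <= M.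
Proof.
move=> p0; have [s E] := poly_factor p^`(); have [r r0 Hr] := inv_dist_sum_near s z0.
exists (3 / 2 * (size s)%:R ^+ 2 * (cmod c)^-1), r => // z Dz zz0.
have [zs H] := Hr z Dz zz0.
split; first by apply: cderivable_pschw; exact: deriv_neq0_lin E zs.
rewrite cmodM cmodV mulrAC; apply: ler_wpM2r; first by rewrite invr_ge0 cmod_ge0.
apply: (@le_trans _ _ (3 / 2 * inv_dist_sum s z ^+ 2 * cmod (z - z0) ^+ 2)).
  by apply: ler_wpM2r; [exact: sqr_ge0|exact: pschw_le].
rewrite -mulrA -exprMn; apply: ler_wpM2l; first by lra.
rewrite lerXn2r // nnegrE ?ler0n // mulr_ge0 ?inv_dist_sum_ge0 ?cmod_ge0 //.
Qed.

Lemma pschw_far (p : {poly R[i]}) c : p^`() != 0 -> exists rho M : R, 0 < rho /\ forall z, rho < cmod z ->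
    cderivable (fun w => pschw p w / c) z /\ cmod (pschw p z / c) * cmod z ^+ 2 <= M.
Proof.
move=> p0; have [s E] := poly_factor p^`(); have [r r0 Hr] := inv_dist_sum_far s.
exists r, (3 / 2 * (2 * (size s)%:R) ^+ 2 * (cmod c)^-1); split => // z rz.
have [zs H] := Hr z rz.
split; first by apply: cderivable_pschw; exact: deriv_neq0_lin E zs.
rewrite cmodM cmodV mulrAC; apply: ler_wpM2r; first by rewrite invr_ge0 cmod_ge0.
apply: (@le_trans _ _ (3 / 2 * inv_dist_sum s z ^+ 2 * cmod z ^+ 2)).
  by apply: ler_wpM2r; [exact: sqr_ge0|exact: pschw_le].
rewrite -mulrA -exprMn; apply: ler_wpM2l; first by lra.
by rewrite lerXn2r // nnegrE ?mulr_ge0 ?ler0n ?inv_dist_sum_ge0 ?cmod_ge0.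
Qed.

End Convergence.

(** * Convergence on the Fatou set *)

Section Main.
Variable R : realType.
Local Notation C := R[i].
Local Notation Co := (R[i]^o).
Local Notation sphere := (one_point_compactification Co).
Implicit Types (z w t c p : C) (n k m : nat).
Variables (d : nat) (f : {poly R[i]}) (A K R0 : R).
Hypotheses (d_ge2 : (2 <= d)%N) (deg_f : size f = d.+1).
Hypotheses (A0 : 0 <= A) (K0 : 0 <= K) (R01 : 1 <= R0).
Hypothesis esc : forall w, R0 <= cmod w ->
   [/\ 2 * cmod w <= cmod f.[w], f^`().[w] != 0,
       cmod (w * f^`().[w] / (d%:R * f.[w]) - 1) <= A / cmod w,
       cmod (w ^+ 2 * pschw f w + (d%:R ^+ 2 - 1) / 2) <= A / cmod w
     & `|ln (cmod f.[w]) - d%:R * ln (cmod w)| <= K].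
Hypothesis nonexc : forall a : C, exists2 b, b != a & (f \Po f).[b] = (f \Po f).[a].

Local Notation fn := (pol_iter f).
Local Notation F := (fatou_set f).

Definition schw_qd n z : C := pschw (fn n) z / d%:R ^+ (2 * n).

Definition green_qd z : C := - 2 * d_dz (green f : Co -> R) z ^+ 2.

Let green_esc z : d_dz (green f : Co -> R) z = logd d f z / 2 -> green_qd z = - (logd d f z ^+ 2 / 2).
Proof. by rewrite /green_qd => ->; field. Qed.

Lemma fatou_cases p : F (Some p) -> (exists m, R0 < cmod (fn m).[p]) \/
  exists2 rho : R, 0 < rho & forall z k, disc p rho z -> cmod (fn k).[z] <= R0.
Proof.
move=> Fp; have [[m Hm]|H] := pselect (exists m, R0 < cmod (fn m).[p]); first by left; exists m.
right; apply: (fatou_nonescaping R01 esc Fp) => k.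
by rewrite leNgt; apply/negP => Rk; apply: H; exists k.
Qed.

Lemma green_qd_near p : F (Some p) -> exists (r M : R), [/\ 0 < r, 0 <= M & forall z, disc p r z ->
  cderivable green_qd z /\ cmod (green_qd z) <= M].
Proof.
case/fatou_cases => [[m Rm]|[rho rho0 bnd]].
  have [r [M [r0 M0 H]]] := green_basin d_ge2 deg_f A0 K0 R01 esc Rm.
  exists r, (M ^+ 2 / 2); split => //; first by rewrite divr_ge0 ?sqr_ge0.
  move=> z Dz; have [_ [l Hl] Ml _ /green_esc gE] := H z Dz.
  split.
    have D := cderN (cderM (cderX 2 Hl) (cder_cst (2^-1 : C) z)).
    eexists; apply: cder_near D.
    apply: filterS (cnbhs_disc_in Dz) => w Dw; have [_ _ _ _ /green_esc ->] := H w Dw.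
    by [].
  rewrite gE cmodN cmodM cmodX cmodV cmod_nat; apply: ler_wpM2r; first by rewrite invr_ge0.
  by rewrite lerXn2r // nnegrE cmod_ge0.
have g0 := green_nonescaping d_ge2 deg_f R01 rho0 bnd.
have E z : disc p rho z -> green_qd z = 0.
  by move=> Dz; rewrite /green_qd g0 // expr0n mulr0.
exists rho, 0; split => // z Dz; split; last by rewrite E // cmod0.
exists 0; apply: cder_near (cder_cst 0 z).
by apply: filterS (cnbhs_disc_in Dz) => w Dw; rewrite E.
Qed.

Lemma green_qd_far z : R0 < cmod z -> [/\ cderivable green_qd z,
  green_qd z = - (logd d f z ^+ 2 / 2) & cmod (green_qd z) * cmod z ^+ 2 <= expR (2 * A) ^+ 2].
Proof.
move=> Rz; have Rz0 : R0 < cmod (fn 0).[z] by rewrite hornerX.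
have [r [M [r0 M0 H]]] := green_basin d_ge2 deg_f A0 K0 R01 esc Rz0.
have [_ [l Hl] _ _ /green_esc gE] := H z (disc_center z r0).
split => //.
  have D := cderN (cderM (cderX 2 Hl) (cder_cst (2^-1 : C) z)).
  eexists; apply: cder_near D.
  apply: filterS (cnbhs_disc_in (disc_center z r0)) => w Dw.
  by have [_ _ _ _ /green_esc ->] := H w Dw.
have := logd_bound d_ge2 A0 R01 esc (ltW Rz); rewrite cmodM => B.
rewrite gE cmodN cmodM cmodX cmodV cmod_nat mulrAC -exprMn mulrC [cmod (logd _ _ _) * _]mulrC.
have X0 : 0 <= cmod z * cmod (logd d f z) by rewrite mulr_ge0 ?cmod_ge0.
have XB : (cmod z * cmod (logd d f z)) ^+ 2 <= expR (2 * A) ^+ 2.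
  by rewrite lerXn2r // nnegrE // expR_ge0.
have := sqr_ge0 (cmod z * cmod (logd d f z)); lra.
Qed.

Lemma deriv_iter_neq0 n : (fn n)^`() != 0.
Proof.
have Rz : R0 <= cmod (R0%:C%C : C) by rewrite cmod_real ler_norm.
by apply: contraNneq (esc_deriv_neq0 R01 esc n Rz) => ->; rewrite horner0.
Qed.

Lemma schw_qd_mero n : meromorphic_qd F (schw_qd n : Co -> Co).
Proof.
move=> V psi Vpsi t Vt; case E : (psi t) => [z0|].
  have [M H] := pschw_near (d%:R ^+ (2 * n)) z0 (deriv_iter_neq0 n).
  exact: (meromorphic_qd_fin Vpsi Vt E H).
have [rho [M [rho0 H]]] := pschw_far (d%:R ^+ (2 * n)) (deriv_iter_neq0 n).
exact: (meromorphic_qd_inf Vpsi Vt E H).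
Qed.

Lemma green_qd_mero : meromorphic_qd F (green_qd : Co -> Co).
Proof.
move=> V psi Vpsi t Vt; case E : (psi t) => [z0|].
  have Fz : F (Some z0) by case: Vpsi => _ _ im _; apply: im; exists t.
  have [r [M [r0 M0 H]]] := green_qd_near Fz.
  apply: (@meromorphic_qd_fin _ _ _ _ _ _ _ 0 M Vpsi Vt E).
  by exists r => // z Dz _; rewrite expr0 mulr1; exact: H.
apply: (@meromorphic_qd_inf _ _ _ _ _ _ R0 (expR (2 * A) ^+ 2) Vpsi Vt E) => z Rz.
by have [] := green_qd_far Rz.
Qed.

Let sqrtE_lt (x : R) : (x%:E < +oo)%E. Proof. exact: ltry. Qed.

Lemma schw_qd_int n : L12_loc_integrable F (schw_qd n : Co -> Co).
Proof.
move=> [p|] Fp.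
  have [V [psi [t [N [H1 H2 H3 H4]]]]] := chart_fin (@open_fatou _ f) Fp (@ltr01 R).
  exists V, psi, t, N; split => //.
  have [s E] := poly_factor (fn n)^`().
  pose b := 2 * Num.sqrt (cmod (d%:R ^+ (2 * n) : C))^-1.
  have b0 : 0 <= b by rewrite mulr_ge0 ?sqrtr_ge0.
  apply: le_lt_trans (H4 _ s 0 b (lexx 0) b0 _) (sqrtE_lt _) => z _.
  rewrite add0r /schw_qd cmodM cmodV sqrtrM ?cmod_ge0 // mulrC /b [2 * _]mulrC -mulrA.
  by apply: ler_wpM2l; [exact: sqrtr_ge0|exact: sqrt_pschw_le].
have [rho [M [rho0 H]]] := pschw_far (d%:R ^+ (2 * n)) (deriv_iter_neq0 n).
have [V [psi [t [N [H1 H2 H3 H4]]]]] := chart_inf (@open_fatou _ f) Fp rho0.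
exists V, psi, t, N; split => //.
pose M' := Num.max 0 M; have M'0 : 0 <= M' by rewrite le_max lexx.
have b0 : 0 < Num.sqrt M' + 1 by apply: ltr_wpDl => //; exact: sqrtr_ge0.
have bM : Num.sqrt M' <= Num.sqrt M' + 1 by rewrite lerDl.
apply: le_lt_trans (H4 _ _ _ b0 M'0 bM _) (sqrtE_lt _) => z /H [_ HM].
by apply: le_trans HM _; rewrite le_max lexx orbT.
Qed.

Lemma green_qd_int : L12_loc_integrable F (green_qd : Co -> Co).
Proof.
move=> [p|] Fp.
  have [r [M [r0 M0 H]]] := green_qd_near Fp.
  have [V [psi [t [N [H1 H2 H3 H4]]]]] := chart_fin (@open_fatou _ f) Fp r0.
  exists V, psi, t, N; split => //.
  apply: le_lt_trans (H4 _ [::] (Num.sqrt M) 0 (sqrtr_ge0 _) (lexx 0) _) (sqrtE_lt _) => z /H [_ HM].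
  by rewrite mul0r addr0; exact: ler_wsqrtr.
have R00 : 0 < R0 by move: R01; lra.
have [V [psi [t [N [H1 H2 H3 H4]]]]] := chart_inf (@open_fatou _ f) Fp R00.
exists V, psi, t, N; split => //.
have B0 : 0 < expR (2 * A) := expR_gt0 _.
have bM : Num.sqrt (expR (2 * A) ^+ 2) <= expR (2 * A) by rewrite sqrtr_sqr ger0_norm // ltW.
apply: le_lt_trans (H4 _ _ _ B0 (sqr_ge0 _) bM _) (sqrtE_lt _) => z Rz.
by have [] := green_qd_far Rz.
Qed.

(** A common form for both kinds of points. In the basin [S] is fixed and [a], [b] decrease, while
    around bounded orbits [S] grows with [n]; only the total [a + b |S|] is asked to vanish. *)
Lemma schw_qd_near p : F (Some p) -> exists (r : R) (e : nat -> R) (m : nat),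
  [/\ 0 < r, vanishing e & forall n, (m <= n)%N -> exists (S : seq C) (a b : R),
    [/\ 0 <= a, 0 <= b, a + b * (size S)%:R <= e n & forall z, disc p r z ->
      Num.sqrt (cmod (schw_qd n z - green_qd z)) <= a + b * inv_dist_sum S z]].
Proof.
case/fatou_cases => [[m Rm]|[rho rho0 bnd]].
  have [r1 [M [r10 M0 H1]]] := green_basin d_ge2 deg_f A0 K0 R01 esc Rm.
  have [r2 [s [e [r20 ev e0 H2]]]] := schw_basin d_ge2 deg_f A0 K0 R01 esc Rm.
  exists (Num.min r1 r2), (fun n => e n + (size s)%:R * e n), m; split.
  - by rewrite lt_min r10.
  - by apply: vanishingD => //; exact: vanishingZ.
  move=> n mn; exists s, (e n), (e n); split => //; first by rewrite mulrC.
  move=> z; rewrite /disc lt_min => /andP[/H1 [_ _ _ _ /green_esc ->] D2].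
  by rewrite opprK; exact: H2.
have [r [e [r0 ev H]]] := interior_estimate d_ge2 deg_f nonexc rho0 bnd.
have g0 := green_nonescaping d_ge2 deg_f R01 rho0 bnd.
exists (Num.min r rho), e, 0%N; split => //; first by rewrite lt_min r0.
move=> n _; have [S [a [b [a0 b0 ab HS]]]] := H n.
exists S, a, b; split => // z; rewrite /disc lt_min => /andP[Dr Drho].
by rewrite /green_qd g0 // expr0n mulr0 subr0; exact: HS.
Qed.

Lemma schw_qd_cvg (q : sphere) : F q -> exists (V : set Co) (psi : Co -> sphere) (t : Co) (N : set Co),
  [/\ local_coordinate F V psi, V t /\ psi t = q, [/\ open N, N t & N `<=` V]
   & (fun n => int_sqrt N (fun t => qd_coef (schw_qd n : Co -> Co) psi t
        - qd_coef (green_qd : Co -> Co) psi t)) @ \oo --> 0%E].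
Proof.
case: q => [p|] Fp.
  have [r [e [m [r0 ev H]]]] := schw_qd_near Fp.
  have [V [psi [t [N [H1 H2 H3 H4]]]]] := chart_fin (@open_fatou _ f) Fp r0.
  exists V, psi, t, N; split => //.
  apply: (@vanishing_cvge _ _ (fun n => 20 * e n)); first by move=> n; exact: int_sqrt_ge0.
    exact: vanishingZ.
  exists m => n /H [S [a [b [a0 b0 ab HS]]]]; rewrite qd_coefB.
  apply: le_trans (H4 _ S a b a0 b0 HS) _.
  by rewrite lee_fin mulrC; apply: ler_wpM2l.
have R00 : 0 < R0 by move: R01; lra.
have [V [psi [t [N [H1 H2 H3 H4]]]]] := chart_inf (@open_fatou _ f) Fp R00.
exists V, psi, t, N; split => //.
have [M M0 HM] := schw_rate d_ge2 A0 R01 esc.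
(* [M + 1] instead of [M] makes [b n] positive, as [chart_inf] demands. *)
pose b n := Num.sqrt ((M + 1) / 2 ^+ n).
apply: (@vanishing_cvge _ _ (fun n => 20 * b n)); first by move=> n; exact: int_sqrt_ge0.
  by apply: vanishingZ => //; apply: vanishing_sqrt; apply: vanishing_exp2; lra.
exists 0%N => n _; rewrite qd_coefB.
have p0 : 0 < 2 ^+ n :> R by rewrite exprn_gt0.
have b0 : 0 < b n by rewrite sqrtr_gt0 divr_gt0 //; lra.
have Mn : 0 <= M / 2 ^+ n by rewrite divr_ge0 // ltW.
have Mb : Num.sqrt (M / 2 ^+ n) <= b n.
  by apply: ler_wsqrtr; apply: ler_wpM2r; [rewrite invr_ge0 ltW|lra].
rewrite mulrC; apply: H4 b0 Mn Mb _ => z Rz.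
by have [_ -> _] := green_qd_far Rz; rewrite opprK; apply: HM; exact: ltW.
Qed.

End Main.

Theorem corollary3p4 (R : realType) (d : nat) (f : {poly R[i]})
  (d_ge2 : (2 <= d)%N) (deg_f : size f = d.+1)
  (f_not_power : ~ conformally_conjugate (poly_sphere f) (poly_sphere 'X^d)) :
  L12_loc_cvg (fatou_set f)
    (fun n z => schwarzian (iter n (horner f)) z / d%:R ^+ (2 * n))
    (fun z => - 2 * d_dz (green f) z ^+ 2).
Proof.
have [A [K [R0 [A0 K0 R01 esc]]]] := escape_constants d_ge2 deg_f.
have nonexc := nonexceptional d_ge2 deg_f f_not_power.
have -> : (fun n z => schwarzian (iter n (horner f)) z / d%:R ^+ (2 * n)) = schw_qd d f.
  by apply/funext => n; apply/funext => z; rewrite pol_iterE schwarzian_horner.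
split.
- by move=> n; split; [exact: (schw_qd_mero R01 esc)|exact: (schw_qd_int R01 esc)].
- split; [exact: (green_qd_mero d_ge2 deg_f A0 K0 R01 esc)|].
  exact: (green_qd_int d_ge2 deg_f A0 K0 R01 esc).
- move=> p Fp; exact: (schw_qd_cvg d_ge2 deg_f A0 K0 R01 esc nonexc Fp).
Qed.
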